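(* Let $\Delta=(\delta_1,\dots,\delta_k)$, $\delta_i\in\mathbb{Z}^n$, be a toric degree, and let $(t_m)_{m\in\mathbb{N}}$ be a sequence of positive real numbers converging to $+\infty$. For a sequence of complex rational curves $f_m:S_m\to(\mathbb{C}^\times)^n$ of toric degree $\Delta$, set $$\mathcal{A}_m:=\operatorname{Log}_{t_m}(f_m(S_m))=\frac{1}{\log(t_m)}\operatorname{Log}(f_m(S_m))\subset\mathbb{R}^n .$$ (a) Any sequence of complex rational curves $f_m:S_m\to(\mathbb{C}^\times)^n$ of toric degree $\Delta$ contains a subsequence such that the sets $\mathcal{A}_m$ converge to a Hausdorff limit $A\subset\mathbb{R}^n$ (including $A=\emptyset$). (b) In this case, the Hausdorff limit $A$ is of the form $$A=h_1(\Gamma_1)\cup\dots\cup h_s(\Gamma_s)$$ for tropical rational curves $h_i:\Gamma_i\to\mathbb{R}^n$ of toric degree $\Delta_i$ such that $(\Delta_1,\dots,\Delta_s)$ is a degeneration of $\Delta$. (c) If $s>1$, the tropical curves $(h_1,\dots,h_s)$ can be chosen from a sublocus of dimension strictly less than $n+k-3$ in the parameter spaces of all tuples of curves of degree $(\Delta_1,\dots,\Delta_s)$.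
   Context: **Toric degree.** A collection $\Delta=(\delta_1,\dots,\delta_k)$ of integer vectors $\delta_i\in\mathbb{Z}^n$ with $\sum_{i=1}^k\delta_i=0$. **Log.** $\operatorname{Log}:(\mathbb{C}^\times)^n\to\mathbb{R}^n$, $(z_1,\dots,z_n)\mapsto(\log|z_1|,\dots,\log|z_n|)$. **Complex rational curves.** A complex rational curve in $(\mathbb{C}^\times)^n$ is a holomorphic map $f:S\to(\mathbb{C}^\times)^n$ from a Riemann sphere with $k$ labelled punctures $S=\mathbb{CP}^1\setminus\{\alpha_1,\dots,\alpha_k\}$. Its toric degree is $(\delta(\alpha_1),\dots,\delta(\alpha_k))$, where $\delta(\alpha_i)\in\mathbb{Z}^n$ has $j$-th coordinate $-\operatorname{ord}_{\alpha_i}(z_j\circ f)$. **Tropical rational curves.** A tropical rational curve in $\mathbb{R}^n$ is a map $h:\Gamma\to\mathbb{R}^n$ with the following properties: $\overline\Gamma$ is a tree with $k$ labelled ends $a_1,\dots,a_k$, and $\Gamma=\overline\Gamma\setminus\{a_1,\dots,a_k\}$ carries a complete inner metric such that each leaf (edge adjacent to an end) is isometric to $[0,\infty)$ and each bounded edge $e$ is isometric to $[0,l(e)]$, where $l(e)>0$ is called the length of $e$; $h$ is (continuous and) affine on each edge; for each oriented edge $e$ the vector $\partial h(e)$ of derivatives of $h$ when travelling along $e$ with unit speed lies in $\mathbb{Z}^n$; at each vertex of $\Gamma$ the vectors $\partial h(e)$ of the adjacent outgoing edges $e$ sum to $0$ (balancing condition). The toric degree of $h$ is $(\partial h(l_1),\dots,\partial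 h(l_k))$, where $l_i$ is the leaf adjacent to $a_i$, oriented towards $a_i$. **Degenerations.** Let $D$ be a tree with $k$ labelled leaves. The oriented edges $e$ of $D$ are uniquely decorated with vectors $\delta(e)\in\mathbb{Z}^n$ such that: the leaf labelled by $i$ (oriented outwards) is decorated by $\delta_i$; the oppositely oriented edge $-e$ carries $\delta(-e)=-\delta(e)$; around each vertex $v$ the vectors $\delta(e)$ of adjacent edges, oriented outwards, sum up to zero and hence form a toric degree denoted $\Delta_v$. A subset $S$ of vertices of $D$ is called allowable if there exists an assignment of non-negative, non-all-zero numbers $(a(e): e\text{ non-leaf})$ such that for any $v,w\in S$ we have $\sum_{e\subset[v,w]}a(e)\delta(e)=0$, where $[v,w]$ denotes the oriented simple path from $v$ to $w$. A collection of toric degrees obtained as $(\Delta_v)_{v\in S}$ for an allowable vertex set $S$ (of some such tree $D$) is called a degeneration of $\Delta$. **Hausdorff limits.** For $A,B\subset\mathbb{R}^n$, the Hausdorff distance is $d(A,B)=\inf\{\delta: A\subset U_\delta(B),\ B\subset U_\delta(A)\}$, where $U_\delta(X)$ is the $\delta$-neighbourhood of $X$. A sequence of subsets $A_m\subset\mathbb{R}^n$ converges to the Hausdorff limit $A\subset\mathbb{R}^n$ if $A$ is closed and for any compact set $K\subset\mathbb{R}^n$ the sequence $d(A_m\cap K,A\cap K)$ converges to $0$. The case $A=\emptyset$ is included, which is to say that for any compact $K\subset\mathbb{R}^n$ there exists $m_0$ such that $A_m\cap K=\emptyset$ for all $m\ge m_0$. **Parameter spaces.** The parameter space of tuples of curves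 of degree $(\Delta_1,\dots,\Delta_s)$ is the space of tuples $(h_1,\dots,h_s)$, with $h_i$ an isomorphism class of tropical rational curves of toric degree $\Delta_i$. The number $n+k-3$ is the dimension of the parameter space of rational complex/tropical curves of toric degree $\Delta$.
   Formalization: Hausdorff convergence is local: A_m∩K in U_δ(A), A∩K in U_δ(A_m); with d(A_m∩K,A∩K), (a) fails for lines A_m=R×{1/m}, K={0}. For a one-vertex tree D the non-all-zero condition on a(e) is dropped; else (b) fails for constant curves, k≤1. *)

(* Defs.v *)
From HB Require Import structures.
From mathcomp Require Import all_boot all_order all_algebra.
From mathcomp Require Import all_classical all_reals all_analysis.
From mathcomp Require Import complex.

Set Implicit Arguments.
Unset Strict Implicit.
Unset Printing Implicit Defensive.

Import Order.TTheory GRing.Theory Num.Theory.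
Import numFieldNormedType.Exports.

Local Open Scope classical_set_scope.
Local Open Scope ring_scope.

(* A toric degree is a sequence of vectors of Z^n with sum 0. Its length is
   the number k of ends, and its i-th vector is Delta`_i. *)
Definition toric_degree (n : nat) (Delta : seq 'rV[int]_n) : Prop :=
  \sum_(d <- Delta) d = 0.

Section ComplexCurves.
Variable R : realType.

(* CP^1 = C plus infinity, where None stands for infinity. *)
Definition CP1 : Type := option R[i].

(* Holomorphic local coordinate w of CP^1 centred at p: it is z - a at a
   finite point a and 1/z at infinity. *)
Definition chart (p : CP1) (w : R[i]) : CP1 :=
  match p with
  | Some a => Some (a + w)
  | None => if w == 0 then None else Some w^-1
  end.

(* Complex differentiability at w (the increment ranges over R[i]). *)
Definition cdiff (u : R[i] -> R[i]) (w : R[i]) : Prop :=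
  derivable (u : R[i]^o -> R[i]^o) (w : R[i]^o) (1 : R[i]^o).

Definition has_order (g : CP1 -> R[i]) (p : CP1) (m : int) : Prop :=
  exists u : R[i] -> R[i],
    [/\ \forall w \near (0 : R[i]^o), cdiff u w,
        u 0 != 0 &
        \forall w \near (0 : R[i]^o), w != 0 -> g (chart p w) = w ^ m * u w].

Variables (n k : nat).

(* The values of curve_map at the punctures are irrelevant. *)
Record curve_data := CurveData {
  puncture : 'I_k -> CP1;
  curve_map : CP1 -> 'rV[R[i]]_n }.

Definition complex_rational_curve (f : curve_data) : Prop :=
  injective (puncture f) /\
  forall p, ~ range (puncture f) p -> forall j,
    curve_map f p 0 j != 0 /\
    cdiff (fun w => curve_map f (chart p w) 0 j) 0.

Definition curve_image (f : curve_data) : set 'rV[R[i]]_n :=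
  curve_map f @` (~` range (puncture f)).

Definition Log (z : 'rV[R[i]]_n) : 'rV[R]_n := \row_j ln (Normc.normc (z 0 j)).

Definition Log_ (t : R) (z : 'rV[R[i]]_n) : 'rV[R]_n := (ln t)^-1 *: Log z.

End ComplexCurves.

Definition curve_of_degree (R : realType) (n : nat)
    (Delta : seq 'rV[int]_n) (f : curve_data R n (size Delta)) : Prop :=
  complex_rational_curve f /\
  forall (i : 'I_(size Delta)) (j : 'I_n),
    has_order (fun p => curve_map f p 0 j) (puncture f i) (- (Delta`_i 0 j)).

Section Hausdorff.
Variables (R : realType) (n : nat).

(* Here ball is for the sup norm; as all norms on R^n are equivalent, this does
   not affect Hausdorff limits. *)
Definition neighbourhood (d : R) (X : set 'rV[R]_n) : set 'rV[R]_n :=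
  \bigcup_(x in X) ball x d.

(* Hausdorff distance relative to K: only the points of A and B lying in K
   have to be close to the other set. The distance between the sets A `&` K
   and B `&` K themselves would not be suitable: for A_m = [set x_m] with
   x_m --> x and x_m != x, and K = [set x], it is always +oo. *)
Definition hausdorff_dist_on (K A B : set 'rV[R]_n) : \bar R :=
  ereal_inf [set d%:E | d in [set d : R | [/\ 0 < d,
    A `&` K `<=` neighbourhood d B & B `&` K `<=` neighbourhood d A]]].

Definition hausdorff_limit (A_ : nat -> set 'rV[R]_n) (A : set 'rV[R]_n) :=
  closed A /\
  forall K : set 'rV[R]_n, compact K ->
    hausdorff_dist_on K (A_ m) A @[m --> \oo] --> 0%E.

End Hausdorff.

(* Trees with k labelled leaves. A leaf is a half-edge i : 'I_k attached at
   the vertex leg i, its end being left implicit; the non-leaf edges are the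
   pairs (u, v) with adj u v. *)
Record ltree (k : nat) := LTree {
  nvert : nat;
  adj : 'I_nvert -> 'I_nvert -> bool;
  leg : 'I_k -> 'I_nvert }.

Notation vert T := 'I_(nvert T).

Section Trees.
Variable k : nat.

Definition simple_path (T : ltree k) (v w : vert T) (p : seq (vert T)) :=
  [/\ path (@adj k T) v p, last v p = w & uniq (v :: p)].

Definition valence (T : ltree k) (v : vert T) : nat :=
  (#|[pred w | adj v w]| + #|[pred i | leg T i == v]|)%N.

(* The last clause says that the labelled ends are the only ends; it leaves
   2-valent vertices free, and admits the one-vertex tree for every k. *)
Definition is_ltree (T : ltree k) : Prop :=
  [/\ (0 < nvert T)%N,
      symmetric (@adj k T),
      irreflexive (@adj k T),
      forall v w : vert T, exists! p, simple_path v w p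
    & (1 < nvert T)%N -> forall v : vert T, (1 < valence v)%N].

Variable n : nat.

(* slope u v is the decoration of the edge oriented from u to v; its value
   is relevant only if adj u v. *)
Definition balanced (T : ltree k) (Delta : seq 'rV[int]_n)
    (slope : vert T -> vert T -> 'rV[int]_n) : Prop :=
  (forall u v, adj u v -> slope v u = - slope u v) /\
  forall v, \sum_(w | adj v w) slope v w
            + \sum_(i | leg T i == v) Delta`_i = 0.

End Trees.

Section TropicalCurves.
Variables (R : realType) (n : nat).

Definition toR (d : 'rV[int]_n) : 'rV[R]_n := map_mx intr d.

(* A map h from a metric tree, affine on edges: pos is h on the vertices,
   and slope u v is the derivative of h along the unit speed edge from u to
   v. The slopes of the leaves are given by the toric degree. *)
Record trop_data (k : nat) := TropData {
  ttree : ltree k;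
  tlength : vert ttree -> vert ttree -> R;
  tslope : vert ttree -> vert ttree -> 'rV[int]_n;
  tpos : vert ttree -> 'rV[R]_n }.

Definition tropical_curve (Delta : seq 'rV[int]_n)
    (h : trop_data (size Delta)) : Prop :=
  [/\ is_ltree (ttree h),
      balanced Delta (@tslope _ h),
      forall u v, adj u v ->
        0 < @tlength _ h u v /\ @tlength _ h u v = @tlength _ h v u
    & forall u v, adj u v ->
        tpos v = tpos u + @tlength _ h u v *: toR (@tslope _ h u v)].

Definition trop_image (Delta : seq 'rV[int]_n)
    (h : trop_data (size Delta)) : set 'rV[R]_n :=
  [set x | [\/ exists v : vert (ttree h), x = tpos v,
      exists (u v : vert (ttree h)) (s : R),
        [/\ adj u v, 0 <= s <= @tlength _ h u v
          & x = tpos u + s *: toR (@tslope _ h u v)]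
    | exists (i : 'I_(size Delta)) (s : R),
        0 <= s /\ x = tpos (leg (ttree h) i) + s *: toR (Delta`_i)]].

(* Tuples of maps, the i-th one with as many ends as Deltas i. *)
Definition trop_tuple (s : nat) (Deltas : 'I_s -> seq 'rV[int]_n) :=
  forall i : 'I_s, trop_data (size (Deltas i)).

(* The parameter space is a union of cells, one for each tuple of trees with
   slopes, with the edge lengths and vertex positions as coordinates. An
   affine family moves in one cell, its coordinates being affine functions of
   y in R^d. Members of the family need not be tropical curves, since lengths
   may become negative and the edge conditions may fail. *)
Definition affine_family (s : nat) (Deltas : 'I_s -> seq 'rV[int]_n)
    (d : nat) (F : 'rV[R]_d -> trop_tuple Deltas) : Prop :=
  forall i, exists (T : ltree (size (Deltas i)))
      (sl : vert T -> vert T -> 'rV[int]_n)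
      (l0 : vert T -> vert T -> R) (l1 : vert T -> vert T -> 'cV[R]_d)
      (p0 : vert T -> 'rV[R]_n) (p1 : vert T -> 'M[R]_(d, n)),
    forall y, F y i = @TropData _ T
      (fun u v => l0 u v + (y *m l1 u v) 0 0) sl (fun v => p0 v + y *m p1 v).

(* Polyhedral dimension: finitely many affine families, each with less than N
   parameters, cover L. For N <= 0 this forces L = set0. Taking
   isomorphism classes does not increase this dimension, and a set of classes
   covered up to isomorphism by such families has a set L of representatives
   in the families themselves. *)
Definition dim_lt (s : nat) (Deltas : 'I_s -> seq 'rV[int]_n)
    (L : set (trop_tuple Deltas)) (N : int) : Prop :=
  exists (r : nat) (d : 'I_r -> nat)
      (F : forall j : 'I_r, 'rV[R]_(d j) -> trop_tuple Deltas),
    (forall j, (d j)%:Z < N /\ affine_family (F j)) /\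
    forall h, L h -> exists (j : 'I_r) (y : 'rV[R]_(d j)), h = F j y.

Definition parameter_space (s : nat) (Deltas : 'I_s -> seq 'rV[int]_n) :
    set (trop_tuple Deltas) :=
  [set h | forall i, tropical_curve (h i)].

End TropicalCurves.

Section Degenerations.
Variables (R : realType) (n : nat).

Definition path_sum (k : nat) (D : ltree k)
    (delta : vert D -> vert D -> 'rV[int]_n) (a : vert D -> vert D -> R)
    (v : vert D) (p : seq (vert D)) : 'rV[R]_n :=
  \sum_(e <- zip (v :: p) p) a e.1 e.2 *: toR R (delta e.1 e.2).

(* If D has only one vertex, it has no non-leaf edge and the condition that a
   is not identically zero is dropped, so that Delta is always a degeneration
   of itself. For k >= 2 this does not add any degeneration, as one can
   subdivide a leaf of D by a 2-valent vertex. *)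
Definition allowable (k : nat) (D : ltree k)
    (delta : vert D -> vert D -> 'rV[int]_n) (S : set (vert D)) : Prop :=
  exists a : vert D -> vert D -> R,
    [/\ forall u v, adj u v -> 0 <= a u v /\ a u v = a v u,
        (1 < nvert D)%N -> exists u v, adj u v /\ a u v != 0
      & forall v w p, S v -> S w -> simple_path v w p ->
          path_sum delta a v p = 0].

(* The vectors of the edges at v, oriented outwards, in an arbitrary order. *)
Definition star_degree (Delta : seq 'rV[int]_n) (D : ltree (size Delta))
    (delta : vert D -> vert D -> 'rV[int]_n) (v : vert D) :
    seq 'rV[int]_n :=
  [seq delta v w | w <- enum (vert D) & adj v w] ++
  [seq Delta`_(i : 'I_(size Delta)) | i <- enum 'I_(size Delta) & leg D i == v].

(* S = range vs is the allowable vertex set. As the edges at a vertex are not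
   ordered, each toric degree is given up to permutation. *)
Definition degeneration (Delta : seq 'rV[int]_n) (s : nat)
    (Deltas : 'I_s -> seq 'rV[int]_n) : Prop :=
  exists (D : ltree (size Delta)) (delta : vert D -> vert D -> 'rV[int]_n)
      (vs : 'I_s -> vert D),
    [/\ is_ltree D, balanced Delta delta, injective vs,
        allowable delta (range vs)
      & forall i, perm_eq (Deltas i) (star_degree delta (vs i))].

End Degenerations.

(* Main.v *)
(* In a coordinate that puts the last puncture at infinity, a rational curve has
   the components c * prod_i (w - a_i)^(-delta_i), by Liouville's theorem. So
   Log of the curve consists of the points p - sum_i ln |w - a_i| delta_i. The
   numbers ln |a_i - a_j| form an ultrametric up to a constant that depends only
   on k, and are thus close to the levels of the lowest common ancestors in a
   rooted tree with at most k - 2 vertices; hence Log of the curve is within a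
   constant of the image of a balanced map from this tree to R^n, given by a
   parameter in R^(n + k - 3). After division by ln t_m the error tends to 0.

   It remains to take limits of balanced maps from a fixed tree, along an
   ultrafilter finer than the Frechet filter. Every vertex has a limit or
   escapes, and every edge has a length in [0, +oo] in the limit. Edges that stay
   in the bounded region in the middle only are subdivided there. Cutting the
   edges of infinite length and contracting those of length 0 gives the tropical
   curves, one for each component with bounded vertices; the tree of all
   components is the tree of the degeneration.

   The positions and lengths of the limit curves solve a linear system. If there
   is more than one curve, the parameters are unbounded, so the system has a
   kernel vector, along which one coordinate of the solution can be made 0. *)
Require Import Defs.
From mathcomp Require Import all_boot all_order all_algebra.
From mathcomp Require Import all_classical all_reals all_analysis.
From mathcomp Require Import complex ring lra zify.

Set Implicit Arguments.
Unset Strict Implicit.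
Unset Printing Implicit Defensive.

Import Order.TTheory GRing.Theory Num.Theory.
Import numFieldNormedType.Exports.

Local Open Scope classical_set_scope.
Local Open Scope ring_scope.

(** * Liouville's theorem *)

(** Liouville's theorem is obtained from Riemann sums over squares: it only takes that the contour
    sums of [(H z - H c) / (z - c)] tend to 0 while those of [1 / (z - c)] do not.

    An ultrafilter [U] replaces repeated passage to subsequences: along [U] every alternative is
    decided and every bounded sequence of reals converges, so all limits are taken for one fixed
    sequence. A Hausdorff limit has to agree with the limit along [U], which gives (b); an actual
    subsequence is extracted only once, for (a).

    The obstacle in (c) is that part of the parameter escapes, so the limit curves do not belong to
    a limit of the parameter. Only those linear functions of it that converge are used. As the image
    of a linear map is closed, their limits are values at one parameter, from which all limit curves
    are read off together.

    For k <= 2 the count of parameters does not fit: the base tree has one vertex and the parameter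
    still has n coordinates. There it is shown instead that at most one curve occurs. *)

Section ComplexNorm.
Variable R : realType.
Implicit Types z w : R[i].

Local Notation nc := (@Normc.normc R).

Lemma nc_ge0 z : 0 <= nc z.
Proof. by case: z => a b; exact: sqrtr_ge0. Qed.

Lemma nc_norm z : (nc z)%:C%C = `|z|.
Proof. by rewrite normc_def; case: z. Qed.

Lemma ncM z w : nc (z * w) = nc z * nc w.
Proof. exact: Normc.normcM. Qed.

Lemma ncV z : nc z^-1 = (nc z)^-1.
Proof. exact: Normc.normcV. Qed.

Lemma ncD z w : nc (z + w) <= nc z + nc w.
Proof. exact: le_normcD. Qed.

Lemma ncN z : nc (- z) = nc z.
Proof. exact: normcN. Qed.

Lemma ncB z w : nc (z - w) = nc (w - z).
Proof. by rewrite -ncN opprB. Qed.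

Lemma nc0 : nc 0 = 0.
Proof. exact: Normc.normc0. Qed.

Lemma nc1 : nc 1 = 1.
Proof. exact: Normc.normc1. Qed.

Lemma nc_eq0 z : (nc z == 0) = (z == 0).
Proof.
by apply/eqP/eqP => [|->]; [exact: Normc.eq0_normc|exact: nc0].
Qed.

Lemma nc_gt0 z : (0 < nc z) = (z != 0).
Proof. by rewrite lt_neqAle nc_ge0 andbT eq_sym nc_eq0. Qed.

Lemma ncR (a : R) : nc a%:C%C = `|a|.
Proof. by rewrite /Normc.normc /= expr0n /= addr0 sqrtr_sqr. Qed.

Lemma nci : nc 'i%C = 1.
Proof. by rewrite /Normc.normc /= expr0n /= add0r expr1n sqrtr1. Qed.

Lemma ncX z n : nc (z ^+ n) = nc z ^+ n.
Proof. by elim: n => [|n IHn]; rewrite ?expr0 ?nc1 // !exprS ncM IHn. Qed.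

Lemma ncXz z (m : int) : nc (z ^ m) = nc z ^ m.
Proof.
case: m => n; first exact: ncX.
by rewrite !NegzE -!exprnN ncV ncX.
Qed.

Lemma nc_prod (I : Type) (r : seq I) (P : pred I) (F : I -> R[i]) :
  nc (\prod_(i <- r | P i) F i) = \prod_(i <- r | P i) nc (F i).
Proof. exact: (big_morph nc ncM nc1). Qed.

Lemma nc_sum (I : Type) (r : seq I) (P : pred I) (F : I -> R[i]) :
  nc (\sum_(i <- r | P i) F i) <= \sum_(i <- r | P i) nc (F i).
Proof.
elim/big_rec2: _ => [|i x y _ le_yx]; first by rewrite nc0.
by rewrite (le_trans (ncD _ _)) // lerD2l.
Qed.

Lemma nc_Re z : `|complex.Re z| <= nc z.
Proof.
by case: z => a b /=; rewrite -sqrtr_sqr ler_wsqrtr // lerDl sqr_ge0.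
Qed.

Lemma nc_Im z : `|complex.Im z| <= nc z.
Proof.
by case: z => a b /=; rewrite -sqrtr_sqr ler_wsqrtr // lerDr sqr_ge0.
Qed.

Lemma nc_le z : nc z <= `|complex.Re z| + `|complex.Im z|.
Proof.
by rewrite [in leLHS](complexE z) (le_trans (ncD _ _)) // ncM nci mul1r !ncR.
Qed.

Lemma nc_subD z w : nc z - nc w <= nc (z + w).
Proof.
have := ncD (z + w) (- w); rewrite addrK ncN; lra.
Qed.

End ComplexNorm.

Section Bisection.
Variable R : realType.

(** Otherwise halving produces nested squares on which [P] fails; they shrink to a point [(a, b)],
    where the local hypothesis applies. [P x y d] speaks of the square of side [d] with lower left
    corner [(x, y)]. *)
Lemma bisection (P : R -> R -> R -> Prop) :
  (forall x y d, 0 < d -> P x y (d / 2) -> P (x + d / 2) y (d / 2) ->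
     P x (y + d / 2) (d / 2) -> P (x + d / 2) (y + d / 2) (d / 2) -> P x y d) ->
  (forall a b, exists2 r, 0 < r & forall x y d, 0 < d < r ->
     x <= a <= x + d -> y <= b <= y + d -> P x y d) ->
  forall x y d, 0 < d -> P x y d.
Proof.
move=> Pstep Ploc x0 y0 d0 d0_gt0; apply: contrapT => nP0.
pose T := (R * R * R)%type.
pose good (q : T) := 0 < q.2 /\ ~ P q.1.1 q.1.2 q.2.
have next (q : T) : good q -> exists q' : T,
   [/\ good q', q'.2 = q.2 / 2,
     q.1.1 <= q'.1.1 /\ q'.1.1 + q'.2 <= q.1.1 + q.2 &
     q.1.2 <= q'.1.2 /\ q'.1.2 + q'.2 <= q.1.2 + q.2].
  case: q => [[x y] d] [/= d_gt0 nP]; apply: contrapT => no; apply: nP.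
  apply: Pstep => //; apply: contrapT => nP; apply: no.
  - exists (x, y, d / 2); rewrite /good /=; split=> //; split=> //; lra.
  - exists (x + d / 2, y, d / 2); rewrite /good /=; split=> //; split=> //; lra.
  - exists (x, y + d / 2, d / 2); rewrite /good /=; split=> //; split=> //; lra.
  - exists (x + d / 2, y + d / 2, d / 2); rewrite /good /=; split=> //; split=> //; lra.
have /choice[g gP] : forall q, exists q', good q -> [/\ good q', q'.2 = q.2 / 2,
     q.1.1 <= q'.1.1 /\ q'.1.1 + q'.2 <= q.1.1 + q.2 &
     q.1.2 <= q'.1.2 /\ q'.1.2 + q'.2 <= q.1.2 + q.2].
  move=> q.
  by have [/next[q' ?]|nq] := pselect (good q); [exists q'|exists q].
pose s n : T := iter n g (x0, y0, d0).
have sgood n : good (s n) by elim: n => [//|n /gP[]].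
have s2 n : (s n).2 = d0 / 2 ^+ n.
  elim: n => [|n IHn]; first by rewrite expr0 divr1.
  by have [_ -> _ _] := gP _ (sgood n); rewrite IHn exprSr invfM mulrA.
have mono1 n m : (s n).1.1 <= (s (n + m)%N).1.1 /\
   (s (n + m)%N).1.1 + (s (n + m)%N).2 <= (s n).1.1 + (s n).2.
  elim: m => [|m [IH1 IH2]]; first by rewrite addn0; split.
  by rewrite addnS; have [_ _ [h1 h2] _] := gP _ (sgood (n + m)%N); split;
    [exact: le_trans h1|exact: le_trans IH2].
have mono2 n m : (s n).1.2 <= (s (n + m)%N).1.2 /\
   (s (n + m)%N).1.2 + (s (n + m)%N).2 <= (s n).1.2 + (s n).2.
  elim: m => [|m [IH1 IH2]]; first by rewrite addn0; split.
  by rewrite addnS; have [_ _ _ [h1 h2]] := gP _ (sgood (n + m)%N); split;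
    [exact: le_trans h1|exact: le_trans IH2].
have pos n : 0 < (s n).2 by have [] := sgood n.
have lim (u : nat -> R) : (forall n m, u n <= u (n + m)%N /\
    u (n + m)%N + (s (n + m)%N).2 <= u n + (s n).2) ->
    exists a, forall n, u n <= a <= u n + (s n).2.
  move=> um; pose A := range u.
  have ubA n : ubound A (u n + (s n).2).
    move=> _ [m _ <-].
    have [le_nm|/ltnW le_mn] := leqP n m.
      rewrite -(subnKC le_nm); have [_] := um n (m - n)%N; apply: le_trans.
      by rewrite lerDl ltW.
    rewrite -(subnKC le_mn); have [h _] := um m (n - m)%N; apply: (le_trans h).
    by rewrite lerDl ltW.
  exists (sup A) => n; apply/andP; split.
    by apply: ub_le_sup; [exists (u n + (s n).2)|exists n].
  by apply: ge_sup; [exists (u n), n|exact: ubA].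
have [a aP] := lim _ mono1.
have [b bP] := lim _ mono2.
have [r r_gt0 rP] := Ploc a b.
have [n dn] : exists n, d0 / 2 ^+ n < r.
  have [n Hn] : exists n : nat, d0 / r < n%:R.
    by exists (Num.truncn (d0 / r)).+1; rewrite truncnS_gt.
  exists n; rewrite ltr_pdivrMr ?exprn_gt0 // mulrC -ltr_pdivrMr //.
  apply: (lt_le_trans Hn); rewrite -natrX ler_nat ltnW //.
  exact: ltn_expl.
have [_ nP] := sgood n; apply: nP; apply: rP; rewrite ?aP ?bP //.
by rewrite pos s2.
Qed.

End Bisection.

Section ComplexDerivative.
Variable R : realType.
Local Notation C := R[i].
Local Notation nc := (@Normc.normc R).
Implicit Types (f g : C -> C) (w : C).

(* An inductive wrapper, which stops unification from unfolding derivability. *)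
Variant cdiff_at f w : Prop := CdiffAt of cdiff f w.

Lemma near_ncP w (P : C -> Prop) :
  (\forall z \near (w : C^o), P z) <->
  exists2 r, 0 < r & forall h, nc h < r -> P (w + h).
Proof.
split.
  move=> /nbhs_ballP[e /= e_gt0 eP].
  have e_real : e = (complex.Re e)%:C%C.
    by case: e e_gt0 {eP} => a b; rewrite ltcE /= => /andP[/eqP -> _].
  exists (complex.Re e); first by move: e_gt0; rewrite ltcE => /andP[].
  move=> h h_lt; apply: eP; rewrite /ball /= opprD addrA subrr add0r normrN.
  by rewrite -nc_norm e_real ltcR.
move=> [r r_gt0 rP]; apply/nbhs_ballP; exists r%:C%C; first by rewrite /= ltcR.
move=> z; rewrite /ball /= => z_lt; rewrite -(subrKC w z); apply: rP.
by rewrite -ltcR nc_norm distrC.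
Qed.

Lemma cdiff_eps f w : cdiff_at f w -> exists q, forall e, 0 < e ->
  exists2 r, 0 < r & forall h, nc h < r -> nc (f (w + h) - f w - h * q) <= e * nc h.
Proof.
move=> [/cvg_ex[q /cvgrPdist_lt qP]]; exists q => e e_gt0.
have /near_ncP[r r_gt0 rP] := qP e%:C%C (ltac:(by rewrite ltcR)).
exists r => // h h_lt; have [->|h_neq0] := eqVneq h 0.
  by rewrite addr0 mul0r subr0 subrr nc0 mulr0.
have := rP _ h_lt; rewrite add0r => /(_ h_neq0) /=.
rewrite -nc_norm ltcR /= -[h *: 1]/(h * 1) mulr1 -[h^-1 *: _]/(h^-1 * _) => lt_e.
have -> : f (w + h) - f w - h * q = - (h * (q - h^-1 * (f (h + w) - f w))).
  by rewrite mulrBr mulrA divff // mul1r opprB [h + w]addrC.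
by rewrite ncN ncM mulrC ler_wpM2r ?nc_ge0 // ltW.
Qed.

Lemma cdiff_cst (c : C) w : cdiff_at (fun=> c) w.
Proof. by split; exact: derivable_cst. Qed.

Lemma cdiff_id w : cdiff_at id w.
Proof. by split; exact: derivable_id. Qed.

Lemma cdiffD f g w : cdiff_at f w -> cdiff_at g w -> cdiff_at (fun z => f z + g z) w.
Proof. by move=> [df] [dg]; split; exact: (derivableD df dg). Qed.

Lemma cdiffM f g w : cdiff_at f w -> cdiff_at g w -> cdiff_at (fun z => f z * g z) w.
Proof. by move=> [df] [dg]; split; exact: (derivableM df dg). Qed.

Lemma cdiffV f w : f w != 0 -> cdiff_at f w -> cdiff_at (fun z => (f z)^-1) w.
Proof. by move=> fw0 [df]; split; exact: (derivableV fw0 df). Qed.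

Lemma cdiffB f g w : cdiff_at f w -> cdiff_at g w -> cdiff_at (fun z => f z - g z) w.
Proof. by move=> [df] [dg]; split; exact: (derivableB df dg). Qed.

Lemma eq_cdiff f g w : f =1 g -> cdiff_at f w -> cdiff_at g w.
Proof. by move=> /funext ->. Qed.

Lemma cdiffX f n w : cdiff_at f w -> cdiff_at (fun z => f z ^+ n) w.
Proof.
move=> df; elim: n => [|n IHn]; first exact: cdiff_cst 1 w.
apply: (eq_cdiff (f := fun z => f z * f z ^+ n)); last exact: cdiffM.
by move=> z; rewrite exprS.
Qed.

Lemma cdiffXz f (m : int) w : f w != 0 -> cdiff_at f w -> cdiff_at (fun z => f z ^ m) w.
Proof.
move=> fw0 df; case: m => n; first exact: cdiffX.
by apply: (cdiffV (f := fun z => f z ^+ n.+1)); [exact: expf_neq0|exact: cdiffX].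
Qed.

Lemma cdiff_prod (I : Type) (r : seq I) (P : pred I) (F : I -> C -> C) w :
  (forall i, P i -> cdiff_at (F i) w) ->
  cdiff_at (fun z => \prod_(i <- r | P i) F i z) w.
Proof.
move=> dF; elim: r => [|i r IHr].
  by apply: (eq_cdiff (f := fun=> 1)); [move=> z; rewrite big_nil|exact: cdiff_cst].
have [Pi|nPi] := boolP (P i); last first.
  by apply: eq_cdiff IHr => z; rewrite big_cons (negPf nPi).
apply: eq_cdiff (cdiffM (dF _ Pi) IHr) => z.
by rewrite big_cons Pi.
Qed.

Lemma cdiff_comp f g w : cdiff_at f w -> cdiff_at g (f w) -> cdiff_at (g \o f) w.
Proof.
move=> [/derivable1_diffP df] [/derivable1_diffP dg]; split.
apply: (iffRL (derivable1_diffP (g \o f : C^o -> C^o) w)).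
exact: (differentiable_comp df dg).
Qed.

Lemma cdiff_cont f w : cdiff_at f w -> {for w, continuous (f : C^o -> C^o)}.
Proof. by move=> [/derivable1_diffP /differentiable_continuous]. Qed.

Lemma cdiff_cont_eps f w : cdiff_at f w -> forall e, 0 < e ->
  exists2 r, 0 < r & forall h, nc h < r -> nc (f (w + h) - f w) < e.
Proof.
move=> /cdiff_cont /cvgrPdist_lt fw e e_gt0.
have /near_ncP[r r_gt0 rP] := fw e%:C%C (ltac:(by rewrite ltcR)).
by exists r => // h /rP; rewrite -nc_norm ltcR ncB.
Qed.

Lemma near_eq_cdiff f g w :
  (\forall z \near (w : C^o), f z = g z) -> cdiff_at f w -> cdiff_at g w.
Proof.
move=> fg [df]; split; apply: (near_eq_derivable (f := f : C^o -> C^o)) => //.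
Qed.

Lemma cdiff_shift f (a w : C) : cdiff_at f (a + w) -> cdiff_at (fun z => f (a + z)) w.
Proof.
move=> df; have da := cdiffD (@cdiff_cst a w) (@cdiff_id w).
exact: cdiff_comp da df.
Qed.

End ComplexDerivative.

(** * Goursat's lemma with dyadic Riemann sums *)

Section Goursat.
Variable R : realType.
Local Notation C := R[i].
Local Notation nc := (@Normc.normc R).

(** With [2 ^ N] sample points, the sum over an interval is exactly the sum over its two halves with
    half as many points each ([riemann_sumS]). Keeping to such sums avoids integrals. *)
Definition riemann_sum (f : R -> C) (x d : R) (N : nat) : C :=
  (d / 2 ^+ N)%:C%C * \sum_(j < 2 ^ N) f (x + d * j%:R / 2 ^+ N).

Lemma riemann_sumS f x d N :
  riemann_sum f x d N.+1 =
  riemann_sum f x (d / 2) N + riemann_sum f (x + d / 2) (d / 2) N.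
Proof.
have n0 : (2 : R) ^+ N != 0 by rewrite expf_neq0 // pnatr_eq0.
have e1 : d / 2 ^+ N.+1 = d / 2 / 2 ^+ N by rewrite exprS; field.
have e2 : (2 ^ N.+1 = 2 ^ N + 2 ^ N)%N by rewrite expnS mul2n addnn.
rewrite /riemann_sum e1 -mulrDr e2 big_split_ord /=; congr (_ * (_ + _)).
  by apply: eq_bigr => j _; congr f; rewrite exprS; field.
by apply: eq_bigr => j _; congr f; rewrite natrD natrX exprS; field.
Qed.

Lemma riemann_sumD f g x d N :
  riemann_sum (fun s => f s + g s) x d N = riemann_sum f x d N + riemann_sum g x d N.
Proof. by rewrite /riemann_sum big_split mulrDr. Qed.

Lemma riemann_sum_cst c x d N : riemann_sum (fun=> c) x d N = d%:C%C * c.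
Proof.
have n0 : (2 : R) ^+ N != 0 by rewrite expf_neq0 // pnatr_eq0.
rewrite /riemann_sum sumr_const card_ord -[c *+ _]mulr_natl mulrA natrX; congr (_ * _).
have -> : (2 : C) ^+ N = (2 ^+ N : R)%:C%C by rewrite rmorphXn rmorph_nat.
by rewrite -rmorphM /= divfK.
Qed.

Lemma riemann_sum_le f x d N M : 0 < d ->
  (forall s, x <= s <= x + d -> nc (f s) <= M) -> nc (riemann_sum f x d N) <= d * M.
Proof.
move=> d_gt0 fM; have p0 : (0 : R) < 2 ^+ N by rewrite exprn_gt0.
have dp : 0 <= d / 2 ^+ N by rewrite divr_ge0 ?ltW.
rewrite /riemann_sum ncM ncR (ger0_norm dp).
have -> : d * M = d / 2 ^+ N * (\sum_(j < 2 ^ N) M).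
  by rewrite sumr_const card_ord -[M *+ _]mulr_natl natrX; field; rewrite gt_eqF.
apply: ler_wpM2l => //.
apply: (le_trans (nc_sum _ _ _)); apply: ler_sum => j _; apply: fM.
have jN : (j%:R : R) / 2 ^+ N <= 1.
  by rewrite ler_pdivrMr // mul1r -natrX ler_nat ltnW.
have jN0 : 0 <= (j%:R : R) / 2 ^+ N by rewrite divr_ge0 ?ler0n // ltW.
rewrite -mulrA lerDl lerD2l mulr_ge0 ?(ltW d_gt0) //=.
by rewrite -[leRHS]mulr1 ler_pM2l.
Qed.

(* Horizontal and vertical sides are paired, so that the sums of an affine
   function vanish exactly. *)
Definition contour (F : C -> C) (x y d : R) (N : nat) : C :=
  riemann_sum (fun s => F (s +i* y)%C - F (s +i* (y + d))%C) x d N +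
  'i%C * riemann_sum (fun s => F ((x + d) +i* s)%C - F (x +i* s)%C) y d N.

Lemma contourS F x y d N : contour F x y d N.+1 =
  contour F x y (d / 2) N + contour F (x + d / 2) y (d / 2) N +
  contour F x (y + d / 2) (d / 2) N + contour F (x + d / 2) (y + d / 2) (d / 2) N.
Proof.
have E f g a b : riemann_sum (fun s => f s - g s) a b N =
    riemann_sum f a b N - riemann_sum g a b N.
  by rewrite riemann_sumD /riemann_sum sumrN mulrN.
have h2 a : a + d / 2 + d / 2 = a + d by rewrite -addrA -splitr.
rewrite /contour !riemann_sumS !E !h2; ring.
Qed.

Lemma contourD F G x y d N :
  contour (fun z => F z + G z) x y d N = contour F x y d N + contour G x y d N.
Proof.
rewrite /contour.
have E f1 g1 f2 g2 a b : riemann_sum (fun s => f1 s + g1 s - (f2 s + g2 s)) a b N =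
    riemann_sum (fun s => f1 s - f2 s) a b N + riemann_sum (fun s => g1 s - g2 s) a b N.
  by rewrite -riemann_sumD; congr riemann_sum; apply/funext => s; ring.
by rewrite !E; ring.
Qed.

Lemma contour_affine A B (w : C) x y d N : contour (fun z => A + (z - w) * B) x y d N = 0.
Proof.
rewrite /contour.
rewrite (_ : (fun s => _) = (fun=> - ('i%C * d%:C%C) * B)); last first.
  apply/funext => s; rewrite (complexE (s +i* y)%C) (complexE (s +i* (y + d))%C) /=.
  rewrite rmorphD /=; ring.
rewrite (_ : (fun s => A + _ - _) = (fun=> d%:C%C * B)); last first.
  apply/funext => s; rewrite (complexE (x +i* s)%C) (complexE ((x + d) +i* s)%C) /=.
  rewrite rmorphD /=; ring.
by rewrite !riemann_sum_cst; ring.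
Qed.

Lemma contourZ A F x y d N : contour (fun z => A * F z) x y d N = A * contour F x y d N.
Proof.
have E f g a b : riemann_sum (fun s => A * f s - A * g s) a b N =
    A * riemann_sum (fun s => f s - g s) a b N.
  rewrite /riemann_sum mulrCA; congr (_ * _); rewrite mulr_sumr.
  by apply: eq_bigr => j _; rewrite mulrBr.
by rewrite /contour !E; ring.
Qed.

Lemma contour_le F x y d N M : 0 < d ->
  (forall s t, x <= s <= x + d -> y <= t <= y + d ->
    (s == x) || (s == x + d) || (t == y) || (t == y + d) ->
    nc (F (s +i* t)%C) <= M) ->
  nc (contour F x y d N) <= 4 * d * M.
Proof.
move=> d_gt0 FM.
apply: (le_trans (ncD _ _)); rewrite ncM nci mul1r.
have -> : 4 * d * M = d * (M + M) + d * (M + M) by ring.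
apply: lerD; apply: riemann_sum_le => // s s_in.
  by apply: (le_trans (ncD _ _)); rewrite ncN lerD ?FM ?eqxx ?orbT //; lra.
by apply: (le_trans (ncD _ _)); rewrite ncN lerD ?FM ?eqxx ?orbT //; lra.
Qed.

End Goursat.

Section Liouville.
Variable R : realType.
Local Notation C := R[i].
Local Notation nc := (@Normc.normc R).

(* Number of one-sided germs of R at c contained in [x, x + d]. Unlike
   closed membership, it is additive under bisection. *)
Let germs (c x d : R) : R := (x <= c < x + d)%R%:R + (x < c <= x + d)%R%:R.

Let germs_half c x d : 0 < d ->
  germs c x d = germs c x (d / 2) + germs c (x + d / 2) (d / 2).
Proof.
move=> d_gt0; rewrite /germs (_ : x + d / 2 + d / 2 = x + d); last by lra.
rewrite addrACA; congr (_ + _).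
  have [c_lt|c_ge] := ltP c (x + d / 2).
    have -> : c < x + d by lra.
    by rewrite andbT addr0.
  have -> : x <= c by lra.
  by rewrite andbF add0r.
have [c_gt|c_le] := ltP (x + d / 2) c.
  have -> : x < c by lra.
  by rewrite andbF add0r.
have -> : c <= x + d by lra.
by rewrite andbT addr0.
Qed.

Let germs_ge0 c x d : 0 <= germs c x d.
Proof. by rewrite addr_ge0 ?ler0n. Qed.

Let germs_ge1 c x d : 0 < d -> x <= c <= x + d -> 1 <= germs c x d.
Proof.
move=> d_gt0 /andP[xc cx]; rewrite /germs xc cx andbT /=.
have [c_lt|c_ge] := ltP c (x + d); first by rewrite lerDl ler0n.
have -> : x < c by lra.
by rewrite add0r.
Qed.

Let germs_le2 c x d : germs c x d <= 2.
Proof. by rewrite -[2]/(1 + 1) lerD // lern1; case: (_ && _). Qed.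

(** Goursat's bisection, with an exceptional point [c] near which [F] is merely bounded. A bound
    that is additive under bisection has to be checked on small squares only: away from [c] it
    follows from differentiability, and around [c] from the small perimeter. *)
Lemma goursat (F : C -> C) (c : C) (r M : R) : 0 < r ->
  (forall z, z != c -> cdiff_at F z) ->
  (forall h, nc h < r -> nc (F (c + h)) <= M) ->
  forall x y d e, 0 < d -> 0 < e ->
  exists N0, forall N, (N0 <= N)%N -> nc (contour F x y d N) <= e.
Proof.
move=> r_gt0 dF FM x0 y0 d0 e d0_gt0 e_gt0.
have [c1 [c2 defc]] : exists c1 c2, c = (c1 +i* c2)%C by case: (c) => c1 c2; exists c1, c2.
(* Area plus the number of quadrant germs at [c] inside the square: additive under bisection, at
   least 1 if the closed square contains [c], and at most [d ^+ 2 + 4], whence [eta]. *)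
pose mu x y d := d ^+ 2 + germs c1 x d * germs c2 y d.
pose eta := e / (d0 ^+ 2 + 4).
have d2 : 0 < d0 ^+ 2 + 4 by rewrite ltr_wpDl ?sqr_ge0.
have eta_gt0 : 0 < eta by rewrite divr_gt0.
pose P x y d := exists N0, forall N, (N0 <= N)%N -> nc (contour F x y d N) <= eta * mu x y d.
suff [N0 N0P] : P x0 y0 d0.
  exists N0 => N /N0P le_N; apply: (le_trans le_N).
  rewrite -[leRHS](divfK (lt0r_neq0 d2)) ler_wpM2l ?(ltW eta_gt0) //.
  rewrite lerD2l; have g1 := germs_le2 c1 x0 d0; have g2 := germs_le2 c2 y0 d0.
  have h1 := germs_ge0 c1 x0 d0; have h2 := germs_ge0 c2 y0 d0.
  have -> : (4 : R) = 2 * 2 by ring.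
  exact: ler_pM.
apply: (@bisection _ P _ _ x0 y0 d0 d0_gt0) => [x y d d_gt0 [N1 P1] [N2 P2] [N3 P3] [N4 P4]|a b].
  exists (N1 + N2 + N3 + N4).+1 => -[//|N] leN; rewrite contourS.
  apply: (le_trans (ncD _ _)); apply: (le_trans (lerD (ncD _ _) (lexx _))).
  apply: (le_trans (lerD (lerD (ncD _ _) (lexx _)) (lexx _))).
  apply: (le_trans (lerD (lerD (lerD (P1 N _) (P2 N _)) (P3 N _)) (P4 N _))); try lia.
  rewrite -!mulrDr ler_wpM2l ?(ltW eta_gt0) //.
  rewrite /mu (germs_half c1 x d_gt0) (germs_half c2 y d_gt0).
  rewrite le_eqVlt; apply/orP; left; apply/eqP; by field.
have [ab_c|ab_c] := eqVneq (a +i* b)%C c.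
  have Mp : 0 < 4 * (`|M| + 1) by rewrite mulr_gt0 // ltr_wpDl.
  exists (Num.min (r / 2) (eta / (4 * (`|M| + 1)))).
    by rewrite lt_min !divr_gt0.
  move=> x y d /andP[d_gt0]; rewrite lt_min => /andP[d_r d_eta] x_in y_in.
  exists 0 => N _; apply: (@le_trans _ _ eta); last first.
    rewrite -[leLHS]mulr1 ler_wpM2l ?(ltW eta_gt0) //.
    rewrite /mu; have [-> ->] : c1 = a /\ c2 = b by move: ab_c; rewrite defc => -[-> ->].
    have g1 := germs_ge1 d_gt0 x_in; have g2 := germs_ge1 d_gt0 y_in.
    have g3 : 1 * 1 <= germs a x d * germs b y d by apply: ler_pM.
    have := sqr_ge0 d; lra.
  have h : nc (contour F x y d N) <= 4 * d * M.
    apply: contour_le => // s t s_in t_in _.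
    rewrite -(subrKC c (s +i* t)%C); apply: FM.
    apply: (le_lt_trans (nc_le _)); rewrite -ab_c /=.
    have h1 : `|s - a| <= d by rewrite ler_norml; lra.
    have h2 : `|t - b| <= d by rewrite ler_norml; lra.
    lra.
  apply: (le_trans h); apply: (@le_trans _ _ (d * (4 * (`|M| + 1)))).
    rewrite [4 * d]mulrC -mulrA ler_wpM2l ?(ltW d_gt0) // ler_wpM2l //.
    by have := ler_norm M; lra.
  by rewrite -ler_pdivlMr // ltW.
have [q qP] := cdiff_eps (dF _ ab_c).
(* The perimeter is [4 * d] and its points are within [2 * d] of the centre of expansion, so the
   factor [eta / 8] leads to [eta * d ^+ 2]. *)
have [r1 r1_gt0 r1P] := qP (eta / 8) (ltac:(by rewrite divr_gt0)).
exists (r1 / 2) => [|x y d /andP[d_gt0 d_r] x_in y_in]; first by rewrite divr_gt0.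
exists 0 => N _; apply: (@le_trans _ _ (eta * d ^+ 2)); last first.
  by rewrite ler_wpM2l ?(ltW eta_gt0) // lerDl mulr_ge0.
pose w := (a +i* b)%C.
have -> : contour F x y d N = contour (fun z => F z - F w - (z - w) * q) x y d N.
  rewrite -[RHS]addr0 -(contour_affine (F w) q w x y d N) -contourD.
  by congr contour; apply/funext => z; ring.
have -> : eta * d ^+ 2 = 4 * d * (eta / 8 * (2 * d)) by field.
apply: contour_le => // s t s_in t_in _.
have nc_le2d : nc ((s +i* t)%C - w) <= 2 * d.
  apply: (le_trans (nc_le _)); rewrite /=.
  have h1 : `|s - a| <= d by rewrite ler_norml; lra.
  have h2 : `|t - b| <= d by rewrite ler_norml; lra.
  lra.
have := r1P ((s +i* t)%C - w); rewrite subrKC => /(_ _)/le_trans; apply.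
  lra.
by rewrite ler_wpM2l // divr_ge0 // ltW.
Qed.

(** The sum is ['i] times two Riemann sums of [2 d / (u^2 + d^2)] over [[-d, d]]. This function is
    at least [1 / d] there, so each of them is at least 2. The bound 4 stands in for the modulus 2
    pi of the integral. *)
Lemma contour_inv (c1 c2 d : R) N : 0 < d ->
  4 <= nc (contour (fun z => (z - (c1 +i* c2)%C)^-1) (c1 - d) (c2 - d) (2 * d) N).
Proof.
move=> d_gt0; pose k u := 2 * d / (u ^+ 2 + d ^+ 2).
have k_ge u : `|u| <= d -> d^-1 <= k u.
  move=> u_le; have u2 : u ^+ 2 <= d ^+ 2 by rewrite -real_normK ?num_real // ler_sqr ?nnegrE // ltW.
  have d2 : 0 < d ^+ 2 by rewrite exprn_gt0.
  have p2 : 0 < u ^+ 2 + d ^+ 2 by rewrite ltr_wpDl ?sqr_ge0.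
  rewrite /k ler_pdivlMr // -[leRHS](mulfK (lt0r_neq0 d_gt0)) mulrC ler_pM2r ?invr_gt0 //.
  rewrite -mulrA -expr2; lra.
have sqD u : u ^+ 2 + d ^+ 2 != 0 by rewrite gt_eqF // ltr_wpDl ?sqr_ge0 ?exprn_gt0.
pose K c := (2 * d) / 2 ^+ N * \sum_(j < 2 ^ N) k (c - d + 2 * d * j%:R / 2 ^+ N - c).
have K_ge c : 2 <= K c.
  have p0 : (0 : R) < 2 ^+ N by rewrite exprn_gt0.
  have -> : 2 = (2 * d) / 2 ^+ N * \sum_(j < 2 ^ N) d^-1.
    rewrite sumr_const card_ord -[d^-1 *+ _]mulr_natl natrX; field.
    by rewrite !gt_eqF.
  apply: ler_wpM2l; first by rewrite divr_ge0 ?(ltW p0) // mulr_ge0 ?ltW.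
  apply: ler_sum => j _; apply: k_ge.
  have jN : (j%:R : R) / 2 ^+ N <= 1.
    by rewrite ler_pdivrMr // mul1r -natrX ler_nat ltnW.
  have jN0 : 0 <= (j%:R : R) / 2 ^+ N by rewrite divr_ge0 ?ler0n // ltW.
  rewrite -mulrA; set q := _ / _ in jN jN0 *.
  have h1 : d * q <= d * 1 by rewrite ler_pM2l.
  have h2 : 0 <= d * q by rewrite mulr_ge0 // ltW.
  by rewrite ler_norml; lra.
have KE f c : (forall s, f s = (k (s - c))%:C%C) ->
    riemann_sum f (c - d) (2 * d) N = (K c)%:C%C.
  move=> fE; rewrite /riemann_sum /K [RHS]rmorphM /=; congr (_ * _).
  by rewrite rmorph_sum /=; apply: eq_bigr => j _; rewrite fE.
have E : contour (fun z => (z - (c1 +i* c2)%C)^-1) (c1 - d) (c2 - d) (2 * d) N =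
    'i%C * (K c1 + K c2)%:C%C.
  rewrite /contour rmorphD /= mulrDr; congr (_ + 'i%C * _); last first.
    apply: KE => s; apply/eqP; rewrite eq_complex /= /k.
    have -> : c1 - d + 2 * d - c1 = d by ring.
    have -> : c1 - d - c1 = - d by ring.
    have sD : d ^+ 2 + (s - c2) ^+ 2 != 0 by rewrite addrC.
    by apply/andP; split; apply/eqP; field; rewrite ?sqrrN ?sD ?sqD.
  have KE' f : (forall s, f s = 'i%C * (k (s - c1))%:C%C) ->
      riemann_sum f (c1 - d) (2 * d) N = 'i%C * (K c1)%:C%C.
    move=> fE; rewrite -(KE (fun s => (k (s - c1))%:C%C) c1) // /riemann_sum mulrCA.
    by congr (_ * _); rewrite mulr_sumr; apply: eq_bigr => j _; rewrite fE.
  apply: KE' => s; apply/eqP; rewrite eq_complex /= /k.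
  have -> : c2 - d + 2 * d - c2 = d by ring.
  have -> : c2 - d - c2 = - d by ring.
  by apply/andP; split; apply/eqP; field; rewrite ?sqrrN ?sqD.
rewrite E ncM nci mul1r ncR ger0_norm; first by have := K_ge c1; have := K_ge c2; lra.
by have := K_ge c1; have := K_ge c2; lra.
Qed.

(** For fixed [c], [goursat] applies to [F z = (H z - H c) / (z - c)], so its sum over a large
    square around [c] is small. In the splitting of [H z - H c] into [H z - L] and [L - H c], the
    first part contributes little because [H] is close to [L] on the boundary, while by
    [contour_inv] the second contributes at least [4 |L - H c|]. *)
Lemma liouville (H : C -> C) (L : C) : (forall z, cdiff_at H z) ->
  (forall e, 0 < e -> exists r, forall z, r < nc z -> nc (H z - L) < e) ->
  forall z, H z = L.
Proof.
move=> dH Hoo c.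
have [c1 [c2 defc]] : exists c1 c2, c = (c1 +i* c2)%C by case: (c) => c1 c2; exists c1, c2.
pose F z := (H z - H c) * (z - c)^-1.
have dF z : z != c -> cdiff_at F z.
  move=> zc; apply: cdiffM; first by apply: cdiffB => //; exact: cdiff_cst.
  apply: cdiffV; first by rewrite subr_eq0.
  by apply: cdiffB; [exact: cdiff_id|exact: cdiff_cst].
have [q qP] := cdiff_eps (dH c).
have [r r_gt0 rP] := qP 1 ltr01.
have FM h : nc h < r -> nc (F (c + h)) <= nc q + 1.
  move=> /rP; rewrite mul1r /F [c + h - c]addrC addKr => le_h.
  have [->|h0] := eqVneq h 0; first by rewrite invr0 mulr0 nc0 addr_ge0 ?nc_ge0.
  rewrite ncM ncV ler_pdivrMr ?nc_gt0 //.
  rewrite -[H (c + h) - H c](subrK (h * q)) (le_trans (ncD _ _)) //.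
  rewrite (le_trans (lerD le_h (lexx _))) // ncM; lra.
apply/eqP; rewrite -subr_eq0 -nc_eq0; apply/eqP/le_anti; rewrite nc_ge0 andbT.
apply/ler_addgt0Pl => e e_gt0; rewrite addr0.
(* The square has perimeter [8 d] and [1 / |z - c| <= 1 / d] on it, so the part with [H z - L] is at
   most [e / 4]. *)
have [r2 r2P] := Hoo (e / 32) (ltac:(by rewrite divr_gt0)).
(* Chosen so that the boundary, at distance at least [d] from [c], lies beyond radius [r2]. *)
pose d := `|r2| + nc c + 1.
have d_gt0 : 0 < d by rewrite ltr_wpDl // addr_ge0 ?nc_ge0.
have [N0 /(_ _ (leqnn _)) N0P] := goursat r_gt0 dF FM (c1 - d) (c2 - d)
  (ltac:(rewrite mulr_gt0 //) : 0 < 2 * d) e_gt0.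
have FE : F = fun z => (H z - L) * (z - c)^-1 + (L - H c) * (z - c)^-1.
  by apply/funext => z; rewrite /F; ring.
rewrite FE contourD contourZ in N0P.
have inv_ge : 4 <= nc (contour (fun z => (z - c)^-1) (c1 - d) (c2 - d) (2 * d) N0).
  by rewrite defc; exact: contour_inv.
have small : nc (contour (fun z => (H z - L) * (z - c)^-1) (c1 - d) (c2 - d) (2 * d) N0)
    <= 4 * (2 * d) * (e / 32 * d^-1).
  apply: contour_le => [|s t s_in t_in bd]; first by rewrite mulr_gt0.
  have far : d <= nc ((s +i* t)%C - c).
    have hR := nc_Re ((s +i* t)%C - c); have hI := nc_Im ((s +i* t)%C - c).
    rewrite defc /= in hR hI *.
    have [sc|sc] := boolP ((s == c1 - d) || (s == c1 - d + 2 * d)).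
      apply: le_trans hR; have -> : `|s - c1| = d; last by [].
      case/orP: sc => /eqP ->; first by rewrite addrC addKr normrN gtr0_norm.
      by rewrite (_ : _ - c1 = d) ?gtr0_norm //; ring.
    apply: le_trans hI; have -> : `|t - c2| = d; last by [].
    move: bd; rewrite (negPf sc) /= => /orP[] /eqP ->; first by rewrite addrC addKr normrN gtr0_norm.
    by rewrite (_ : _ - c2 = d) ?gtr0_norm //; ring.
  rewrite ncM ncV; apply: ler_pM; rewrite ?nc_ge0 ?invr_ge0 ?nc_ge0 //.
    apply/ltW/r2P; apply: (le_lt_trans (ler_norm _)).
    have := le_trans far (ncD (s +i* t)%C (- c)); rewrite ncN /d; lra.
  by rewrite lef_pV2 ?posrE // (lt_le_trans d_gt0).
have E4 : 4 * (2 * d) * (e / 32 * d^-1) = e / 4 by field; rewrite gt_eqF.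
rewrite E4 in small.
have h4 : nc (L - H c) * 4 <= e + e / 4.
  apply: (@le_trans _ _ (nc (L - H c) * nc (contour (fun z => (z - c)^-1) (c1 - d) (c2 - d) (2 * d) N0))).
    by rewrite ler_wpM2l ?nc_ge0.
  rewrite -ncM; set u := _ * contour _ _ _ _ _ in N0P *.
  set v := contour _ _ _ _ _ in N0P small.
  have := nc_subD u v; rewrite [u + v]addrC; lra.
rewrite ncB; lra.
Qed.

End Liouville.

(** * The closed form of a rational curve *)

Section RationalForm.
Variable R : realType.
Local Notation C := R[i].
Local Notation nc := (@Normc.normc R).

(* A coordinate on the complement of p, in which p is at infinity. *)
Definition mobius (p : CP1 R) (w : C) : CP1 R :=
  match p with
  | None => Some w
  | Some a => if w == 0 then None else Some (a + w^-1)
  end.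

Lemma mobius_inj p : injective (mobius p).
Proof.
case: p => [a|] w1 w2 /=; last by case.
have [->|w10] := eqVneq w1 0; have [->|w20] := eqVneq w2 0 => //.
by case=> /addrI/invr_inj.
Qed.

Lemma mobius_neq p w : mobius p w <> p.
Proof.
case: p => [a|] //=; have [//|w0] := eqVneq w 0 => -[].
by move/eqP; rewrite -subr_eq0 addrC addKr invr_eq0 (negPf w0).
Qed.

Lemma mobius_surj p q : q <> p -> exists w, mobius p w = q.
Proof.
case: p q => [a|] [b|] //= qp.
- have ba : b - a != 0 by rewrite subr_eq0; apply/eqP => ba; apply: qp; rewrite ba.
  by exists (b - a)^-1; rewrite invr_eq0 (negPf ba) invrK subrKC.
- by exists 0; rewrite eqxx.
- by exists b.
Qed.

Lemma chart_mobius p h : h != 0 -> chart p h = mobius p h^-1.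
Proof. by case: p => [a|] /= h0; rewrite ?invr_eq0 (negPf h0) ?invrK. Qed.

(** The change of coordinate has the form [h |-> h * psi h] with [psi 0 != 0], so it preserves
    differentiability and the order of zeros and poles. *)
Lemma mobius_chart p w : exists psi : C -> C,
  [/\ cdiff_at psi 0, psi 0 != 0 &
    \forall h \near (0 : C^o), mobius p (w + h) = chart (mobius p w) (h * psi h)].
Proof.
have near0 (f : C -> C) : cdiff_at f 0 -> f 0 != 0 -> \forall h \near (0 : C^o), f h != 0.
  move=> df f0; have f0' : 0 < nc (f 0) by rewrite nc_gt0.
  have [r r_gt0 rP] := cdiff_cont_eps df f0'.
  apply/near_ncP; exists r => // h /rP; rewrite add0r => lt_f.
  by apply/eqP => fh; rewrite fh sub0r ncN ltxx in lt_f.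
case: p => [a|] /=; last first.
  exists (fun=> 1); split; [exact: cdiff_cst|exact: oner_neq0|].
  by apply/near_ncP; exists 1 => [|h _]; rewrite ?ltr01 ?mulr1 ?add0r.
have [->|w0] := eqVneq w 0.
  pose D (h : C) := 1 + a * h.
  have dD : cdiff_at D 0.
    apply: cdiffD; first exact: cdiff_cst.
    by apply: cdiffM; [exact: cdiff_cst|exact: cdiff_id].
  have D0 : D 0 != 0 by rewrite /D mulr0 addr0 oner_neq0.
  exists (fun h => (D h)^-1); split; [exact: cdiffV|by rewrite invr_eq0|].
  apply: filterS (near0 _ dD D0) => h Dh /=.
  rewrite add0r mulf_eq0 invr_eq0 (negPf Dh) orbF.
  have [//|h0] := eqVneq h 0; congr Some; rewrite /D in Dh *.
  by field; rewrite h0 Dh.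
pose D (h : C) := w * (w + h).
have dD : cdiff_at D 0.
  apply: cdiffM; first exact: cdiff_cst.
  by apply: cdiffD; [exact: cdiff_cst|exact: cdiff_id].
have D0 : D 0 != 0 by rewrite /D addr0 mulf_neq0.
exists (fun h => - 1 * (D h)^-1); split.
- by apply: cdiffM; [exact: cdiff_cst|exact: cdiffV].
- by rewrite mulf_neq0 ?invr_eq0 // oppr_eq0 oner_neq0.
apply: filterS (near0 _ dD D0) => h; rewrite /D mulf_eq0 negb_or w0 /= => wh.
by rewrite (negPf wh); congr Some; field; rewrite w0 wh.
Qed.

(** Differentiability of [u] is asked at 0 only: filling in a puncture takes no more, and an
    ordinary point directly supplies just that. *)
Definition weak_order (g : CP1 R -> C) (p : CP1 R) (m : int) : Prop :=
  exists u : C -> C, [/\ cdiff_at u 0, u 0 != 0 &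
    \forall w \near (0 : C^o), w != 0 -> g (chart p w) = w ^ m * u w].

Lemma has_order_weak g p m : has_order g p m -> weak_order g p m.
Proof. by case=> u [/nbhs_singleton du u0 gu]; exists u. Qed.

Lemma cdiff_idM (f : C -> C) w : cdiff_at f w -> cdiff_at (fun h => h * f h) w.
Proof. by move=> df; exact: cdiffM (@cdiff_id _ w) df. Qed.

Lemma near0_mul_cdiff (psi : C -> C) (P : C -> Prop) : cdiff_at psi 0 ->
  (\forall h \near (0 : C^o), P h) -> \forall h \near (0 : C^o), P (h * psi h).
Proof.
move=> dpsi nP.
have H : (fun h : C^o => (h * psi h : C^o)) @ (0 : C^o) --> ((0 * psi 0) : C^o).
  exact: cdiff_cont (cdiff_idM dpsi).
by rewrite mul0r in H; exact: H nP.
Qed.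

Lemma cdiff_mobius (g : CP1 R -> C) p w :
  cdiff_at (fun h => g (chart (mobius p w) h)) 0 -> cdiff_at (fun z => g (mobius p z)) w.
Proof.
move=> dg; have [psi [dpsi psi0 near_psi]] := mobius_chart p w.
have dphi := cdiff_idM dpsi.
have d1 : cdiff_at (fun h => g (mobius p (w + h))) 0.
  apply: (near_eq_cdiff (f := (fun h => g (chart (mobius p w) h)) \o (fun h => h * psi h))).
    by apply: filterS near_psi => h ->.
  have dg0 : cdiff_at (fun h => g (chart (mobius p w) h)) (0 * psi 0).
    rewrite mul0r.
    exact: dg.
  exact: (@cdiff_comp R (fun h => h * psi h) (fun h => g (chart (mobius p w) h)) 0 dphi dg0).
have d2 : cdiff_at (fun z => z - w) w by apply: cdiffB; [exact: cdiff_id|exact: cdiff_cst].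
rewrite -(subrr w) in d1.
by apply: eq_cdiff (cdiff_comp d2 d1) => z /=; rewrite subrKC.
Qed.

Lemma near_neq (z w : C) : z != w -> \forall h \near (0 : C^o), z + h != w.
Proof.
move=> zw; apply/near_ncP; exists (nc (z - w)); first by rewrite nc_gt0 subr_eq0.
move=> h; rewrite add0r => h_lt; apply/eqP => zhw.
by move: h_lt; rewrite -zhw opprD addNKr ncN ltxx.
Qed.

(** The product [P w = prod_i (w - a i) ^ (e i)] cancels the zeros and poles of [g] at the points
    [a i], and the order prescribed at [p] makes [g * P] converge at infinity. Filled in at the
    [a i] this product is entire, hence constant by Liouville's theorem. *)
Lemma rational_form (g : CP1 R -> C) (p : CP1 R) (m : nat) (a : 'I_m -> C)
    (e : 'I_m -> int) : injective a ->
  (forall w, (forall i, w != a i) -> cdiff_at (fun h => g (chart (mobius p w) h)) 0) ->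
  (forall i, weak_order g (mobius p (a i)) (- e i)) ->
  weak_order g p (\sum_i e i) ->
  exists2 c, c != 0 & forall w, (forall i, w != a i) ->
    g (mobius p w) = c * \prod_i (w - a i) ^ (- e i).
Proof.
move=> a_inj dg ga [u [du u0 gu]].
pose G w := g (mobius p w).
pose P w := \prod_i (w - a i) ^ (e i).
have dfac (b z : C) (k : int) : z != b -> cdiff_at (fun z => (z - b) ^ k) z.
  move=> zb; apply: cdiffXz; first by rewrite subr_eq0.
  by apply: cdiffB; [exact: cdiff_id|exact: cdiff_cst].
have dP w : (forall i, w != a i) -> cdiff_at P w.
  by move=> wa; apply: cdiff_prod => i _; exact: dfac.
have /choice[v vP] : forall i, exists v : C -> C, cdiff_at v 0 /\
    \forall h \near (0 : C^o), h != 0 -> G (a i + h) * P (a i + h) = v h.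
  move=> i; have [s [ds s0 gs]] := ga i.
  have [psi [dpsi psi0 near_psi]] := mobius_chart p (a i).
  have dphi := cdiff_idM dpsi.
  exists (fun h => psi h ^ (- e i) * s (h * psi h) *
    \prod_(j | j != i) (a i + h - a j) ^ e j); split.
    apply: cdiffM; first apply: cdiffM; first exact: cdiffXz.
      by apply: (cdiff_comp dphi); rewrite mul0r.
    apply: cdiff_prod => j ji.
    apply: (@cdiff_shift _ (fun z => (z - a j) ^ e j)).
    by rewrite addr0; apply: dfac; rewrite (inj_eq a_inj) eq_sym.
  have near_psi0 : \forall h \near (0 : C^o), psi h != 0.
    have psi0' : 0 < nc (psi 0) by rewrite nc_gt0.
    have [r r_gt0 rP] := cdiff_cont_eps dpsi psi0'.
    apply/near_ncP; exists r => // h /rP; rewrite add0r => lt_f.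
    by apply/eqP => fh; rewrite fh sub0r ncN ltxx in lt_f.
  near=> h => h0.
  have psih : psi h != 0 by near: h; exact: near_psi0.
  have -> : G (a i + h) = (h * psi h) ^ (- e i) * s (h * psi h).
    rewrite /G (near near_psi h _) //.
    have : h * psi h != 0 by rewrite mulf_neq0.
    near: h; exact: near0_mul_cdiff gs.
  rewrite /P (bigD1 i) //= expfzMl -[a i + h - a i]addrAC subrr add0r.
  have hh : h ^ (- e i) * h ^ e i = 1 by rewrite -expfzDr // addNr expr0z.
  by rewrite -[RHS]mul1r -hh; ring.
pose H w := if [pick i | w == a i] is Some i then v i 0 else G w * P w.
have HE w : (forall i, w != a i) -> H w = G w * P w.
  by move=> wa; rewrite /H; case: pickP => // i /eqP wai; have := wa i; rewrite wai eqxx.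
have Ha i : H (a i) = v i 0.
  rewrite /H; case: pickP => [j /eqP/a_inj -> //|/(_ i)]; by rewrite eqxx.
have near_a w : \forall h \near (0 : C^o), forall i, w != a i -> w + h != a i.
  apply: (@filter_forall _ _ (fun i (h : C^o) => w != a i -> w + h != a i) (nbhs (0 : C^o))) => i; have [->|wa] := eqVneq w (a i).
    by apply/near_ncP; exists 1 => [|h _ /eqP]; rewrite ?ltr01.
  by apply: filterS (near_neq wa).
have unshift (f : C -> C) (w : C) : cdiff_at (fun h => f (w + h)) 0 -> cdiff_at f w.
  rewrite -(subrr w) => df.
  have d2 : cdiff_at (fun z => z - w) w by apply: cdiffB; [exact: cdiff_id|exact: cdiff_cst].
  by apply: eq_cdiff (cdiff_comp d2 df) => z /=; rewrite subrKC.
have dH z : cdiff_at H z.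
  have [/existsP[i /eqP ->]|/existsPn za] := boolP [exists i, z == a i].
    have [dv nv] := vP i; apply: unshift; apply: near_eq_cdiff dv.
    near=> h; have [->|h0] := eqVneq h 0; first by rewrite addr0 Ha.
    rewrite HE; first by rewrite (near nv h _).
    move=> j; have [<-|ij] := eqVneq i j.
      by rewrite -subr_eq0 addrC addKr.
    have : a i != a j by rewrite (inj_eq a_inj).
    by move: (j) {ij}; near: h; exact: near_a.
  have d1 : cdiff_at (fun z => G z * P z) z.
    by apply: cdiffM; [exact/cdiff_mobius/dg|exact: dP].
  rewrite -[z]addr0 in d1; apply: unshift; apply: near_eq_cdiff (cdiff_shift d1).
  by near=> h; rewrite HE // => i; apply: (near (near_a z) h _) => //; exact: za.
(* This is [G * P] in the coordinate [h = 1 / w] at [p]; the power [h ^ (sum_i e i)] in [g] is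
   absorbed by the factors [1 / h - a i]. *)
pose V h := u h * \prod_i (1 - a i * h) ^ e i.
have dV : cdiff_at V 0.
  apply: (cdiffM du); apply: cdiff_prod => i _; apply: cdiffXz.
    by rewrite mulr0 subr0 oner_neq0.
  apply: cdiffB; first exact: cdiff_cst.
  by apply: cdiffM; [exact: cdiff_cst|exact: cdiff_id].
have V0 : V 0 = u 0.
  by rewrite /V big1 ?mulr1 // => i _; rewrite mulr0 subr0 exp1rz.
have GPV : \forall h \near (0 : C^o), h != 0 -> G h^-1 * P h^-1 = V h.
  apply: filterS gu => h gh h0; rewrite /G -chart_mobius // gh //.
  rewrite /V mulrAC [RHS]mulrC; congr (_ * _).
  have -> : h ^ (\sum_i e i) = \prod_i h ^ (e i).
    elim/big_rec2: _ => [|i x y _ <-]; first by rewrite expr0z.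
    by rewrite expfzDr.
  rewrite /P -big_split /=; apply: eq_bigr => i _; rewrite -expfzMl.
  by congr (_ ^ _); field.
have Hoo eps : 0 < eps -> exists r, forall z, r < nc z -> nc (H z - u 0) < eps.
  move=> eps_gt0; have [r r_gt0 rP] := cdiff_cont_eps dV eps_gt0.
  have /near_ncP[r1 r1_gt0 r1P] := GPV.
  exists (r^-1 + r1^-1 + \sum_i nc (a i)) => z z_gt.
  have s0 : 0 <= \sum_i nc (a i) by apply: sumr_ge0 => i _; exact: nc_ge0.
  have ri : 0 < r^-1 by rewrite invr_gt0.
  have r1i : 0 < r1^-1 by rewrite invr_gt0.
  have z_gt0 : 0 < nc z by lra.
  have z0 : z != 0 by rewrite -nc_gt0.
  have zr s : 0 < s -> s^-1 < nc z -> nc z^-1 < s.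
    by move=> s_gt0 s_lt; rewrite ncV -[s]invrK ltf_pV2 ?posrE ?invr_gt0.
  have za i : z != a i.
    apply: contraTneq z_gt => ->; rewrite -leNgt (bigD1 i) //=.
    have : 0 <= \sum_(j | j != i) nc (a j) by apply: sumr_ge0 => j _; exact: nc_ge0.
    lra.
  have := r1P _ (zr _ r1_gt0 (ltac:(lra))); rewrite add0r invr_eq0 z0 invrK => /(_ isT) Ez.
  by rewrite HE // Ez -V0 -[z^-1]add0r rP // zr //; lra.
exists (u 0) => // w wa.
have := liouville dH Hoo w; rewrite HE // => <-.
rewrite -mulrA -big_split big1 /= ?mulr1 // => i _.
by rewrite -expfzDr ?addrN ?expr0z // subr_eq0.
Unshelve. all: by end_near.
Qed.

End RationalForm.

(** * Logarithmic images as sums of logarithms *)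

Section LogImage.
Variables (R : realType) (n : nat).
Local Notation C := R[i].
Local Notation nc := (@Normc.normc R).

(** Points and vectors are indexed by [nat] and only the first [M] of them count, so that [M] can be
    rewritten without casts. *)
Definition log_factors (M : nat) (d : nat -> 'rV[int]_n) (a : nat -> C)
    (p : 'rV[R]_n) : set 'rV[R]_n :=
  [set p - \sum_(i < M) ln (nc (w - a i)) *: toR R (d i) |
    w in [set w | forall i, (i < M)%N -> w != a i]].

Lemma toR0 : toR R (0 : 'rV[int]_n) = 0.
Proof. by apply/rowP => j; rewrite !mxE. Qed.

Lemma toRN (d : 'rV[int]_n) : toR R (- d) = - toR R d.
Proof. by apply/rowP => j; rewrite !mxE rmorphN. Qed.

Lemma toRD (d e : 'rV[int]_n) : toR R (d + e) = toR R d + toR R e.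
Proof. by apply/rowP => j; rewrite !mxE rmorphD. Qed.

Lemma toR_sum (I : Type) (r : seq I) (P : pred I) (F : I -> 'rV[int]_n) :
  toR R (\sum_(i <- r | P i) F i) = \sum_(i <- r | P i) toR R (F i).
Proof. exact: (big_morph _ toRD toR0). Qed.

Lemma ord_empty (k : nat) (i : 'I_k) : k = 0%N -> False.
Proof. by move=> k0; case: i => i; rewrite k0. Qed.

Lemma ln_Xz (x : R) (m : int) : 0 < x -> ln (x ^ m) = m%:~R * ln x.
Proof.
move=> x_gt0; case: m => k; first by rewrite -exprnP lnXn // mulr_natl.
rewrite NegzE -exprnN lnV ?posrE ?exprn_gt0 // lnXn // mulrNz mulNr.
by rewrite -[k.+1%:~R]/(k.+1%:R) mulr_natl.
Qed.

Lemma ln_prod (M : nat) (F : 'I_M -> R) : (forall i, 0 < F i) ->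
  ln (\prod_i F i) = \sum_i ln (F i).
Proof.
move=> F_gt0; suff [] : 0 < \prod_i F i /\ ln (\prod_i F i) = \sum_i ln (F i) by [].
elim/big_rec2: _ => [|i x y _ [x_gt0 IH]]; first by rewrite ln1.
by rewrite mulr_gt0 // lnM ?posrE // IH.
Qed.

(** For [k >= 2] the number [(k - 2).+1] is [k - 1], the number of finite punctures once the last
    one is at infinity. For [k <= 1] it is 1, and a dummy point with vector 0 is put in, so that the
    trees to come always have a leg. *)
Lemma log_curve_image (Delta : seq 'rV[int]_n) (f : curve_data R n (size Delta)) :
  toric_degree Delta -> curve_of_degree f ->
  exists a p, (forall i j, (i < (size Delta - 2).+1)%N -> (j < (size Delta - 2).+1)%N ->
      a i = a j -> i = j) /\
    (@Log R n) @` curve_image f = log_factors (size Delta - 2).+1 (fun i => Delta`_i) a p.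
Proof.
move=> Delta0 [[pinj fP] ford]; set k := size Delta.
have Dsum j : \sum_(i < k) Delta`_i 0 j = 0.
  move: Delta0; rewrite /toric_degree (big_nth 0) big_mkord => /(congr1 (fun v : 'rV_n => v 0 j)).
  by rewrite summxE mxE.
(* without punctures, the point at infinity plays the role of the last one *)
have [p [pP pk]] : exists p, (forall i : 'I_k, (i < k.-1)%N -> puncture f i <> p) /\
    forall i : 'I_k, ~~ (i < k.-1)%N -> puncture f i = p.
  have [k0|k_gt0] := posnP k.
    by exists None; split=> i; case: (ord_empty i k0).
  have lt_k : (k.-1 < k)%N by rewrite prednK.
  exists (puncture f (Ordinal lt_k)); split=> i i_lt.
    by move/pinj => E; rewrite E /= ltnn in i_lt.
  congr puncture; apply/val_inj/anti_leq => /=.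
  by rewrite -leqNgt in i_lt; rewrite i_lt andbT -ltnS prednK // ltn_ord.
have /choice[a aP] : forall i : nat, exists w, forall i' : 'I_k, i' = i :> nat ->
    (i < k.-1)%N -> mobius p w = puncture f i'.
  move=> i; have [i_lt|i_ge] := boolP (i < k.-1)%N; last by exists 0.
  have ik : (i < k)%N := leq_trans i_lt (leq_pred k).
  have [w wP] := mobius_surj (pP (Ordinal ik) i_lt).
  by exists w => i' E _; rewrite wP; congr puncture; apply/val_inj; exact: esym E.
have wid (i : 'I_k.-1) : (i < k)%N := leq_trans (ltn_ord i) (leq_pred k).
pose o i := Ordinal (wid i).
have aE i : mobius p (a (i : 'I_k.-1)) = puncture f (o i) by exact: aP.
have a_inj : injective (fun i : 'I_k.-1 => a i).
  by move=> i j /= aij; apply/val_inj; have := aE i; rewrite aij aE => /pinj [].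
have notp w : (forall i : 'I_k.-1, w != a i) -> ~ range (puncture f) (mobius p w).
  move=> wa [i _ ip]; have [i_lt|/pk E] := boolP (i < k.-1)%N.
    have := wa (Ordinal i_lt); rewrite -(aP i i) // in ip.
    by move/mobius_inj: ip => /= ->; rewrite eqxx.
  by apply: (@mobius_neq _ p w); rewrite -ip.
have porder j : weak_order (fun q => curve_map f q 0 j) p (\sum_(i < k.-1) Delta`_i 0 j).
  have [k0|k_gt0] := posnP k.
    have pN : ~ range (puncture f) p by move=> [i0]; case: (ord_empty i0 k0).
    have [h1 h2] := fP _ pN j.
    exists (fun w => curve_map f (chart p w) 0 j); split; first by split.
      by case: (p) h1 => [b|] /=; rewrite ?addr0 ?eqxx.
    apply/near_ncP; exists 1 => // h _ _.
    by rewrite (_ : \sum_(i < k.-1) _ = 0) ?expr0z ?mul1r // k0 big_ord0.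
  have lt_k : (k.-1 < k)%N by rewrite prednK.
  have -> : \sum_(i < k.-1) Delta`_i 0 j = - Delta`_(Ordinal lt_k) 0 j.
    have := Dsum j; rewrite -(big_mkord xpredT (fun i => Delta`_i 0 j)).
    rewrite -{1}(prednK k_gt0) big_nat_recr //= big_mkord => /eqP.
    by rewrite addr_eq0 => /eqP.
  rewrite -(pk (Ordinal lt_k)) ?ltnn //.
  exact: has_order_weak.
have /choice[c cP] : forall j, exists c : C, c != 0 /\ forall w, (forall i : 'I_k.-1, w != a i) ->
    curve_map f (mobius p w) 0 j = c * \prod_(i < k.-1) (w - a i) ^ (- Delta`_i 0 j).
  move=> j; have [|||c c0 cP] := @rational_form _ (fun q => curve_map f q 0 j) p k.-1
    (fun i => a i) (fun i => Delta`_i 0 j) a_inj; last by exists c.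
  - by move=> w wa; split; have [] := fP _ (notp _ wa) j.
  - by move=> i; rewrite aE; apply: has_order_weak; exact: ford.
  - exact: porder.
pose P : 'rV[R]_n := \row_j ln (nc (c j)).
have LogE w : (forall i : 'I_k.-1, w != a i) -> Log (curve_map f (mobius p w)) =
    P - \sum_(i < k.-1) ln (nc (w - a i)) *: toR R Delta`_i.
  move=> wa; apply/rowP => j; rewrite !mxE summxE (cP j).2 // ncM nc_prod.
  have pos i : 0 < nc ((w - a (i : 'I_k.-1)) ^ (- Delta`_i 0 j)).
    by rewrite nc_gt0 expfz_neq0 // subr_eq0.
  rewrite lnM ?posrE ?nc_gt0 ?(cP j).1 ?ln_prod //; last first.
    by rewrite -nc_prod nc_gt0; apply/prodf_neq0 => i _; rewrite -nc_gt0.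
  congr (_ + _); rewrite -sumrN; apply: eq_bigr => i _.
  by rewrite ncXz ln_Xz ?nc_gt0 ?subr_eq0 // !mxE mulrNz mulNr mulrC.
have imE : (@Log R n) @` curve_image f = log_factors k.-1 (fun i => Delta`_i) a P.
  apply/seteqP; split=> [_ [_ [q qN <-] <-]|_ [w wa <-]]; last first.
    have wa' (i : 'I_k.-1) : w != a i by exact: wa.
    by exists (curve_map f (mobius p w)); [exists (mobius p w) => //; exact: notp|exact: LogE].
  have [qp|qp] := pselect (q = p); last first.
    have [w wq] := mobius_surj qp; subst q.
    have wa (i : 'I_k.-1) : w != a i.
      by apply/eqP => wai; apply: qN; exists (o i) => //; rewrite -aE wai.
    by exists w; [move=> i ik; exact: (wa (Ordinal ik))|rewrite LogE].
  (* Only in the absence of punctures is [p] itself a point of the curve. The map is then constant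
     on the other points, and continuity gives its value at [p]. *)
  have k0 : k = 0.
    have [//|k_gt0] := posnP k; have lt_k : (k.-1 < k)%N by rewrite prednK.
    by case: qN; exists (Ordinal lt_k) => //; rewrite qp pk ?ltnn.
  have k1 : k.-1 = 0%N by rewrite k0.
  exists 0 => [i|]; first by rewrite k1.
  have wa w : forall i : 'I_k.-1, w != a i by move=> i; case: (ord_empty i k1).
  have s0 w j : \prod_(i < k.-1) (w - a i) ^ (- Delta`_i 0 j) = 1.
    by apply: big1 => i _; case: (ord_empty i k1).
  rewrite -LogE //; congr Log; apply/rowP => j.
  have [c0 cE] := cP j; rewrite cE // s0 mulr1 qp.
  have [_ du] := fP _ qN j; rewrite qp in du.
  have ch0 : chart p 0 = p by case: (p) => [b|] /=; rewrite ?addr0 ?eqxx.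
  apply/esym/eqP; rewrite -subr_eq0 -nc_eq0; apply/eqP/le_anti; rewrite nc_ge0 andbT.
  apply/ler_addgt0Pl => e e_gt0; rewrite addr0 ltW //.
  have [r r_gt0 rP] := cdiff_cont_eps (CdiffAt du) e_gt0.
  have := rP (r / 2)%:C%C; rewrite ncR gtr0_norm ?divr_gt0 // => /(_ (ltac:(lra))).
  have h0 : (r / 2)%:C%C != 0 by rewrite -nc_gt0 ncR gtr0_norm divr_gt0.
  by rewrite add0r ch0 (chart_mobius p h0) (cE _ (wa _)) s0 mulr1 ncB.
have [k2|k1] := leqP 2 k.
  have kE : (k - 2).+1 = k.-1 by lia.
  exists a, P; rewrite kE; split=> [i j ik jk aij|]; last exact: imE.
  by case: (a_inj (Ordinal ik) (Ordinal jk) aij).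
exists (fun=> 0), P; have -> : (k - 2).+1 = 1%N by lia.
split=> [[|i] [|j] //|]; rewrite imE.
have k10 : k.-1 = 0%N by lia.
have d0 : Delta`_0 = 0.
  case: (posnP k) => [k0|k_gt0]; first by rewrite nth_default // -/k k0.
  apply/rowP => j; rewrite mxE; have := Dsum j.
  have k1' : k = 1%N by rewrite -(prednK k_gt0) k10.
  by rewrite -(big_mkord xpredT (fun i => Delta`_i 0 j)) k1' big_nat1.
apply/seteqP; split=> [_ [w _ <-]|_ [w _ <-]].
  exists 1 => [i _|]; first exact: oner_neq0.
  by rewrite k10 big_ord0 big_ord1 d0 toR0 scaler0.
exists 0 => [i|]; first by rewrite k10.
by rewrite k10 big_ord0 big_ord1 d0 toR0 scaler0.
Qed.

End LogImage.

(** * Rooted trees *)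

Section ParentTree.
Variables (V : finType) (r : V) (pr : V -> V) (rk : V -> nat).
Hypothesis pr_root : pr r = r.
Hypothesis pr_rank : forall x, x != r -> (rk (pr x) < rk x)%N.

(** A rooted tree is coded by its parent map [pr]; a rank that drops along [pr] excludes cycles.
    Throughout, [fconnect pr v c] says that [c] is [v] or an ancestor of [v], that is, [v] lies
    below [c]. *)
Definition parent_adj (u v : V) : bool :=
  (u != r) && (pr u == v) || (v != r) && (pr v == u).

Lemma parent_adj_sym : symmetric parent_adj.
Proof. by move=> u v; rewrite /parent_adj orbC. Qed.

Lemma parent_neq x : x != r -> pr x != x.
Proof. by move/pr_rank; apply: contraTneq => ->; rewrite ltnn. Qed.

Lemma parent_adj_irr : irreflexive parent_adj.
Proof.
move=> x; rewrite /parent_adj orbb; apply/negP => /andP[/parent_neq].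
by move=> /negPf ->.
Qed.

Lemma iter_rank i x : iter i pr x = x \/ (rk (iter i pr x) < rk x)%N.
Proof.
elim: i => [|i IHi] /=; first by left.
have [ir|ir] := eqVneq (iter i pr x) r.
  by rewrite ir pr_root -ir.
right; have lt_i := pr_rank ir; case: IHi => [E|]; first by rewrite {2}E in lt_i.
exact: ltn_trans.
Qed.

Lemma ancestor_rank v c : fconnect pr v c -> c != v -> (rk c < rk v)%N.
Proof.
move=> /iter_findex <-; case: (iter_rank (findex pr v c) v) => [->|//].
by rewrite eqxx.
Qed.

Lemma ancestor_root v : fconnect pr v r.
Proof.
have [q] := ubnP (rk v); elim: q v => // q IHq v; rewrite ltnS => le_q.
have [->//|vr] := eqVneq v r.
by apply: connect_trans (fconnect1 _ _) (IHq _ _); exact: leq_trans (pr_rank vr) le_q.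
Qed.

Lemma ancestor_parent v c : fconnect pr v c -> v != c -> fconnect pr (pr v) c.
Proof.
move=> /iter_findex; case: findex => [/= ->|i <- _]; first by rewrite eqxx.
by rewrite iterSr fconnect_iter.
Qed.

Lemma ancestor_child v c : v != r -> fconnect pr (pr v) c -> fconnect pr v c.
Proof. by move=> _; exact: connect_trans (fconnect1 _ _). Qed.

Lemma ancestor_chain w x y :
  fconnect pr w x -> fconnect pr w y -> fconnect pr x y \/ fconnect pr y x.
Proof.
move=> /iter_findex <- /iter_findex <-; set i := findex _ _ _; set j := findex _ _ _.
have [ij|/ltnW ji] := leqP i j.
  by left; rewrite -(subnK ij) iterD fconnect_iter.
by right; rewrite -(subnK ji) iterD fconnect_iter.
Qed.

Lemma sibling_eq w x y : x != r -> y != r -> pr x = pr y ->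
  fconnect pr w x -> fconnect pr w y -> x = y.
Proof.
have aux a b : a != r -> b != r -> pr a = pr b -> fconnect pr a b -> a = b.
  move=> ar br ab cab; have [//|nab] := eqVneq a b.
  have := ancestor_parent cab nab; rewrite ab => cb.
  have := ancestor_rank cb; rewrite eq_sym parent_neq // => /(_ isT).
  by have := pr_rank br; lia.
move=> xr yr xy wx wy; have [|] := ancestor_chain wx wy; first exact: aux.
by move=> /aux ->.
Qed.

Lemma adj_leave a b c : parent_adj a b -> fconnect pr a c -> ~~ fconnect pr b c ->
  [/\ a = c, c != r & b = pr c].
Proof.
move=> /orP[] /andP[ar /eqP <-] ac bc; last by rewrite ancestor_child in bc.
have [<-|nac] := eqVneq a c; first by [].
by rewrite ancestor_parent in bc.
Qed.

Lemma path_below c x p : path parent_adj x p -> pr c \notin x :: p ->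
  fconnect pr x c -> fconnect pr (last x p) c.
Proof.
elim: p x => //= y p IHp x /andP[xy yp]; rewrite inE negb_or => /andP[cx cyp] xc.
apply: IHp => //; apply/contraT => yc.
have [_ _ E] := adj_leave xy xc yc.
by rewrite inE negb_or E eqxx in cyp.
Qed.

Lemma path_not_below c x p : path parent_adj x p -> c \notin x :: p ->
  ~~ fconnect pr x c -> ~~ fconnect pr (last x p) c.
Proof.
elim: p x => //= y p IHp x /andP[xy yp]; rewrite inE negb_or => /andP[cx cyp] xc.
apply: IHp => //; apply/negP => yc; rewrite parent_adj_sym in xy.
have [E _ _] := adj_leave xy yc xc.
by rewrite inE negb_or E eqxx in cyp.
Qed.

(** The end of a path without repetitions determines its first step: after a step to a child [x] of
    [v] the path stays below [x], since it could leave only through [v], and after a step to the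
    parent it never gets below [v] again. *)
Lemma uniq_path_unique v w p q :
  path parent_adj v p -> last v p = w -> uniq (v :: p) ->
  path parent_adj v q -> last v q = w -> uniq (v :: q) -> p = q.
Proof.
have down v' x p' : v' != x -> x != r -> pr x = v' -> path parent_adj x p' ->
    v' \notin x :: p' -> fconnect pr (last x p') x.
  by move=> _ xr <- xp; move/path_below; apply.
have up v' p' : v' != r -> path parent_adj (pr v') p' -> v' \notin pr v' :: p' ->
    ~~ fconnect pr (last (pr v') p') v'.
  move=> vr vp vN; apply: path_not_below => //; apply/negP => /ancestor_rank.
  by rewrite eq_sym parent_neq // => /(_ isT); have := pr_rank vr; lia.
elim: p v q => [|x p IHp] v [|y q] //=.
- by move=> _ -> _ _ /= yq /andP[]; rewrite -yq mem_last.
- by move=> _ <- /andP[+ _] _ /= E; rewrite E mem_last.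
move=> /andP[vx xp] lx /andP[vN up'] /andP[vy yq] ly /andP[vN' uq].
suff xy : x = y by subst y; congr cons; exact: (IHp x).
have vx' : v != x by apply: contraTneq vx => ->; rewrite parent_adj_irr.
have vy' : v != y by apply: contraTneq vy => ->; rewrite parent_adj_irr.
case/orP: vx => /andP[xr /eqP xv]; case/orP: vy => /andP[yr /eqP yv].
- by rewrite -xv.
- have h1 := down _ _ _ vy' yr yv yq vN'; rewrite ly -lx in h1.
  subst x; have := up _ _ xr xp vN.
  by rewrite (connect_trans h1) // -[X in fconnect _ _ X]yv fconnect1.
- have h1 := down _ _ _ vx' xr xv xp vN; rewrite lx -ly in h1.
  subst y; have := up _ _ yr yq vN'.
  by rewrite (connect_trans h1) // -[X in fconnect _ _ X]xv fconnect1.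
have h1 := down _ _ _ vx' xr xv xp vN; have h2 := down _ _ _ vy' yr yv yq vN'.
rewrite lx in h1; rewrite ly in h2.
by apply: (sibling_eq xr yr _ h1 h2); rewrite xv yv.
Qed.

Lemma simple_path_exists v w : exists p,
  [/\ path parent_adj v p, last v p = w & uniq (v :: p)].
Proof.
have to_root u : connect parent_adj u r.
  have [q] := ubnP (rk u); elim: q u => // q IHq u; rewrite ltnS => le_q.
  have [->//|ur] := eqVneq u r.
  apply: (connect_trans (connect1 _) (IHq (pr u) _)).
    by rewrite /parent_adj ur eqxx.
  exact: leq_trans (pr_rank ur) le_q.
have : connect parent_adj v w.
  by apply: connect_trans (to_root v) _; rewrite (sym_connect_sym parent_adj_sym).
case/connectP => p vp ->; case/shortenP: vp => p' vp' up' _.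
by exists p'.
Qed.

End ParentTree.

Definition parent_tree (m k : nat) (r : 'I_m) (pr : 'I_m -> 'I_m) (lg : 'I_k -> 'I_m) :
    ltree k := LTree (parent_adj r pr) lg.

Lemma is_ltree_parent m k (r : 'I_m) (pr : 'I_m -> 'I_m) (rk : 'I_m -> nat)
    (lg : 'I_k -> 'I_m) : pr r = r -> (forall x, x != r -> (rk (pr x) < rk x)%N) ->
  ((1 < m)%N -> forall v : 'I_m, (1 < @valence _ (parent_tree r pr lg) v)%N) ->
  is_ltree (parent_tree r pr lg).
Proof.
move=> pr_root pr_rank val_gt1; split=> //=.
- exact: leq_ltn_trans (ltn_ord r).
- exact: parent_adj_sym.
- exact: parent_adj_irr pr_rank.
move=> v w; have [p [vp pw up]] := simple_path_exists pr_rank v w.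
exists p; split=> [|q [vq qw uq]]; first by split.
exact: (uniq_path_unique pr_root pr_rank vp pw up vq qw uq).
Qed.

(** * Contraction of edges *)

Section Contraction.
Variables (X : finType) (root : X) (par : X -> X) (rk : X -> nat).
Hypothesis par_root : par root = root.
Hypothesis par_rank : forall x, x != root -> (rk (par x) < rk x)%N.

Fixpoint topn (P : pred X) (i : nat) (x : X) : X :=
  if P x then x else if i is i'.+1 then topn P i' (par x) else x.

(* The closest ancestor of x, possibly x itself, that satisfies P. *)
Definition top (P : pred X) (x : X) : X := topn P (rk x) x.

Section Top.
Variable P : pred X.
Hypothesis P_root : P root.

Lemma topn_stable i j x : (rk x <= i)%N -> (rk x <= j)%N -> topn P i x = topn P j x.
Proof.
elim: i j x => [|i IHi] j x le_i le_j.
  suff Px : P x by case: j {le_j} => [|j] /=; rewrite Px.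
  have [->//|xr] := eqVneq x root; by have := par_rank xr; lia.
have [Px|nPx] := boolP (P x); first by case: j {le_j} => [|j] /=; rewrite Px.
have xr : x != root by apply: contraNneq nPx => ->.
have lt_x := par_rank xr.
case: j le_j => [|j] le_j; first by lia.
by rewrite /= (negPf nPx); apply: IHi; lia.
Qed.

Lemma top_id x : P x -> top P x = x.
Proof. by rewrite /top; case: (rk x) => [|i] /= ->. Qed.

Lemma top_par x : ~~ P x -> top P x = top P (par x).
Proof.
move=> nPx; have xr : x != root by apply: contraNneq nPx => ->.
have lt_x := par_rank xr; rewrite /top.
case E: (rk x) => [|i] /=; first by lia.
by rewrite (negPf nPx); apply: topn_stable; lia.
Qed.

Lemma rank_ind (Q : X -> Prop) :
  (forall x, (forall y, (rk y < rk x)%N -> Q y) -> Q x) -> forall x, Q x.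
Proof.
move=> step x; have [q] := ubnP (rk x); elim: q x => // q IHq x le_q.
by apply: step => y lt_y; apply: IHq; lia.
Qed.

Lemma top_ind (Q : X -> X -> Prop) : (forall x, P x -> Q x x) ->
  (forall x, ~~ P x -> Q (par x) (top P x) -> Q x (top P x)) -> forall x, Q x (top P x).
Proof.
move=> Q0 Qs; elim/rank_ind => x IH.
have [Px|nPx] := boolP (P x); first by rewrite top_id //; exact: Q0.
apply: Qs => //; rewrite top_par //; apply/IH/par_rank.
by apply: contraNneq nPx => ->.
Qed.

Lemma topP x : P (top P x).
Proof. exact: (@top_ind (fun _ t => P t)). Qed.

Lemma top_ancestor x : fconnect par x (top P x).
Proof.
apply: (@top_ind (fun x t => fconnect par x t)) => [y _|y _ h]; first exact: connect0.
exact: connect_trans (fconnect1 _ _) h.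
Qed.

Lemma ancestor_top x v : P v -> fconnect par x v -> fconnect par (top P x) v.
Proof.
move=> Pv; apply: (@top_ind (fun x t => fconnect par x v -> fconnect par t v)) => //.
move=> y nPy IH yv; apply: IH; apply: ancestor_parent => //.
by apply: contraNneq nPy => ->.
Qed.

Lemma top_rank x : (rk (top P x) <= rk x)%N.
Proof.
have := top_ancestor x => /(ancestor_rank par_root par_rank).
by have [->//|_ /(_ isT)/ltnW] := eqVneq (top P x) x.
Qed.

Variable leaf : pred X.
Hypothesis par_nonleaf : forall x, x != root -> ~~ leaf (par x).
Hypothesis leaf_P : forall x, leaf x -> P x.

Lemma top_nonleaf x : ~~ leaf x -> ~~ leaf (top P x).
Proof.
apply: (@top_ind (fun x t => ~~ leaf x -> ~~ leaf t)) => // y nPy IH _.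
by apply/IH/par_nonleaf; apply: contraNneq nPy => ->.
Qed.

(** Each [x] other than the root also names the edge between [x] and [par x]. When the edges outside
    [P] are contracted, these are the edges at [v] leading away from the root. *)
Definition outs (v : X) : pred X := [pred x | [&& x != root, P x & top P (par x) == v]].

(** Conservation is summed over all vertices contracted to [v]. The contracted edges occur on both
    sides and cancel. *)
Lemma conservation_top (n : nat) (s : X -> 'rV[int]_n) :
  (forall y, ~~ leaf y -> \sum_(x | (x != root) && (par x == y)) s x = s y) ->
  forall v, P v -> ~~ leaf v -> \sum_(x in outs v) s x = s v.
Proof.
move=> cons v Pv nlv.
have fib_nl y : top P y == v -> ~~ leaf y.
  move=> /eqP yv; apply/negP => ly; rewrite top_id ?leaf_P // in yv.
  by rewrite -yv ly in nlv.
have fib : \sum_(y | top P y == v) s y = \sum_(x | (x != root) && (top P (par x) == v)) s x.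
  rewrite [RHS](partition_big par (fun y => top P y == v)) /=; last by move=> x /andP[].
  apply: eq_bigr => y yv; rewrite -cons ?fib_nl //; apply: eq_bigl => x.
  by have [->|] := eqVneq (par x) y; rewrite ?andbT ?andbF // yv andbT.
rewrite (bigD1 v) ?top_id //= in fib.
rewrite (bigID P) /= in fib.
have E1 : \sum_(i | (top P i == v) && (i != v) && P i) s i = 0.
  by apply: big1 => i /andP[/andP[/eqP iv niv] Pi]; rewrite top_id // in iv; rewrite iv eqxx in niv.
rewrite E1 add0r [RHS](bigID P) /= in fib.
have E2 : \sum_(i | (top P i == v) && (i != v) && ~~ P i) s i =
    \sum_(i | (i != root) && (top P (par i) == v) && ~~ P i) s i.
  apply: eq_bigl => i; have [Pi|nPi] := boolP (P i); rewrite ?andbF // !andbT top_par //.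
  have -> : i != root by apply: contraNneq nPi => ->.
  have -> : i != v by apply: contraNneq nPi => ->.
  by rewrite andbT.
rewrite E2 in fib; move/addIr: fib => ->.
by apply: eq_bigl => x; rewrite !inE -andbA [P x && _]andbC.
Qed.

Lemma outs_ancestor v l : P v -> P l -> fconnect par l v -> l != v ->
  exists2 x, x \in outs v & fconnect par l x.
Proof.
move=> Pv; elim/rank_ind: l => l IH Pl lv lneq.
have lr : l != root.
  apply: contraNneq lneq => E; move: lv; rewrite E => /iter_findex <-.
  have -> // : forall i, iter i par root = root by elim=> //= i ->.
have := ancestor_top Pv (ancestor_parent lv lneq); set w := top P (par l) => wv.
have [wE|wneq] := eqVneq w v; first by exists l => //; rewrite inE /= lr Pl; apply/eqP.
have lt_w : (rk w < rk l)%N by exact: leq_ltn_trans (top_rank _) (par_rank lr).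
have [x xv wx] := IH w lt_w (topP _) wv wneq.
exists x => //; apply: connect_trans (fconnect1 _ _) _.
exact: connect_trans (top_ancestor _) wx.
Qed.

End Top.

Lemma top_top (K P : pred X) : K root -> P root -> (forall x, K x -> P x) ->
  forall x, top K (top P x) = top K x.
Proof.
move=> K_root P_root KP; apply: (@top_ind P P_root (fun x t => top K t = top K x)) => //.
by move=> x nPx ->; rewrite [in RHS]top_par //; apply: contra nPx; exact: KP.
Qed.

End Contraction.

(** * Components of a cut and contracted tree *)

Section Component.
Variables (X : finType) (root : X) (par : X -> X) (rk : X -> nat) (leaf : pred X).
Variables (n : nat) (s : X -> 'rV[int]_n) (K P : pred X) (c : X).

(* The component of c when the edges above the vertices of K are cut, and those
   above the vertices outside P are contracted. *)
Definition comp_vertex : pred X :=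
  [pred x | (x == c) || [&& P x, ~~ leaf x & top par rk K x == c]].

Lemma comp_vertex_top : comp_vertex c.
Proof. by apply/orP; left; exact: eqxx. Qed.

Local Notation comp_type := {x : X | comp_vertex x}.

Definition comp_top : comp_type := exist _ c comp_vertex_top.
(** The vertices of an [ltree] are ordinals, so those of the component are numbered; an element that
    is not a vertex of it gets the number of [c] by default. *)
Definition comp_index (x : X) : 'I_#|{: comp_type}| :=
  enum_rank (insubd comp_top x).
Definition comp_at (i : 'I_#|{: comp_type}|) : X := val (enum_val i).
Definition comp_root := comp_index c.
Definition comp_par (i : 'I_#|{: comp_type}|) :=
  if comp_at i == c then comp_root else comp_index (top par rk P (par (comp_at i))).

(* Some x is the edge above x, and None the edge above c. *)
Definition comp_attach (o : option X) :=
  if o is Some x then comp_index (top par rk P (par x)) else comp_root.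
Definition comp_label (o : option X) : 'rV[int]_n := if o is Some x then s x else - s c.

(** [s x] is oriented away from the root, so a step towards the root carries a minus sign. The same
    holds for the label of the edge above [c], which leaves the component towards the root. *)
Definition comp_slope (i j : 'I_#|{: comp_type}|) : 'rV[int]_n :=
  if (i != comp_root) && (comp_par i == j) then - s (comp_at i)
  else if (j != comp_root) && (comp_par j == i) then s (comp_at j) else 0.

Definition comp_tree (k : nat) (lg : 'I_k -> option X) : ltree k :=
  parent_tree comp_root comp_par (comp_attach \o lg).

Lemma comp_indexK x : comp_vertex x -> comp_at (comp_index x) = x.
Proof. by move=> vx; rewrite /comp_at enum_rankK val_insubd vx. Qed.

Lemma comp_at_inj : injective comp_at.
Proof. by move=> i j /val_inj/enum_val_inj. Qed.

Lemma comp_atP i : comp_vertex (comp_at i).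
Proof. exact: valP (enum_val i). Qed.

Lemma comp_rootE : comp_at comp_root = c.
Proof. exact: comp_indexK comp_vertex_top. Qed.

Lemma comp_eq_root i : (i == comp_root) = (comp_at i == c).
Proof. by rewrite -(inj_eq comp_at_inj) comp_rootE. Qed.

Lemma comp_atK i : comp_index (comp_at i) = i.
Proof. by apply: comp_at_inj; rewrite comp_indexK ?comp_atP. Qed.

Hypothesis par_root : par root = root.
Hypothesis par_rank : forall x, x != root -> (rk (par x) < rk x)%N.
Hypothesis par_nonleaf : forall x, x != root -> ~~ leaf (par x).
Hypothesis root_nonleaf : ~~ leaf root.
Hypothesis K_root : K root.
Hypothesis P_root : P root.
Hypothesis KP : forall x, K x -> P x.
Hypothesis leaf_K : forall x, leaf x -> K x.
Hypothesis Kc : K c.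
Hypothesis c_nonleaf : ~~ leaf c.

Lemma comp_vertexE x : comp_vertex x = [&& P x, ~~ leaf x & top par rk K x == c].
Proof.
rewrite /comp_vertex /=; have [->|//] := eqVneq x c.
by rewrite KP // c_nonleaf (top_id par rk Kc) eqxx.
Qed.

Lemma comp_vertex_notK x : comp_vertex x -> x != c -> ~~ K x.
Proof.
rewrite comp_vertexE => /and3P[_ _ /eqP xc]; apply: contraNN => Kx.
by rewrite -xc top_id.
Qed.

Lemma comp_vertex_root x : comp_vertex x -> x = root -> c = root.
Proof.
rewrite comp_vertexE => /and3P[_ _ /eqP <-] ->; exact: (top_id par rk K_root).
Qed.

Lemma comp_vertex_parent x : x != root -> top par rk K (par x) = c ->
  comp_vertex (top par rk P (par x)).
Proof.
move=> xr xc; rewrite comp_vertexE (topP par_rank P_root).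
rewrite (top_nonleaf par_rank P_root par_nonleaf) ?par_nonleaf //=.
by rewrite (top_top par_rank K_root P_root KP) xc.
Qed.

Lemma comp_vertex_par i : comp_at i != c ->
  comp_vertex (top par rk P (par (comp_at i))).
Proof.
move=> ic; have nK := comp_vertex_notK (comp_atP i) ic.
apply: comp_vertex_parent; first by apply: contraNneq nK => ->.
rewrite -(top_par par_rank K_root nK); have := comp_atP i.
by rewrite comp_vertexE => /and3P[_ _ /eqP].
Qed.

Lemma comp_parE i : i != comp_root ->
  comp_at (comp_par i) = top par rk P (par (comp_at i)).
Proof.
rewrite comp_eq_root => ic; rewrite /comp_par (negPf ic) comp_indexK //.
exact: comp_vertex_par.
Qed.

Lemma comp_par_root : comp_par comp_root = comp_root.
Proof. by rewrite /comp_par comp_rootE eqxx. Qed.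

Lemma comp_at_neq_root i : i != comp_root -> comp_at i != root.
Proof.
rewrite comp_eq_root => ic; have nK := comp_vertex_notK (comp_atP i) ic.
by apply: contraNneq nK => ->.
Qed.

Lemma comp_par_rank i : i != comp_root -> (rk (comp_at (comp_par i)) < rk (comp_at i))%N.
Proof.
move=> ir; rewrite comp_parE //.
exact: leq_ltn_trans (top_rank par_root par_rank P_root _) (par_rank (comp_at_neq_root ir)).
Qed.

Lemma comp_par_asym v w : v != comp_root -> w != comp_root ->
  comp_par v = w -> comp_par w = v -> False.
Proof.
move=> vr wr vw wv; have h1 := comp_par_rank vr; have h2 := comp_par_rank wr.
rewrite vw in h1; rewrite wv in h2.
by have := ltn_trans h1 h2; rewrite ltnn.
Qed.

Lemma comp_child x v : x != root -> P x -> ~~ K x -> top par rk P (par x) = comp_at v ->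
  [/\ comp_vertex x, comp_index x != comp_root & comp_par (comp_index x) = v].
Proof.
move=> xr Px nKx xv; have nlx : ~~ leaf x by apply: contra nKx; exact: leaf_K.
have topx : top par rk K x = c.
  rewrite (top_par par_rank K_root nKx) -(top_top par_rank K_root P_root KP) xv.
  by have := comp_atP v; rewrite comp_vertexE => /and3P[_ _ /eqP].
have vx : comp_vertex x by rewrite comp_vertexE Px nlx topx eqxx.
have xnc : comp_index x != comp_root.
  by rewrite comp_eq_root comp_indexK //; apply: contraNneq nKx => ->.
by split=> //; apply: comp_at_inj; rewrite comp_parE // comp_indexK.
Qed.

Section Legs.
Variables (k : nat) (lg : 'I_k -> option X).
Hypothesis lg_inj : injective lg.
Hypothesis lg_some : forall x, (Some x \in codom lg) = [&& x != root, K x & top par rk K (par x) == c].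
Hypothesis lg_none : (None \in codom lg) = (c != root).

Local Notation adjT := (parent_adj comp_root comp_par).

(** Balancing, valence and star degree all follow from this. Every edge at [v] is named in
    [option X]: by [Some x] if it leads away from the root, by [None] if it leads to the root. Both
    sides are then images under [dg] of lists of names without repetition and with the same
    members. *)
Lemma comp_star v : perm_eq
  ([seq comp_slope v w | w <- enum 'I_#|{: comp_type}| & adjT v w] ++
   [seq comp_label (lg i) | i <- enum 'I_k & comp_attach (lg i) == v])
  ([seq s x | x <- enum (outs root par rk P (comp_at v))] ++
   (if comp_at v == root then [::] else [:: - s (comp_at v)])).
Proof.
pose nb w := if (w != comp_root) && (comp_par w == v) then Some (comp_at w) else None.
pose dg (o : option X) := if o is Some x then s x else - s (comp_at v).
have -> : [seq comp_slope v w | w <- enum 'I_#|{: comp_type}| & adjT v w] =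
    map dg [seq nb w | w <- enum 'I_#|{: comp_type}| & adjT v w].
  rewrite -map_comp; apply/eq_in_map => w; rewrite mem_filter /parent_adj => /andP[vw _] /=.
  rewrite /comp_slope /nb; have [vw'|nvw] := boolP ((v != comp_root) && (comp_par v == w)).
    case/andP: vw' => vr /eqP vw'; have [/andP[wr /eqP wv]|//] := boolP ((w != comp_root) && _).
    by case: (comp_par_asym vr wr vw' wv).
  by move: vw; rewrite (negPf nvw) /= => ->.
have -> : [seq comp_label (lg i) | i <- enum 'I_k & comp_attach (lg i) == v] =
    map dg [seq lg i | i <- enum 'I_k & comp_attach (lg i) == v].
  rewrite -map_comp; apply/eq_in_map => i; rewrite mem_filter => /andP[iv _] /=.
  by case: (lg i) iv => //= /eqP <-; rewrite comp_rootE.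
have -> : [seq s x | x <- enum (outs root par rk P (comp_at v))] ++
   (if comp_at v == root then [::] else [:: - s (comp_at v)]) =
   map dg ([seq Some x | x <- enum (outs root par rk P (comp_at v))] ++
     (if comp_at v == root then [::] else [:: None])).
  by rewrite map_cat -map_comp; case: ifP.
rewrite -map_cat; apply/perm_map/uniq_perm.
- rewrite cat_uniq; apply/and3P; split.
  + rewrite map_inj_in_uniq; first by apply/filter_uniq/enum_uniq.
    move=> w1 w2; rewrite !mem_filter /parent_adj /nb => /andP[vw1 _] /andP[vw2 _].
    case: ifP vw1; case: ifP vw2 => //; rewrite ?orbT ?orbF.
      by move=> _ _ _ _ [] /comp_at_inj.
    by move=> _ /andP[_ /eqP <-] _ /andP[_ /eqP <-].
  + apply/hasPn => o /mapP[i0]; rewrite mem_filter => /andP[iv _] oE.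
    apply/negP => /mapP[w]; rewrite mem_filter /parent_adj /nb => /andP[vw _].
    case: ifP vw => [/andP[wr wv] _|_].
      move=> E; have : Some (comp_at w) \in codom lg by rewrite -E oE codom_f.
      rewrite lg_some (negPf (comp_vertex_notK (comp_atP w) _)) ?andbF //.
      by rewrite -comp_eq_root.
    rewrite orbF => /andP[vr _] E; move: iv; rewrite -oE E /= eq_sym.
    by rewrite (negPf vr).
  + by rewrite map_inj_uniq //; apply/filter_uniq/enum_uniq.
- rewrite cat_uniq map_inj_uniq ?enum_uniq; last by move=> ? ? [].
  by case: ifP => //=; rewrite ?andbT orbF => _; apply/mapP => -[].
move=> o; rewrite !mem_cat; case: o => [x|].
  have -> : (Some x \in [seq Some x | x <- enum (outs root par rk P (comp_at v))]) =
      (x \in outs root par rk P (comp_at v)).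
    by rewrite mem_map ?mem_enum // => ? ? [].
  have -> : (Some x \in if comp_at v == root then [::] else [:: None]) = false by case: ifP.
  rewrite orbF inE /=; apply/orP/and3P.
    case=> [/mapP[w]|/mapP[i0]]; rewrite mem_filter => /andP[].
      rewrite /parent_adj /nb => _ _; case: ifP => // /andP[wr /eqP wv] [->].
      have := comp_atP w; rewrite comp_vertexE => /and3P[Pw _ _].
      by rewrite comp_at_neq_root // -comp_parE // wv.
    move=> /eqP iv _ E; have : Some x \in codom lg by rewrite E codom_f.
    rewrite lg_some => /and3P[xr Kx /eqP xc]; split=> //; first exact: KP.
    by rewrite -iv -E /= comp_indexK // comp_vertex_parent.
  case=> xr Px /eqP xv; have [Kx|nKx] := boolP (K x).
    right; have : Some x \in codom lg.
      rewrite lg_some xr Kx -(top_top par_rank K_root P_root KP) xv.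
      by have := comp_atP v; rewrite comp_vertexE => /and3P[].
    case/codomP => i E; apply/mapP; exists i => //.
    by rewrite mem_filter mem_enum -E /= xv comp_atK eqxx.
  have [vx xnr xpar] := comp_child xr Px nKx xv; left; apply/mapP; exists (comp_index x).
    by rewrite mem_filter mem_enum /parent_adj xnr xpar eqxx orbT.
  by rewrite /nb xnr xpar eqxx comp_indexK.
have -> : (None \in [seq Some x | x <- enum (outs root par rk P (comp_at v))]) = false.
  by apply/negP => /mapP[].
rewrite /=; apply/orP/idP.
  case=> [/mapP[w]|/mapP[i0]]; rewrite mem_filter => /andP[].
    rewrite /parent_adj /nb => vw _; case: ifP vw => // _; rewrite orbF => /andP[vr _] _.
    by rewrite (negPf (comp_at_neq_root vr)) inE.
  move=> /eqP iv _ E; have : None \in codom lg by rewrite E codom_f.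
  by rewrite lg_none -iv -E /= comp_rootE => /negPf ->; rewrite inE.
case: ifP => // vroot _; have [vr|vr] := eqVneq v comp_root.
  right; have : None \in codom lg by rewrite lg_none -comp_rootE -vr vroot.
  case/codomP => i E; apply/mapP; exists i => //.
  by rewrite mem_filter mem_enum -E /= vr eqxx.
left; apply/mapP; exists (comp_par v); first by rewrite mem_filter mem_enum /parent_adj vr eqxx.
rewrite /nb; case: ifP => // /andP[wr /eqP wv].
by case: (comp_par_asym vr wr erefl wv).
Qed.

Hypothesis conservation :
  forall y, ~~ leaf y -> \sum_(x | (x != root) && (par x == y)) s x = s y.
Hypothesis s_root : s root = 0.

Let comp_at_P v : P (comp_at v).
Proof. by have := comp_atP v; rewrite comp_vertexE => /and3P[]. Qed.

Let comp_at_nonleaf v : ~~ leaf (comp_at v).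
Proof. by have := comp_atP v; rewrite comp_vertexE => /and3P[]. Qed.

Lemma comp_balanced v :
  \sum_(w | adjT v w) comp_slope v w +
  \sum_(i | comp_attach (lg i) == v) comp_label (lg i) = 0.
Proof.
have -> : \sum_(w | adjT v w) comp_slope v w =
    \sum_(d <- [seq comp_slope v w | w <- enum 'I_#|{: comp_type}| & adjT v w]) d.
  by rewrite big_map big_filter big_enum_cond.
have -> : \sum_(i | comp_attach (lg i) == v) comp_label (lg i) =
    \sum_(d <- [seq comp_label (lg i) | i <- enum 'I_k & comp_attach (lg i) == v]) d.
  by rewrite big_map big_filter big_enum_cond.
rewrite -big_cat (perm_big _ (comp_star v)) /= big_cat /= big_map big_enum /=.
have leaf_P x : leaf x -> P x by move=> /leaf_K/KP.
rewrite (conservation_top par_rank P_root leaf_P conservation) //.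
case: eqP => [->|_]; first by rewrite big_nil s_root addr0.
by rewrite big_seq1 addrN.
Qed.

Lemma comp_valence v : @valence _ (comp_tree lg) v =
  (#|outs root par rk P (comp_at v)| + (comp_at v != root))%N.
Proof.
have cardf (T : finType) (Q : pred T) : #|Q| = size [seq x <- enum T | Q x].
  by rewrite -sum1_card -sum1_size big_filter big_enum_cond.
have /perm_size := comp_star v; rewrite !size_cat !size_map -!cardf => E.
rewrite /valence /= E -cardE; congr (_ + _)%N.
by case: (comp_at v == root).
Qed.

Hypothesis leaf_below : forall x, x != root -> P x -> ~~ leaf x ->
  exists2 l, leaf l & fconnect par l x.
Hypothesis leaf_not_below : forall x, x != root -> P x -> ~~ leaf x ->
  exists2 l, leaf l & ~~ fconnect par l x.

Lemma leaf_ancestor x y : leaf y -> fconnect par x y -> x = y.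
Proof.
move=> ly /iter_findex; case: findex => [//|i /= E].
have [ir|ir] := eqVneq (iter i par x) root.
  by move: ly; rewrite -E ir par_root (negPf root_nonleaf).
by move: ly; rewrite -E (negPf (par_nonleaf ir)).
Qed.

(** For the valence: a vertex other than [root] has the edge above it and one towards a leaf below
    it. If [root] is a vertex and not the only one, one of its edges leads to another vertex, and a
    leaf not below that edge leads to a second edge. *)
Lemma comp_is_ltree : is_ltree (comp_tree lg).
Proof.
apply: (@is_ltree_parent _ _ _ _ (fun i => rk (comp_at i))) => [|i|gt1 v].
- exact: comp_par_root.
- exact: comp_par_rank.
have leaf_P x : leaf x -> P x by move=> /leaf_K/KP.
rewrite comp_valence; have [vr|vr] := eqVneq (comp_at v) root; last first.
  have [l ll lv] := leaf_below vr (comp_at_P v) (comp_at_nonleaf v).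
  have lneq : l != comp_at v by apply: contraTneq ll => ->; exact: comp_at_nonleaf.
  have [x xv _] := outs_ancestor par_root par_rank P_root (comp_at_P v) (leaf_P _ ll) lv lneq.
  by rewrite addn1 ltnS; apply/card_gt0P; exists x.
have cr : c = root by exact: comp_vertex_root (comp_atP v) vr.
have [i ir] : exists i : 'I_#|{: {x : X | comp_vertex x}}|, i != comp_root.
  have /card_gt1P[i [j [_ _ ij]]] : (1 < #|{: 'I_#|{: {x : X | comp_vertex x}}| }|)%N by rewrite card_ord.
  have [E|] := eqVneq i comp_root; last by exists i.
  by exists j; rewrite -E eq_sym.
set x := comp_at i; have xr := comp_at_neq_root ir.
have [x1 x1v xx1] := outs_ancestor par_root par_rank P_root P_root (comp_at_P i)
  (ancestor_root par_rank x) xr.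
have /and3P[x1r Px1 _] := x1v.
have nl1 : ~~ leaf x1.
  by apply/negP => l1; have := comp_at_nonleaf i; rewrite -/x (leaf_ancestor l1 xx1) l1.
have [l ll lx1] := leaf_not_below x1r Px1 nl1.
have lr : l != root by apply: contraTneq ll => ->.
have [x2 x2v lx2] := outs_ancestor par_root par_rank P_root P_root (leaf_P _ ll)
  (ancestor_root par_rank l) lr.
rewrite vr addn0; apply/card_gt1P; exists x1, x2; split=> //.
by apply: contraNneq lx1 => ->.
Qed.

End Legs.
End Component.

(** * The trees of a limit *)

Section DoubleTree.
Variables (n E : nat) (Delta : seq 'rV[int]_n).
Local Notation k := (size Delta).
Variables (par0 : 'I_E.+1 -> 'I_E.+1) (leg0 : 'I_k -> 'I_E.+1).

(* Edges of the base tree, with inl v the edge above v and inr i the i-th leaf. *)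
Definition bedge : finType := ('I_E.+1 + 'I_k)%type.
Definition bottom_of (x : bedge) : 'I_E.+1 :=
  match x with inl v => par0 v | inr i => leg0 i end.
Definition bslope (x : bedge) : 'rV[int]_n :=
  match x with
  | inl v => \sum_(i | fconnect par0 (leg0 i) v) Delta`_i
  | inr i => Delta`_i
  end.

(* Each edge x of the base tree is subdivided by a vertex (x, true), whose lower
   end is (x, false). *)
Definition dvert : finType := (bedge * bool)%type.
(** The base root has no edge above it. The pair [inl ord0] is a dummy edge of slope 0 on top of it,
    which belongs to the contracted edges in all uses. *)
Definition droot : dvert := (inl ord0, true).
Definition dpar (x : dvert) : dvert :=
  if x.2 then if x.1 == inl ord0 then droot else (inl (bottom_of x.1), false)
  else (x.1, true).
Definition drk (x : dvert) : nat :=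
  (match x.1 with inl v => v : nat | inr _ => E.+1 end).*2 + ~~ x.2.
Definition dleaf (x : dvert) : bool := ~~ x.2 && (if x.1 is inr _ then true else false).
Definition dslope (x : dvert) : 'rV[int]_n := bslope x.1.

Hypothesis par0_root : par0 ord0 = ord0.
Hypothesis par0_lt : forall v, v != ord0 -> (par0 v < v)%N.

Lemma dpar_root : dpar droot = droot.
Proof. by []. Qed.

Lemma dpar_rank x : x != droot -> (drk (dpar x) < drk x)%N.
Proof.
case: x => [x []]; rewrite /dpar /drk /= => xr; last by rewrite addn0 addn1.
have [x0|x0] := eqVneq x (inl ord0); first by rewrite x0 eqxx in xr.
case: x x0 {xr} => [v|i] x0 /=; rewrite addn0 addn1 -doubleS ltn_Sdouble /=.
  by apply: par0_lt; apply: contraNneq x0 => ->.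
exact: ltn_ord.
Qed.

Lemma dpar_nonleaf x : x != droot -> ~~ dleaf (dpar x).
Proof. by case: x => [x []] _; rewrite /dpar /dleaf //=; case: ifP. Qed.

(** Counted leaf by leaf: a leaf below [v] is either attached at [v] or lies below exactly one child
    of [v]. *)
Lemma bslope_conservation v :
  \sum_(x : bedge | (x != inl ord0) && (bottom_of x == v)) bslope x = bslope (inl v).
Proof.
rewrite big_sumType /=.
have -> : \sum_(i < E.+1 | (inl i != inl ord0 :> bedge) && (par0 i == v)) 
    \sum_(j | fconnect par0 (leg0 j) i) Delta`_j =
  \sum_(j < k) \sum_(i < E.+1 | [&& i != ord0, par0 i == v & fconnect par0 (leg0 j) i]) Delta`_j.
  under eq_bigr => i _ do rewrite big_mkcond.
  rewrite exchange_big /=; apply: eq_bigr => j _; rewrite -big_mkcondr /=.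
  by apply: eq_bigl => i; rewrite -andbA; congr (_ && _).
rewrite [X in _ + X]big_mkcond -big_split [RHS]big_mkcond /=; apply: eq_bigr => j _.
have [ljv|ljv] := eqVneq (leg0 j) v.
  rewrite -ljv connect0 big1 ?add0r // => i /and3P[i0 /eqP iv ij].
  have := ancestor_rank (rk := @nat_of_ord _) par0_root par0_lt ij.
  have := par0_lt i0; rewrite iv.
  have [->|_] := eqVneq i (leg0 j); first by rewrite ltnn.
  by move=> h1 /(_ isT) h2; have := ltn_trans h1 h2; rewrite ltnn.
rewrite addr0; have [jv|njv] := boolP (fconnect par0 (leg0 j) v); last first.
  apply: big1 => i /and3P[i0 /eqP iv ij]; case/negP: njv.
  by apply: connect_trans ij _; rewrite -iv fconnect1.
have [x /and3P[x0 _ /eqP xv] jx] := @outs_ancestor _ ord0 par0 (@nat_of_ord _) par0_root par0_lt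
  predT isT v (leg0 j) isT isT jv ljv.
rewrite top_id // in xv.
rewrite (big_pred1 x) // => i /=; apply/and3P/eqP => [[i0 /eqP iv ij]|->]; last by rewrite xv eqxx.
by apply: (sibling_eq par0_root par0_lt i0 x0 _ ij jx); rewrite iv xv.
Qed.

Lemma dslope_conservation y : ~~ dleaf y ->
  \sum_(x | (x != droot) && (dpar x == y)) dslope x = dslope y.
Proof.
case: y => [y []] yl.
  rewrite (big_pred1 (y, false)) // => -[x b]; rewrite /dpar /=; case: b => /=.
    by rewrite andbC; case: ifP => [/eqP ->|]; rewrite /droot /= !xpair_eqE ?andbF ?eqxx ?andbT.
  by rewrite !xpair_eqE eqxx andbT andbF.
case: y yl => // v _; rewrite -[RHS]bslope_conservation.
have inj_true : injective (fun x : bedge => (x, true) : dvert) by move=> ? ? [].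
rewrite [RHS](reindex_onto (fun x : dvert => x.1) (fun x => (x, true) : dvert)) //=.
apply: eq_big => [[x b]|[x b] _ //]; rewrite /dpar /=; case: b; rewrite /= !xpair_eqE ?andbF //= ?andbT.
rewrite eqxx; have [->|x0] := eqVneq x (inl ord0); first by [].
by rewrite /= xpair_eqE eqxx !andbT; apply/eqP/eqP => [[->]|->].
Qed.

Hypothesis Delta_toric : toric_degree Delta.

Lemma dslope_root : dslope droot = 0.
Proof.
rewrite /dslope /= (eq_bigl predT) => [|i]; last first.
  exact: (ancestor_root (rk := @nat_of_ord _)).
by move: Delta_toric; rewrite /toric_degree (big_nth 0) big_mkord.
Qed.

Lemma dvert_ancestor u v b : fconnect par0 u v -> v != ord0 ->
  fconnect dpar (inl u, false) (inl v, b).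
Proof.
move=> uv v0; suff h : fconnect dpar (inl u, false) (inl v, false).
  case: b => //; apply: connect_trans h _.
  by have := fconnect1 dpar (inl v, false).
move: uv => /iter_findex; move: (findex _ _ _) => i; elim: i u => [|i IHi] u.
  by move=> /= ->; exact: connect0.
rewrite iterSr => E1; have [u0|u0] := eqVneq u ord0.
  have it0 j : iter j par0 ord0 = ord0 by elim: j => //= j ->.
  by move: E1; rewrite u0 par0_root it0 => /esym/eqP; rewrite (negPf v0).
apply: connect_trans (fconnect1 _ _) _; apply: connect_trans (fconnect1 _ _) _.
rewrite /dpar /= (_ : (inl u == inl ord0 :> bedge) = false) ?IHi //.
by apply/negbTE; apply: contra u0 => /eqP [->].
Qed.

Let proj (x : dvert) : 'I_E.+1 := match x.1 with inl v => v | inr i => leg0 i end.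

Lemma dvert_ancestor_inv x v b : fconnect dpar x (inl v, b) -> fconnect par0 (proj x) v.
Proof.
move=> /iter_findex; move: (findex _ _ _) => i; elim: i x => [|i IHi] x.
  by move=> /= ->; exact: connect0.
rewrite iterSr => /IHi; apply: connect_trans.
case: x => [[u|j] []]; rewrite /dpar /proj /= ?connect0 //.
have [[->]|_] := eqVneq (inl u : bedge) (inl ord0); first exact: connect0.
exact: fconnect1.
Qed.

Lemma dvert_leaf_other i j : i != j -> ~~ fconnect dpar (inr j, false) (inr i, true).
Proof.
move=> ij; have dp x y : fconnect dpar x y -> x != y -> fconnect dpar (dpar x) y.
  exact: ancestor_parent.
apply/negP => /dp; rewrite xpair_eqE andbF => /(_ isT)/dp.
have -> : ((inr j, true) != (inr i, true) :> dvert).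
  by apply: contraNneq ij => -[->].
move=> /(_ isT); set y := dpar _ => /(ancestor_rank dpar_root dpar_rank).
have yi : (inr i, true) != y by [].
by move=> /(_ yi); rewrite /drk /= !addn0 addn1 ltnS leq_double leqNgt ltn_ord.
Qed.

End DoubleTree.

(** * The tree of the degeneration and the trees of its curves *)

Section Code.
Variables (n E : nat) (Delta : seq 'rV[int]_n).
Local Notation k := (size Delta).
Local Notation X := (dvert E Delta).
Variables (par0 : 'I_E.+1 -> 'I_E.+1) (leg0 : 'I_k -> 'I_E.+1) (Z I : {set X}).
Local Notation root := (droot E Delta).
Local Notation par := (dpar par0 leg0).
Local Notation rk := (@drk n E Delta).
Local Notation leaf := (@dleaf n E Delta).
Local Notation slope := (dslope par0 leg0).

(* Edges in Z are contracted in the components, and those in I are cut. *)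
Definition cut : pred X := [pred x | (x == root) || (x \in I)].
Definition keep : pred X := [pred x | (x == root) || (x \notin Z)].
Definition ends : pred X := [pred x | (x == root) || leaf x].

Definition leaf_leg (i : 'I_k) : option X := Some (inr i, false).
(** The construction of a component, applied with cuts at the leaves only and with contraction of
    all edges that are not cut: the vertices of the result are the components, and its edges are the
    cut edges. *)
Definition deg_tree : ltree k := comp_tree par rk leaf ends cut root leaf_leg.
Definition deg_slope := @comp_slope X par rk leaf n slope ends cut root.
Definition deg_at := @comp_at X par rk leaf ends cut root.

Definition leg_seq (c : X) : seq (option X) :=
  [seq Some x | x <- enum (outs root par rk cut c)] ++
  (if c == root then [::] else [:: None]).
Definition comp_degree (c : X) : seq 'rV[int]_n := map (comp_label slope c) (leg_seq c).
Definition comp_leg (c : X) (j : 'I_(size (comp_degree c))) : option X := nth None (leg_seq c) j.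
Definition ctree (c : X) : ltree (size (comp_degree c)) :=
  comp_tree par rk leaf cut keep c (@comp_leg c).
Definition cslope (c : X) := @comp_slope X par rk leaf n slope cut keep c.

Hypothesis par0_root : par0 ord0 = ord0.
Hypothesis par0_lt : forall v, v != ord0 -> (par0 v < v)%N.
Hypothesis leaf_under : forall v, v != ord0 -> exists i, fconnect par0 (leg0 i) v.
Hypothesis leaf_not_under : forall v, v != ord0 -> exists i, ~~ fconnect par0 (leg0 i) v.
Hypothesis leaf_I : forall i, (inr i, false) \in I.
Hypothesis IZ : forall x, x \in I -> x \notin Z.
Hypothesis root_Z : (inl ord0, false) \in Z.
(** A subdivision vertex either merges with the vertex above it or is the middle of an edge that is
    cut on both sides of it. *)
Hypothesis sub_ZI : forall x, x != inl ord0 ->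
  (x, true) \in Z \/ [/\ (x, true) \in I, (x, false) \in I & bslope par0 leg0 x != 0].
Hypothesis Delta_toric : toric_degree Delta.

Let pr := dpar_root par0 leg0.
Let prk := @dpar_rank _ _ _ par0 leg0 par0_lt.
Let pnl := @dpar_nonleaf _ _ _ par0 leg0.
Let rnl : ~~ leaf root := isT.

Lemma cut_root : cut root.
Proof. by apply/orP; left. Qed.

Lemma keep_root : keep root.
Proof. by apply/orP; left. Qed.

Lemma ends_root : ends root.
Proof. by apply/orP; left. Qed.

Lemma cut_keep x : cut x -> keep x.
Proof. by move=> /orP[/eqP ->|/IZ xZ]; [exact: keep_root|apply/orP; right]. Qed.

Lemma leafP x : leaf x -> exists i, x = (inr i, false).
Proof. by case: x => [[v|i] []] // _; exists i. Qed.

Lemma ends_cut x : ends x -> cut x.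
Proof. by move=> /orP[/eqP ->|/leafP[i ->]]; [exact: cut_root|apply/orP; right; exact: leaf_I]. Qed.

Lemma leaf_ends x : leaf x -> ends x.
Proof. by move=> lx; apply/orP; right. Qed.

Lemma leaf_cut x : leaf x -> cut x.
Proof. by move/leaf_ends/ends_cut. Qed.

(** A single end would have vector 0, because the vectors sum to 0. This supplies the leaf outside a
    subdivided leaf edge. *)
Lemma other_leaf i : bslope par0 leg0 (inr i) != 0 -> exists j, i != j.
Proof.
move=> /= di; apply: contrapT => no; case/negP: di; apply/eqP.
have all_i (j : 'I_k) : j = i.
  by apply/esym/eqP; rewrite -[_ == _]negbK; apply/negP => ij; apply: no; exists j.
move: Delta_toric; rewrite /toric_degree (big_nth 0) big_mkord (bigD1 i) //= big1 ?addr0 //.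
by move=> j; rewrite (all_i j) eqxx.
Qed.

Lemma keep_leaf_below x : x != root -> keep x -> ~~ leaf x ->
  exists2 l, leaf l & fconnect par l x.
Proof.
case: x => [[v|i] b] xr Px nlx; last first.
  case: b xr Px nlx => // _ _ _; exists (inr i, false) => //.
  by have := fconnect1 par (inr i, false).
have v0 : v != ord0.
  apply/eqP => v0; subst v; case: b xr Px nlx => xr Px nlx; first by rewrite eqxx in xr.
  by case/orP: Px => [/eqP[]//|]; rewrite root_Z.
have [i iv] := leaf_under v0; exists (inr i, false) => //.
apply: connect_trans (fconnect1 _ _) _; apply: connect_trans (fconnect1 _ _) _.
exact: dvert_ancestor.
Qed.

Lemma keep_leaf_not_below x : x != root -> keep x -> ~~ leaf x ->
  exists2 l, leaf l & ~~ fconnect par l x.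
Proof.
case: x => [[v|i] b] xr Px nlx; last first.
  case: b xr Px nlx => // xr Px nlx.
  have [|[_ _ di]] := sub_ZI (x := inr i) isT.
    by case/orP: Px => [/eqP[]//|/negP].
  have [j ij] := other_leaf di; exists (inr j, false) => //.
  exact: dvert_leaf_other.
have v0 : v != ord0.
  apply/eqP => v0; subst v; case: b xr Px nlx => xr Px nlx; first by rewrite eqxx in xr.
  by case/orP: Px => [/eqP[]//|]; rewrite root_Z.
have [i iv] := leaf_not_under v0; exists (inr i, false) => //.
by apply: contra iv; exact: dvert_ancestor_inv.
Qed.

Let cut_lb x : x != root -> cut x -> ~~ leaf x -> exists2 l, leaf l & fconnect par l x.
Proof. by move=> xr /cut_keep; exact: keep_leaf_below. Qed.

Let cut_lnb x : x != root -> cut x -> ~~ leaf x -> exists2 l, leaf l & ~~ fconnect par l x.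
Proof. by move=> xr /cut_keep; exact: keep_leaf_not_below. Qed.

Lemma leaf_leg_inj : injective leaf_leg.
Proof. by move=> i j []. Qed.

Lemma top_ends x : ~~ leaf x -> top par rk ends x = root.
Proof.
move=> nlx; have /orP[/eqP //|] := topP prk ends_root x.
by rewrite (negPf (top_nonleaf prk ends_root pnl nlx)).
Qed.

Lemma leaf_leg_some x : (Some x \in codom leaf_leg) =
  [&& x != root, ends x & top par rk ends (par x) == root].
Proof.
apply/codomP/and3P => [[i [->]]|[xr /orP[/eqP Ex|/leafP[i ->]] _]].
- by split; [|exact: leaf_ends|rewrite top_ends].
- by rewrite Ex eqxx in xr.
- by exists i.
Qed.

Lemma leaf_leg_none : (None \in codom leaf_leg) = (root != root).
Proof. by rewrite eqxx; apply/negbTE/codomP => -[]. Qed.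

Lemma deg_is_ltree : is_ltree deg_tree.
Proof.
exact: (comp_is_ltree slope pr prk pnl rnl ends_root cut_root ends_cut leaf_ends
  ends_root rnl leaf_leg_inj leaf_leg_some leaf_leg_none cut_lb cut_lnb).
Qed.

Lemma comp_slopeN K P c (u v : 'I_#|{: {x : X | comp_vertex par rk leaf K P c x}}|) :
  K root -> P root -> (forall x, K x -> P x) -> K c -> ~~ leaf c ->
  parent_adj (comp_root par rk leaf K P c) (@comp_par X par rk leaf K P c) u v ->
  comp_slope slope v u = - comp_slope slope u v.
Proof.
move=> Kr Pr KP Kc nlc uv; rewrite /comp_slope.
have asym := comp_par_asym pr prk pnl Kr Pr KP Kc nlc.
case/orP: uv => /andP[ur /eqP uv]; rewrite ur uv eqxx /=.
  by case: ifP => [/andP[vr /eqP vu]|_]; [case: (asym _ _ ur vr uv vu)|rewrite opprK].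
by case: ifP => [/andP[vr /eqP vu]|_ //]; case: (asym _ _ ur vr uv vu).
Qed.

Lemma deg_balanced : @balanced k n deg_tree Delta deg_slope.
Proof.
split=> [u v uv|v]; first exact: comp_slopeN ends_root cut_root ends_cut ends_root rnl uv.
have H := comp_balanced pr prk pnl ends_root cut_root ends_cut leaf_ends
  ends_root rnl leaf_leg_inj leaf_leg_some leaf_leg_none
  (dslope_conservation leg0 par0_root par0_lt) (dslope_root leg0 par0_lt Delta_toric) v.
exact: etrans H.
Qed.

Section OneComponent.
Variable c : X.
Hypothesis cut_c : cut c.
Hypothesis c_nonleaf : ~~ leaf c.

Lemma leg_seq_uniq : uniq (leg_seq c).
Proof.
rewrite cat_uniq map_inj_uniq ?enum_uniq; last by move=> ? ? [].
by case: ifP => //=; rewrite ?andbT orbF => _; apply/mapP => -[].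
Qed.

Lemma comp_leg_inj : injective (@comp_leg c).
Proof.
move=> i j /eqP; rewrite /comp_leg nth_uniq ?leg_seq_uniq //.
- by move/eqP/val_inj.
- by have := ltn_ord i; rewrite {2}size_map.
- by have := ltn_ord j; rewrite {2}size_map.
Qed.

Lemma comp_leg_codom o : (o \in codom (@comp_leg c)) = (o \in leg_seq c).
Proof.
apply/codomP/idP => [[j ->]|o_in].
  by apply: mem_nth; have := ltn_ord j; rewrite {2}size_map.
have lt_i : (index o (leg_seq c) < size (comp_degree c))%N by rewrite size_map index_mem.
by exists (Ordinal lt_i); rewrite /comp_leg nth_index.
Qed.

Lemma comp_leg_some x : (Some x \in codom (@comp_leg c)) =
  [&& x != root, cut x & top par rk cut (par x) == c].
Proof.
rewrite comp_leg_codom mem_cat mem_map ?mem_enum; last by move=> ? ? [].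
by rewrite inE; case: (c == root); rewrite orbF.
Qed.

Lemma comp_leg_none : (None \in codom (@comp_leg c)) = (c != root).
Proof.
rewrite comp_leg_codom mem_cat; case: eqP => _ /=; last by rewrite inE eqxx orbT.
by rewrite orbF; apply/negbTE/mapP => -[].
Qed.

Lemma ctree_is_ltree : is_ltree (ctree c).
Proof.
exact: (comp_is_ltree slope pr prk pnl rnl cut_root keep_root cut_keep leaf_cut
  cut_c c_nonleaf comp_leg_inj comp_leg_some comp_leg_none keep_leaf_below keep_leaf_not_below).
Qed.

Lemma comp_degreeE (j : 'I_(size (comp_degree c))) :
  (comp_degree c)`_j = comp_label slope c (comp_leg j).
Proof. by rewrite (nth_map None) //; have := ltn_ord j; rewrite {2}size_map. Qed.

Lemma ctree_balanced : @balanced _ n (ctree c) (comp_degree c) (@cslope c).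
Proof.
split=> [u v uv|v]; first exact: comp_slopeN cut_root keep_root cut_keep cut_c c_nonleaf uv.
rewrite (eq_bigr _ (fun j _ => comp_degreeE j)).
exact: (comp_balanced pr prk pnl cut_root keep_root cut_keep leaf_cut
  cut_c c_nonleaf comp_leg_inj comp_leg_some comp_leg_none
  (dslope_conservation leg0 par0_root par0_lt) (dslope_root leg0 par0_lt Delta_toric) v).
Qed.

Definition deg_vert : vert deg_tree := comp_index par rk leaf ends cut root c.

Lemma deg_vertP : comp_vertex par rk leaf ends cut root c.
Proof. by apply/orP; right; apply/and3P; split=> //; rewrite top_ends. Qed.

Lemma deg_at_vert : deg_at deg_vert = c.
Proof. exact/comp_indexK/deg_vertP. Qed.

Lemma deg_star : perm_eq (comp_degree c) (star_degree (D := deg_tree) deg_slope deg_vert).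
Proof.
have H := comp_star slope pr prk pnl ends_root cut_root ends_cut leaf_ends
  ends_root rnl leaf_leg_inj leaf_leg_some leaf_leg_none deg_vert.
rewrite perm_sym; apply: perm_trans H _.
rewrite /deg_vert (comp_indexK deg_vertP) /comp_degree /leg_seq map_cat -map_comp.
by case: (c == root).
Qed.

End OneComponent.
End Code.

(** * The linear family of limit curves *)

Section Family.
Variables (R : realType) (n E : nat) (Delta : seq 'rV[int]_n).
Local Notation k := (size Delta).
Local Notation X := (dvert E Delta).
Variables (par0 : 'I_E.+1 -> 'I_E.+1) (leg0 : 'I_k -> 'I_E.+1) (Z I : {set X}).
Local Notation root := (droot E Delta).
Local Notation par := (dpar par0 leg0).
Local Notation rk := (@drk n E Delta).
Local Notation leaf := (@dleaf n E Delta).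
Local Notation slope := (dslope par0 leg0).
Local Notation cut := (cut I).
Local Notation keep := (keep Z).
Implicit Types y : 'rV[R]_(n + E).

(* A parameter y consists of the position of the root of the base tree followed
   by the lengths of the edges above its other vertices. *)
Definition base_mx (v : 'I_E.+1) : 'M[R]_(n + E, n) :=
  col_mx 1%:M (\matrix_(e, j) (if fconnect par0 v (lift ord0 e)
    then (bslope par0 leg0 (inl (lift ord0 e)) 0 j)%:~R else 0)).

(* The subdivision point of an edge is placed at its bottom vertex. *)
Definition pos_mx (x : X) : 'M[R]_(n + E, n) :=
  match x with (inl v, false) => base_mx v | (z, _) => base_mx (bottom_of par0 leg0 z) end.
Definition len_mx (x : X) : 'cV[R]_(n + E) :=
  match x with
  | (inl v, false) => if unlift ord0 v is Some e then delta_mx (rshift n e) 0 else 0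
  | _ => 0
  end.
Definition pos y x : 'rV[R]_n := y *m pos_mx x.
Definition len y x : R := (y *m len_mx x) 0 0.

Definition child_of (c : X) (u v : vert (ctree par0 leg0 Z I c)) : X :=
  if (u != comp_root par rk leaf cut keep c) && (comp_par u == v) then comp_at u
  else comp_at v.

(** The matrix [A] restricts the parameter to a subspace: it will be the identity or the inclusion
    of a coordinate hyperplane. The summands 0 give lengths and positions the literal form of
    [affine_family]. *)
Definition hcurve (p : nat) (A : 'M[R]_(p, n + E)) (c : X) (y : 'rV[R]_p) :
    trop_data R n (size (comp_degree par0 leg0 I c)) :=
  @TropData R n _ (ctree par0 leg0 Z I c)
    (fun u v => 0 + (y *m (A *m len_mx (child_of u v))) 0 0)
    (@cslope n E Delta par0 leg0 Z I c)
    (fun v => 0 + y *m (A *m pos_mx (comp_at v))).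

Hypothesis par0_root : par0 ord0 = ord0.
Hypothesis par0_lt : forall v, v != ord0 -> (par0 v < v)%N.

Let pr := dpar_root par0 leg0.
Let prk := @dpar_rank _ _ _ par0 leg0 par0_lt.
Let pnl := @dpar_nonleaf _ _ _ par0 leg0.

Lemma base_mx_step y v : v != ord0 ->
  y *m base_mx v = y *m base_mx (par0 v) +
    len y (inl v, false) *: toR R (bslope par0 leg0 (inl v)).
Proof.
move=> v0; have yE u : y *m base_mx u = lsubmx y + rsubmx y *m dsubmx (base_mx u).
  by rewrite -{1}[y]hsubmxK mul_row_col mulmx1 col_mxKd.
rewrite !yE -addrA; congr (_ + _).
rewrite /len /len_mx; case: unliftP => [e ve|v0']; last by rewrite v0' eqxx in v0.
rewrite -colE !col_mxKd; apply/rowP => j; rewrite !mxE.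
rewrite (bigD1 e) //= [in RHS](bigD1 e) //= !mxE -ve connect0.
have -> : fconnect par0 (par0 v) v = false.
  apply/negP => /(ancestor_rank (rk := @nat_of_ord _) par0_root par0_lt).
  have := par0_lt v0; have [E1|_] := eqVneq v (par0 v); first by rewrite -{1}E1 ltnn.
  by move=> h1 /(_ isT) h2; have := ltn_trans h1 h2; rewrite ltnn.
rewrite mulr0 add0r addrC; congr (_ + _).
apply: eq_bigr => i ie; rewrite !mxE; congr (_ * _).
have -> // : fconnect par0 v (lift ord0 i) = fconnect par0 (par0 v) (lift ord0 i).
apply/idP/idP => [|h]; last by apply: connect_trans h; exact: fconnect1.
by move/ancestor_parent; apply; rewrite ve (inj_eq lift_inj) eq_sym.
Qed.

Lemma pos_step y x : x != root -> ~~ leaf x ->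
  pos y x = pos y (par x) + len y x *: toR R (slope x).
Proof.
case: x => [[v|i] []] xr nlx //; rewrite /pos /len /dslope /dpar /=.
- rewrite mulmx0 mxE scale0r addr0; have [E1|//] := eqVneq (inl v : bedge E Delta) (inl ord0).
  by rewrite E1 eqxx in xr.
- have [->|v0] := eqVneq v ord0; last exact: base_mx_step.
  by rewrite unlift_none mulmx0 mxE scale0r addr0 par0_root.
by rewrite mulmx0 mxE scale0r addr0.
Qed.

Hypothesis leaf_I : forall i, (inr i, false) \in I.
Hypothesis IZ : forall x, x \in I -> x \notin Z.

Let cut_root : cut root := cut_root I.
Let keep_root : keep root := keep_root Z.
Let cut_keep := cut_keep IZ.
Let leaf_cut := leaf_cut leaf_I.

Definition contracted_lengths y := forall x, x \in Z -> len y x = 0.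
Definition positive_lengths y := forall x, x != root -> x \notin Z -> x \notin I -> 0 < len y x.

Lemma pos_top y x : contracted_lengths y -> ~~ leaf x -> pos y x = pos y (top par rk keep x).
Proof.
move=> Z0; apply: (@top_ind _ root _ _ prk keep keep_root
  (fun x t => ~~ leaf x -> pos y x = pos y t)) => // {}x nP IH nlx.
have xr : x != root by apply: contraNneq nP => ->.
have xZ : x \in Z by move: nP; rewrite /= negb_or negbK => /andP[].
by rewrite pos_step // Z0 // scale0r addr0 IH // pnl.
Qed.

Section OneCurve.
Variables (p : nat) (A : 'M[R]_(p, n + E)) (y : 'rV[R]_p) (c : X).
Hypothesis Z_0 : contracted_lengths (y *m A).
Hypothesis I_pos : positive_lengths (y *m A).
Hypothesis cut_c : cut c.
Hypothesis c_nonleaf : ~~ leaf c.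

Local Notation croot := (comp_root par rk leaf cut keep c).
Local Notation cidx := (comp_index par rk leaf cut keep c).
Local Notation h := (hcurve A c y).

Lemma hcurve_pos v : tpos (t := h) v = pos (y *m A) (comp_at v).
Proof. by rewrite /= add0r mulmxA. Qed.

Lemma hcurve_len u v : tlength (t := h) u v = len (y *m A) (child_of u v).
Proof. by rewrite /= add0r mulmxA. Qed.

Lemma hcurve_slope u v : tslope (t := h) u v = @cslope _ _ _ par0 leg0 Z I c u v.
Proof. by []. Qed.

Lemma child_ofP u v : adj (l := ctree par0 leg0 Z I c) u v ->
  exists w, [/\ w != croot, child_of u v = comp_at w,
     child_of v u = comp_at w &
     (u = w /\ v = comp_par w /\ @cslope _ _ _ par0 leg0 Z I c u v = - slope (comp_at w)) \/
     (v = w /\ u = comp_par w /\ @cslope _ _ _ par0 leg0 Z I c u v = slope (comp_at w))].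
Proof.
move=> uv; have asym := comp_par_asym pr prk pnl cut_root keep_root cut_keep cut_c c_nonleaf.
rewrite /child_of /cslope /comp_slope; case/orP: uv => /andP[ur /eqP uv].
  exists u; rewrite ur uv eqxx /=; split=> //; last by left.
  by case: ifP => // /andP[vr /eqP vu]; case: (asym _ _ ur vr uv vu).
exists v; rewrite ur uv eqxx /=; case: ifP => [/andP[vr /eqP vu]|_].
  by case: (asym _ _ ur vr uv vu).
by split=> //; right.
Qed.

Lemma comp_at_props w : w != croot ->
  [/\ comp_at w != root, comp_at w \notin Z, comp_at w \notin I, ~~ leaf (comp_at w) &
   comp_at (comp_par w) = top par rk keep (par (comp_at w))].
Proof.
move=> wr.
have nK : ~~ cut (comp_at w).
  apply: (comp_vertex_notK cut_keep cut_c c_nonleaf (comp_atP w)).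
  by rewrite -(comp_eq_root w).
have wroot : comp_at w != root by apply: contraNneq nK => ->.
have := comp_atP w; rewrite (comp_vertexE par rk cut_keep cut_c c_nonleaf) => /and3P[Pw nlw _].
split=> //.
- by case/orP: Pw => // /eqP E1; rewrite E1 eqxx in wroot.
- by apply: contra nK => wI; apply/orP; right.
exact: (comp_parE prk pnl cut_root keep_root cut_keep cut_c c_nonleaf wr).
Qed.

Lemma hcurve_tropical : 
  is_ltree (ctree par0 leg0 Z I c) ->
  balanced (T := ctree par0 leg0 Z I c) (comp_degree par0 leg0 I c) (@cslope _ _ _ par0 leg0 Z I c) ->
  @tropical_curve R n (comp_degree par0 leg0 I c) h.
Proof.
move=> tree_c bal_c; split=> // u v uv; have [w [wr uvw vuw Hw]] := child_ofP uv.
  have [wroot wZ wI _ _] := comp_at_props wr.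
  rewrite !hcurve_len uvw vuw; split=> //; exact: I_pos.
have [wroot wZ wI nlw parw] := comp_at_props wr.
have step : pos (y *m A) (comp_at w) = pos (y *m A) (comp_at (comp_par w)) +
    len (y *m A) (comp_at w) *: toR R (slope (comp_at w)).
  by rewrite parw -pos_top ?pnl // -pos_step.
rewrite !hcurve_pos hcurve_len uvw hcurve_slope.
case: Hw => [[-> [-> ->]]|[-> [-> ->]]]; last exact: step.
by rewrite step toRN scalerN addrK.
Qed.

Lemma comp_index_top z : ~~ leaf z -> top par rk cut z = c ->
  comp_at (cidx (top par rk keep z)) = top par rk keep z.
Proof.
move=> nlz zc; apply: comp_indexK.
rewrite (comp_vertexE par rk cut_keep cut_c c_nonleaf) (topP prk keep_root).
by rewrite (top_nonleaf prk keep_root pnl) //= (top_top prk cut_root keep_root cut_keep) zc.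
Qed.

(** This and the next three lemmas, with the converse [image_inv], describe the image of a component
    by vertices and edges of the uncontracted tree, so that limits can be discussed there. *)
Lemma image_vertex z : ~~ leaf z -> top par rk cut z = c -> trop_image h (pos (y *m A) z).
Proof.
move=> nlz zc; apply: Or31; exists (cidx (top par rk keep z)).
by rewrite hcurve_pos comp_index_top // pos_top.
Qed.

Lemma image_edge x s : x != root -> x \notin Z -> x \notin I -> top par rk cut x = c ->
  0 <= s <= len (y *m A) x -> trop_image h (pos (y *m A) (par x) + s *: toR R (slope x)).
Proof.
move=> xr xZ xI xc s_in; apply: Or32.
have nK : ~~ cut x by rewrite /= negb_or xr.
have nlx : ~~ leaf x by apply: contra nK; exact: leaf_cut.
have Px : keep x by apply/orP; right.
have xv : comp_vertex par rk leaf cut keep c x.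
  by rewrite (comp_vertexE par rk cut_keep cut_c c_nonleaf) Px nlx xc eqxx.
have parc : top par rk cut (par x) = c by rewrite -(top_par prk cut_root nK).
have nxc : cidx x != croot.
  by rewrite comp_eq_root comp_indexK //; apply: contraNneq nK => ->.
have parx : comp_par (cidx x) = cidx (top par rk keep (par x)).
  apply: comp_at_inj; have [_ _ _ _ ->] := comp_at_props nxc.
  by rewrite comp_indexK // comp_index_top // pnl.
exists (cidx (top par rk keep (par x))), (cidx x), s.
have uv : adj (l := ctree par0 leg0 Z I c) (cidx (top par rk keep (par x))) (cidx x).
  by apply/orP; right; rewrite nxc parx eqxx.
have asym := comp_par_asym pr prk pnl cut_root keep_root cut_keep cut_c c_nonleaf.
have nswap : (cidx (top par rk keep (par x)) != croot) &&
   (comp_par (cidx (top par rk keep (par x))) == cidx x) = false.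
  by apply/negP => /andP[ur /eqP vu]; case: (asym _ _ ur nxc vu parx).
split=> //.
  by rewrite hcurve_len /child_of nswap comp_indexK.
rewrite hcurve_pos comp_index_top ?pnl // -pos_top ?pnl //; congr (_ + _ *: toR R _).
by rewrite hcurve_slope /cslope /comp_slope nswap nxc parx eqxx /= comp_indexK.
Qed.

Lemma image_leg x s : x != root -> x \in I -> top par rk cut (par x) = c -> 0 <= s ->
  trop_image h (pos (y *m A) (par x) + s *: toR R (slope x)).
Proof.
move=> xr xI xc s_ge0; apply: Or33.
have : Some x \in codom (@comp_leg _ _ _ par0 leg0 I c).
  by rewrite comp_leg_some xr xc eqxx andbT; apply/orP; right.
case/codomP => j jx; exists j, s; split=> //; rewrite comp_degreeE hcurve_pos /= -jx /=.
by rewrite comp_index_top ?pnl // -pos_top ?pnl.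
Qed.

Lemma image_up s : c != root -> 0 <= s ->
  trop_image h (pos (y *m A) c - s *: toR R (slope c)).
Proof.
move=> cr s_ge0; apply: Or33.
have : None \in codom (@comp_leg _ _ _ par0 leg0 I c) by rewrite comp_leg_none.
case/codomP => j jx; exists j, s; split=> //; rewrite comp_degreeE hcurve_pos /= -jx /=.
by rewrite comp_rootE toRN scalerN.
Qed.

Lemma image_inv (q : 'rV[R]_n) : trop_image h q ->
  [\/ exists z, [/\ ~~ leaf z, top par rk cut z = c & q = pos (y *m A) z],
      exists x s, [/\ [/\ x != root, x \notin Z, x \notin I & top par rk cut x = c],
        0 <= s <= len (y *m A) x & q = pos (y *m A) (par x) + s *: toR R (slope x)],
      exists x s, [/\ x != root, x \in I, top par rk cut (par x) = c, 0 <= s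
        & q = pos (y *m A) (par x) + s *: toR R (slope x)] |
      exists s, [/\ c != root, 0 <= s & q = pos (y *m A) c - s *: toR R (slope c)]].
Proof.
have atc v : ~~ leaf (comp_at (v : vert (ctree par0 leg0 Z I c))) /\ top par rk cut (comp_at v) = c.
  have := comp_atP v; rewrite (comp_vertexE par rk cut_keep cut_c c_nonleaf).
  by move=> /and3P[_ -> /eqP].
case=> [[v ->]|[u [v [s [uv s_in ->]]]]|[j [s [s_ge0 ->]]]].
- by apply: Or41; exists (comp_at v); rewrite hcurve_pos; have [] := atc v.
- apply: Or42; have [w [wr uvw _ Hw]] := child_ofP uv.
  have [wroot wZ wI nlw parw] := comp_at_props wr; have [_ topw] := atc w.
  rewrite hcurve_len uvw in s_in; exists (comp_at w).
  have parpos : pos (y *m A) (comp_at (comp_par w)) = pos (y *m A) (par (comp_at w)).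
    by rewrite parw -pos_top ?pnl.
  case: Hw => [[-> [-> E1]]|[-> [-> E1]]].
    exists (len (y *m A) (comp_at w) - s); split=> //; first by lra.
    by rewrite hcurve_pos hcurve_slope E1 toRN scalerN scalerBl addrA -pos_step.
  by exists s; split=> //; rewrite hcurve_pos hcurve_slope E1 parpos.
rewrite comp_degreeE hcurve_pos /=; case E1 : (comp_leg j) => [x|] /=.
  have : Some x \in codom (@comp_leg _ _ _ par0 leg0 I c) by rewrite -E1 codom_f.
  rewrite comp_leg_some => /and3P[xr cx /eqP xc]; apply: Or43; exists x, s.
  split=> //; first by case/orP: cx => // /eqP E2; rewrite E2 eqxx in xr.
  by rewrite comp_index_top ?pnl // -pos_top ?pnl.
have : None \in codom (@comp_leg _ _ _ par0 leg0 I c) by rewrite -E1 codom_f.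
rewrite comp_leg_none => cr; apply: Or44; exists s; split=> //.
by rewrite comp_rootE toRN scalerN.
Qed.

End OneCurve.
End Family.

(** * Logarithmic images are close to trees *)

Section Meet.
Variables (R : realType) (E : nat) (par : 'I_E.+1 -> 'I_E.+1) (lam : 'I_E.+1 -> R).

(* When lam is the level of the vertices, this is the level of the lowest
   common ancestor of u and v. *)
Definition meet (u v : 'I_E.+1) : R :=
  lam ord0 - \sum_(e | [&& e != ord0, fconnect par u e & fconnect par v e])
    (lam (par e) - lam e).

Hypothesis par_root : par ord0 = ord0.
Hypothesis par_lt : forall v, v != ord0 -> (par v < v)%N.
Hypothesis lam_par : forall v, lam v <= lam (par v).

Let prk : forall v, v != ord0 -> (@nat_of_ord _ (par v) < v)%N := par_lt.

Lemma meetC u v : meet u v = meet v u.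
Proof. by congr (_ - _); apply: eq_bigl => e; rewrite [fconnect par u e && _]andbC. Qed.

Lemma ancestor_step v e : v != ord0 ->
  fconnect par v e = (e == v) || fconnect par (par v) e.
Proof.
move=> v0; apply/idP/orP => [ve|[/eqP ->|]]; last 2 first.
- exact: connect0.
- exact/connect_trans/fconnect1.
by have [->|ev] := eqVneq e v; [left|right; rewrite ancestor_parent // eq_sym].
Qed.

Lemma parent_not_below v : v != ord0 -> ~~ fconnect par (par v) v.
Proof.
move=> v0; apply/negP => /(ancestor_rank (rk := @nat_of_ord _) par_root prk).
have := par_lt v0; have [<-|_] := eqVneq v (par v); first by rewrite ltnn.
by move=> h1 /(_ isT) h2; have := ltn_trans h1 h2; rewrite ltnn.
Qed.

Lemma meet_step u v : v != ord0 ->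
  meet v u = meet (par v) u - (if fconnect par u v then lam (par v) - lam v else 0).
Proof.
move=> v0; rewrite /meet; case: ifP => uv.
  rewrite (bigD1 v) ?v0 ?connect0 //= opprD addrA addrAC; congr (_ - _ - _).
  apply: eq_bigl => e; rewrite ancestor_step //.
  have [->|ev] := eqVneq e v; last by rewrite andbT.
  by rewrite andbF (negPf (parent_not_below v0)) /= andbF.
rewrite subr0; congr (_ - _); apply: eq_bigl => e; rewrite ancestor_step //.
by have [->|//] := eqVneq e v; rewrite uv !andbF.
Qed.

Lemma root_ind (Q : 'I_E.+1 -> Prop) :
  Q ord0 -> (forall v, v != ord0 -> Q (par v) -> Q v) -> forall v, Q v.
Proof.
move=> Q0 Qs v; have [q] := ubnP (nat_of_ord v); elim: q v => // q IHq v le_q.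
have [->//|v0] := eqVneq v ord0; apply: Qs => //; apply: IHq.
exact: leq_trans (par_lt v0) _.
Qed.

Lemma ancestor_ord0 v : fconnect par v ord0.
Proof. exact: (ancestor_root prk). Qed.

Lemma meet_id v : meet v v = lam v.
Proof.
suff H : forall u, fconnect par u v -> meet v u = lam v by apply: H; exact: connect0.
move: v; apply: root_ind => [u _|v v0 IH u uv].
  rewrite /meet big1 ?subr0 // => e /and3P[e0 h _].
  have := ancestor_rank (rk := @nat_of_ord _) par_root prk h e0.
  by rewrite ltn0.
rewrite meet_step // uv IH; first by ring.
exact: connect_trans uv (fconnect1 _ _).
Qed.

Lemma meet_below u v : fconnect par u v -> meet v u = lam v.
Proof.
move=> uv; rewrite -[RHS]meet_id /meet; congr (_ - _); apply: eq_bigl => e.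
rewrite andbb; have [ve|//] := boolP (fconnect par v e).
by rewrite (connect_trans uv ve) andbT.
Qed.

Let incr_ge0 e : 0 <= lam (par e) - lam e.
Proof. by rewrite subr_ge0. Qed.

Lemma meet_ge u v : lam v <= meet v u.
Proof.
rewrite -[leLHS]meet_id /meet lerD2l lerN2.
rewrite [leRHS](bigID (fun e => fconnect par u e)) /=.
rewrite [X in _ <= X + _](eq_bigl (fun e => [&& e != ord0, fconnect par v e & fconnect par u e])).
  by rewrite lerDl sumr_ge0.
by move=> e /=; rewrite andbb andbA.
Qed.

Lemma meet_le u v w : fconnect par u w -> fconnect par v w -> meet u v <= lam w.
Proof.
move=> uw vw; rewrite -[leRHS]meet_id /meet lerD2l lerN2.
rewrite [leRHS](bigID (fun e => fconnect par w e)) /=.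
rewrite [X in _ <= X + _](eq_bigl (fun e => [&& e != ord0, fconnect par w e & fconnect par w e])).
  by rewrite lerDl sumr_ge0.
move=> e /=; rewrite andbb; have [we|] := boolP (fconnect par w e); rewrite ?andbF //.
by rewrite (connect_trans uw we) (connect_trans vw we) !andbT.
Qed.

(** The common ancestors of [u] and [v] are ancestors of [v] strictly above [e], because [u] is not
    below [e]. *)
Lemma meet_above u v e : e != ord0 -> fconnect par v e -> ~~ fconnect par u e ->
  meet v u = meet (par e) u.
Proof.
move=> e0 ve nue; rewrite /meet; congr (_ - _); apply: eq_bigl => x.
have [x0|x0] //= := boolP (x != ord0).
have [ux|_] := boolP (fconnect par u x); last by rewrite !andbF.
rewrite !andbT.
apply/idP/idP => [vx|ex]; last first.
  by apply: connect_trans ve _; apply: connect_trans (fconnect1 _ _) ex.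
have [xe|ex] := ancestor_chain vx ve.
  by rewrite (connect_trans ux xe) in nue.
apply: ancestor_parent => //; apply: contraNneq nue => ->.
exact: ux.
Qed.

End Meet.

(** * Approximate ultrametrics as trees *)

Section UltrametricTree.
Variable R : realType.
Local Notation C := R[i].
Local Notation nc := (@Normc.normc R).

Definition logdist (M : nat) (a : 'I_M -> C) (i j : 'I_M) : R := ln (nc (a i - a j)).

(** The legs are the points, a vertex is a cluster of points, and [lam v] is meant as the logarithm
    of its diameter; the distance of two points is then given by the smallest cluster containing
    both. *)
Definition approx_tree (M E : nat) (a : 'I_M -> C) (par : 'I_E.+1 -> 'I_E.+1)
    (leg : 'I_M -> 'I_E.+1) (lam : 'I_E.+1 -> R) (err : R) : Prop :=
  [/\ par ord0 = ord0 /\ (forall v, v != ord0 -> (par v < v)%N),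
      forall v, lam v <= lam (par v),
      forall v, exists i, fconnect par (leg i) v
    & forall i j, i != j -> `|logdist a i j - meet par lam (leg i) (leg j)| <= err].

Lemma logdistC M (a : 'I_M -> C) i j : logdist a i j = logdist a j i.
Proof. by rewrite /logdist ncB. Qed.

Lemma ln_nc_le (z w : C) (c : R) : 0 < c -> z != 0 -> w != 0 -> nc z <= c * nc w ->
  ln (nc z) <= ln c + ln (nc w).
Proof.
move=> c_gt0 z0 w0 zw; rewrite -lnM ?posrE ?nc_gt0 // ler_ln ?posrE ?nc_gt0 //.
by rewrite mulr_gt0 ?nc_gt0.
Qed.

(* Induction by merging the two closest points. *)
Lemma approx_tree_exists (N : nat) (a : 'I_N.+2 -> C) : injective a ->
  exists par leg lam, approx_tree (E := N) a par leg lam (N%:R * ln 2) /\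
    forall th, (forall i j, i != j -> th <= logdist a i j) -> forall v, th <= lam v.
Proof.
elim: N a => [|N IHN] a a_inj.
  exists id, (fun=> ord0), (fun=> logdist a ord0 ord_max); split; last first.
    by move=> th th_le _; exact: th_le.
  split=> //.
  - by split=> // v; rewrite (ord1 v).
  - by move=> v; exists ord0; rewrite (ord1 v) connect0.
  move=> i j ij; rewrite /meet big1 => [|e /andP[]]; last by rewrite (ord1 e).
  rewrite subr0 mul0r; have -> : logdist a i j = logdist a ord0 ord_max; last by rewrite subrr normr0.
  have h (u : 'I_2) : u = ord0 \/ u = ord_max.
    by case: u => [[|[|u]]] // hu; [left|right]; exact/val_inj.
  by case: (h i) (h j) ij => -> [] -> //; rewrite logdistC.
pose Q := [pred q : 'I_N.+3 * 'I_N.+3 | q.1 != q.2].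
have Q0 : Q (ord0, ord_max) by [].
have [[i0 j0] /= ij0 min0] := @arg_minP _ _ _ (ord0, ord_max) Q (fun q => logdist a q.1 q.2) Q0.
have {}min0 i j : i != j -> logdist a i0 j0 <= logdist a i j by move=> ij; exact: (min0 (i, j)).
set l0 := logdist a i0 j0 in min0.
have [i1 i1E] : exists i1, i0 = lift j0 i1.
  by case: (unliftP j0 i0) => [i1 ->|E1]; [exists i1|rewrite E1 eqxx in ij0].
pose b i := a (lift j0 i).
have b_inj : injective b by move=> i j /a_inj /lift_inj.
have [par [leg [lam [[[par0 par_lt] lam_par below err] th_lam]]]] := IHN b b_inj.
(* The least distance lies below all levels of the smaller tree, which keeps the levels monotone at
   the new vertex. This is what the second half of the statement is for. *)
have l0_lam v : l0 <= lam v.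
  by apply: th_lam => i j ij; apply: min0; rewrite (inj_eq lift_inj).
pose W (u : 'I_N.+1) : 'I_N.+2 := lift ord_max u.
have W_inj : injective W by exact: lift_inj.
have valW u : W u = u :> nat by exact: lift_max.
have W0 : W ord0 = ord0 by apply/val_inj; rewrite /= /bump leqn0.
(* The new vertex [ord_max] is a child of the old vertex of [i0], has level [l0] and carries the
   legs [i0] and [j0]. As it gets the largest number, parents keep smaller numbers than their
   children. *)
pose par' v := if unlift ord_max v is Some u then W (par u) else W (leg i1).
pose lam' v := if unlift ord_max v is Some u then lam u else l0.
pose leg' i := if unlift j0 i is Some i' then if i' == i1 then ord_max else W (leg i') else ord_max.
have parW u : par' (W u) = W (par u) by rewrite /par' liftK.
have parM : par' ord_max = W (leg i1) by rewrite /par' unlift_none.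
have lamW u : lam' (W u) = lam u by rewrite /lam' liftK.
have lamM : lam' ord_max = l0 by rewrite /lam' unlift_none.
have W_or v : v = ord_max \/ exists u, v = W u.
  by case: (unliftP ord_max v) => [u ->|->]; [right; exists u|left].
have WM u : W u != ord_max by rewrite /W eq_sym neq_lift.
have par0' : par' ord0 = ord0 by rewrite -W0 parW par0.
have par_lt' v : v != ord0 -> (par' v < v)%N.
  have [->|[u ->]] := W_or v => v0; first by rewrite parM valW /= ltn_ord.
  rewrite parW !valW; apply: par_lt; apply: contraNneq v0 => ->.
  by rewrite W0.
have iterW s u : iter s par' (W u) = W (iter s par u).
  by elim: s => //= s ->; rewrite parW.
have fcW u e : fconnect par' (W u) (W e) = fconnect par u e.
  apply/idP/idP => /iter_findex.
    by rewrite iterW => /W_inj <-; exact: fconnect_iter.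
  by move=> <-; rewrite -iterW fconnect_iter.
have fcWM u : fconnect par' (W u) ord_max = false.
  apply/negP => /iter_findex; rewrite iterW => /eqP.
  by rewrite (negPf (WM _)).
have fcMW e : fconnect par' ord_max (W e) = fconnect par (leg i1) e.
  rewrite -fcW -parM; apply/idP/idP => [h|].
    by apply: ancestor_parent => //; rewrite eq_sym WM.
  by apply: connect_trans; exact: fconnect1.
have sumW (P : pred 'I_N.+2) (F : 'I_N.+2 -> R) : P ord_max = false ->
    \sum_(e | P e) F e = \sum_(u | P (W u)) F (W u).
  move=> PM; rewrite big_mkcond [RHS]big_mkcond /= (bigD1_ord ord_max) //= PM add0r.
  by [].
have W0' u : (W u != ord0) = (u != ord0) by rewrite -W0 (inj_eq W_inj).
have meetW u v : meet par' lam' (W u) (W v) = meet par lam u v.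
  rewrite /meet -W0 lamW sumW ?fcWM ?andbF //; congr (_ - _).
  by apply: eq_big => [e|e _]; rewrite ?fcW ?(inj_eq W_inj) // parW !lamW.
have meetM v : meet par' lam' ord_max (W v) = meet par lam (leg i1) v.
  rewrite /meet -W0 lamW sumW ?fcWM ?andbF //; congr (_ - _).
  by apply: eq_big => [e|e _]; rewrite ?fcW ?fcMW ?(inj_eq W_inj) // parW !lamW.
have lam_par' v : lam' v <= lam' (par' v).
  by have [->|[u ->]] := W_or v; rewrite ?parM ?parW ?lamM !lamW.
have meetMM : meet par' lam' ord_max ord_max = l0.
  by rewrite -lamM; exact: meet_id.
have ln2 : 0 <= ln (2 : R) by rewrite ln_ge0 // ler1n.
have eN : N%:R * ln (2 : R) <= N.+1%:R * ln 2 by rewrite ler_wpM2r // ler_nat.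
have leg_i0 : leg' i0 = ord_max by rewrite /leg' i1E liftK eqxx.
have leg_j0 : leg' j0 = ord_max by rewrite /leg' unlift_none.
have leg_b i' : i' != i1 -> leg' (lift j0 i') = W (leg i').
  by move=> /negPf ii; rewrite /leg' liftK ii.
have cases i : [\/ i = i0, i = j0 | exists2 i', i' != i1 & i = lift j0 i'].
  case: (unliftP j0 i) => [i' ->|->]; last by apply: Or32.
  by have [->|ii] := eqVneq i' i1; [apply: Or31|apply: Or33; exists i'].
pose good i j := `|logdist a i j - meet par' lam' (leg' i) (leg' j)| <= N.+1%:R * ln 2.
have goodC i j : good i j -> good j i by rewrite /good logdistC meetC.
have good_i0 j' : j' != i1 -> good i0 (lift j0 j').
  move=> jj; rewrite /good leg_i0 leg_b // meetM; apply: le_trans eN.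
  by have := err i1 j'; rewrite eq_sym => /(_ jj); rewrite /logdist /b -i1E.
(* Here the error grows by [ln 2]: [a i0 - a j0] is no longer than either difference to a third
   point, so these two differences agree up to a factor 2. *)
have good_j0 j' : j' != i1 -> good j0 (lift j0 j').
  move=> jj; rewrite /good leg_j0 leg_b // meetM.
  have := err i1 j'; rewrite eq_sym => /(_ jj); rewrite /logdist /b -i1E => h.
  set j := lift j0 j' in h *.
  have ji : i0 != j by rewrite i1E (inj_eq lift_inj) eq_sym.
  have jj0 : j0 != j by rewrite neq_lift.
  have sub0 u v : u != v -> a u - a v != 0 by rewrite subr_eq0 (inj_eq a_inj).
  have exp_le u v u' v' : u != v -> u' != v' -> logdist a u v <= logdist a u' v' ->
      nc (a u - a v) <= nc (a u' - a v').
    by move=> uv uv'; rewrite /logdist ler_ln // posrE nc_gt0 sub0.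
  have h1 : logdist a i0 j <= ln 2 + logdist a j0 j.
    apply: ln_nc_le; rewrite ?sub0 //.
    have := ncD (a i0 - a j0) (a j0 - a j); rewrite addrA subrK => /le_trans; apply.
    have := exp_le _ _ _ _ ij0 jj0 (min0 _ _ jj0); lra.
  have h2 : logdist a j0 j <= ln 2 + logdist a i0 j.
    apply: ln_nc_le; rewrite ?sub0 //.
    have := ncD (a j0 - a i0) (a i0 - a j); rewrite addrA subrK => /le_trans; apply.
    have := exp_le _ _ _ _ ij0 ji (min0 _ _ ji); rewrite ncB; lra.
  move: h h1 h2; rewrite /logdist ler_norml => h h1 h2; rewrite ler_norml.
  have -> : N.+1%:R = N%:R + 1 :> R by rewrite -natr1.
  rewrite mulrDl mul1r; lra.
exists par', leg', lam'; split; first split=> //.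
- move=> v; have [->|[u ->]] := W_or v; first by exists i0; rewrite leg_i0 connect0.
  have [i' iu] := below u; have [ii|ii] := eqVneq i' i1.
    by exists i0; rewrite leg_i0 fcMW -ii.
  by exists (lift j0 i'); rewrite leg_b // fcW.
- move=> i j; rewrite -/(good i j).
  case: (cases i) => [->|->|[i' ii ->]]; case: (cases j) => [->|->|[j' jj ->]]; rewrite ?eqxx // => ij.
  + by rewrite /good leg_i0 leg_j0 meetMM subrr normr0 mulr_ge0.
  + exact: good_i0.
  + by apply: goodC; rewrite /good leg_i0 leg_j0 meetMM subrr normr0 mulr_ge0.
  + exact: good_j0.
  + exact/goodC/good_i0.
  + exact/goodC/good_j0.
  rewrite /good !leg_b // meetW; apply: le_trans eN.
  by apply: err; rewrite (inj_eq lift_inj) in ij.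
move=> th th_le v; have [->|[u ->]] := W_or v.
  by rewrite lamM; exact: th_le.
rewrite lamW; apply: th_lam => i j ij; apply: th_le.
by rewrite (inj_eq lift_inj).
Qed.

End UltrametricTree.

(** * Paths from the ends to the root *)

Section TreePath.
Variables (R : realType) (n M E : nat) (par : 'I_E.+1 -> 'I_E.+1) (leg : 'I_M -> 'I_E.+1).
Variables (lam : 'I_E.+1 -> R) (d : 'I_M -> 'rV[int]_n) (p : 'rV[R]_n).
Hypothesis par_root : par ord0 = ord0.
Hypothesis par_lt : forall v, v != ord0 -> (par v < v)%N.
Hypothesis lam_par : forall v, lam v <= lam (par v).

Definition tree_pos (v : 'I_E.+1) : 'rV[R]_n :=
  p - \sum_j meet par lam v (leg j) *: toR R (d j).

Definition tree_slope (v : 'I_E.+1) : 'rV[int]_n := \sum_(j | fconnect par (leg j) v) d j.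

(* Logarithmic distance to the j-th end of the point at level r on the path
   from the i-th end to the root end. *)
Definition path_level (i j : 'I_M) (r : R) : R :=
  if j == i then r else Num.max r (meet par lam (leg i) (leg j)).

Definition tree_path (i : 'I_M) (r : R) : 'rV[R]_n :=
  p - \sum_j path_level i j r *: toR R (d j).

Lemma tree_pos_step v : v != ord0 ->
  tree_pos v = tree_pos (par v) + (lam (par v) - lam v) *: toR R (tree_slope v).
Proof.
move=> v0; rewrite /tree_pos -addrA; congr (_ + _).
rewrite toR_sum scaler_sumr [X in _ + X]big_mkcond -!sumrN -big_split /=.
apply: eq_bigr => j _; rewrite (meet_step lam par_root par_lt (leg j) v0) //.
by case: ifP => _; rewrite ?subr0 ?addr0 // -!scaleNr -scalerDl opprB addrC.
Qed.

Lemma tree_path_leg i r : r <= lam (leg i) ->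
  tree_path i r = tree_pos (leg i) + (lam (leg i) - r) *: toR R (d i).
Proof.
move=> r_le; rewrite /tree_path /tree_pos -addrA; congr (_ + _).
rewrite (bigD1 i) //= [in RHS](bigD1 i) //= /path_level eqxx meet_id //.
rewrite (eq_bigr (fun j => meet par lam (leg i) (leg j) *: toR R (d j))).
  by rewrite scalerBl !opprD; set s := \sum_(_ | _) _; rewrite addrAC addrA addNr add0r.
move=> j ji; rewrite (negPf ji) max_r //.
exact: le_trans r_le (meet_ge par_root par_lt lam_par _ _).
Qed.

(** At a level between those of [e] and its parent, exactly the ends below [e] are at level [r]; the
    distances to the others are constant. So the path moves in the direction of the sum of their
    vectors. *)
Lemma tree_path_edge i e r : e != ord0 -> fconnect par (leg i) e ->
  lam e <= r <= lam (par e) ->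
  tree_path i r = tree_pos (par e) + (lam (par e) - r) *: toR R (tree_slope e).
Proof.
move=> e0 ie /andP[er re]; rewrite /tree_path /tree_pos -addrA; congr (_ + _).
rewrite toR_sum scaler_sumr -sumrN [X in _ + X]big_mkcond -sumrN -big_split /=.
apply: eq_bigr => j _; case: ifP => je.
  have -> : path_level i j r = r.
    rewrite /path_level; case: ifP => // _; apply/max_l.
    exact: le_trans (meet_le par_root par_lt lam_par ie je) er.
  rewrite (meet_below lam par_root par_lt) ?(connect_trans je (fconnect1 _ _)) //.
  by rewrite -scaleNr -[in RHS]scaleNr -scalerDl; congr (_ *: _); ring.
rewrite addr0 /path_level; have [ji|ji] := eqVneq j i; first by rewrite ji ie in je.
rewrite (meet_above lam e0 ie) ?je // max_r //.
exact: le_trans re (meet_ge par_root par_lt lam_par _ _).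
Qed.

(** Beyond the level of the root all ends are at the same distance [r], and the path follows the ray
    towards infinity. *)
Lemma tree_path_root i r : lam ord0 <= r ->
  tree_path i r = tree_pos ord0 + (r - lam ord0) *: (- \sum_j toR R (d j)).
Proof.
move=> r_ge; rewrite /tree_path /tree_pos -addrA; congr (_ + _).
rewrite scalerN scaler_sumr -!sumrN -big_split /=; apply: eq_bigr => j _.
rewrite (meet_below lam par_root par_lt) ?ancestor_ord0 //.
have -> : path_level i j r = r.
  rewrite /path_level; case: ifP => // _; apply/max_l; apply: le_trans r_ge.
  by apply: (meet_le par_root par_lt lam_par); exact: ancestor_ord0.
by rewrite -!scaleNr -scalerDl; congr (_ *: _); ring.
Qed.

Lemma tree_path_cases i r : [\/ r <= lam (leg i), lam ord0 <= r |
  exists e, [/\ e != ord0, fconnect par (leg i) e & lam e <= r <= lam (par e)]].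
Proof.
have [r_le|r_gt] := leP r (lam (leg i)); first exact: Or31.
suff H v : lam v <= r -> lam ord0 <= r \/
    exists e, [/\ e != ord0, fconnect par v e & lam e <= r <= lam (par e)].
  by case: (H _ (ltW r_gt)) => ?; [apply: Or32|apply: Or33].
move: v; apply: (root_ind par_lt) => [h|v v0 IH vr]; first by left.
have [rp|/ltW pr] := leP r (lam (par v)).
  by right; exists v; rewrite v0 connect0 vr rp.
case: (IH pr) => [h|[e [e0 pe re]]]; first by left.
by right; exists e; split=> //; exact: connect_trans (fconnect1 _ _) pe.
Qed.

End TreePath.

Section NearPath.
Variables (R : realType) (n M : nat) (a : nat -> R[i]) (d : nat -> 'rV[int]_n).
Local Notation nc := (@Normc.normc R).

Definition near_by (e : R) (x y : 'rV[R]_n) : Prop := forall c, `|x 0 c - y 0 c| <= e.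

Definition near_sets (e : R) (A B : set 'rV[R]_n) : Prop :=
  (forall x, A x -> exists2 y, B y & near_by e x y) /\
  (forall y, B y -> exists2 x, A x & near_by e x y).

Definition weight : R := \sum_(j < M) \sum_c `|toR R (d j) 0 c|.

Lemma near_combination (p : 'rV[R]_n) (f g : 'I_M -> R) (e : R) : 0 <= e ->
  (forall j, `|f j - g j| <= e) ->
  near_by (e * weight) (p - \sum_(j < M) f j *: toR R (d j)) (p - \sum_(j < M) g j *: toR R (d j)).
Proof.
move=> e_ge0 fg c.
have -> : (p - \sum_(j < M) f j *: toR R (d j)) 0 c - (p - \sum_(j < M) g j *: toR R (d j)) 0 c =
    \sum_(j < M) (g j - f j) * toR R (d j) 0 c.
  rewrite !mxE !summxE opprB addrA addrAC [p 0 c - _ - _]addrAC subrr sub0r addrC -sumrB.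
  by apply: eq_bigr => j _; rewrite !mxE mulrBl.
apply: (le_trans (ler_norm_sum _ _ _)); rewrite /weight mulr_sumr; apply: ler_sum => j _.
rewrite normrM distrC; apply: ler_pM => //.
by rewrite (bigD1 c) //= lerDl sumr_ge0.
Qed.

(* Pigeonhole: some of M + 1 equally spaced candidates is far from the M points. *)
Lemma far_point (i : 'I_M) (rho : R) : 0 < rho -> exists w : R[i],
  [/\ rho <= nc (w - a i), nc (w - a i) <= M.+1%:R * rho &
    forall j, (j < M)%N -> rho / 3 <= nc (w - a j)].
Proof.
move=> rho_gt0.
pose cand (q : nat) : R[i] := a i + (q.+1%:R * rho)%:C%C.
have candE q : nc (cand q - a i) = q.+1%:R * rho.
  by rewrite /cand addrC addKr ncR ger0_norm // mulr_ge0 ?ler0n // ltW.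
have [q qP] : exists q : 'I_M.+1, forall j : 'I_M, rho / 3 <= nc (cand q - a j).
  apply: contrapT => no.
  have /choice[J JP] : forall q : 'I_M.+1, exists j : 'I_M, nc (cand q - a j) < rho / 3.
    move=> q; apply: contrapT => noj; apply: no; exists q => j.
    by rewrite leNgt; apply/negP => h; apply: noj; exists j.
  (* Two candidates are at least [rho] apart, but they would be closer than [2 * rho / 3] if both
     were within [rho / 3] of the same point. *)
  have Jinj : injective J.
    move=> q1 q2 J12; apply: contrapT => q12.
    have h1 := JP q1; have h2 := JP q2; rewrite -J12 ncB in h2.
    have := ncD (cand q1 - a (J q1)) (a (J q1) - cand q2); rewrite addrA subrK.
    have -> : cand q1 - cand q2 = ((q1%:R - q2%:R) * rho)%:C%C.
      rewrite /cand opprD addrACA subrr add0r -rmorphB /= -mulrBl; congr ((_ * _)%:C%C).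
      by rewrite -!natr1 opprD addrACA subrr addr0.
    rewrite ncR normrM (gtr0_norm rho_gt0).
    have : 1 <= `|q1%:R - q2%:R : R|.
      have q12' : (q1 : nat) != q2 by apply/eqP => E1; apply: q12; exact: val_inj.
      have [lt12|lt21|E1] := ltngtP q1 q2; last by rewrite E1 eqxx in q12'.
        by rewrite distrC -natrB ?(ltnW lt12) // normr_nat ler1n subn_gt0.
      by rewrite -natrB ?(ltnW lt21) // normr_nat ler1n subn_gt0.
    move=> h3 h4; have : 1 * rho <= `|q1%:R - q2%:R : R| * rho by rewrite ler_pM2r.
    lra.
  by have := max_card (mem (codom J)); rewrite card_codom // !card_ord ltnn.
exists (cand q); split=> [||j jM]; last exact: (qP (Ordinal jM)).
  by rewrite candE -[leLHS]mul1r ler_pM2r // ler1n.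
by rewrite candE ler_pM2r // ler_nat ltn_ord.
Qed.

End NearPath.

Section TreeSet.
Variables (R : realType) (n E : nat) (Delta : seq 'rV[int]_n).
Local Notation k := (size Delta).

Definition tree_set (par0 : 'I_E.+1 -> 'I_E.+1) (leg0 : 'I_k -> 'I_E.+1)
    (y : 'rV[R]_(n + E)) : set 'rV[R]_n :=
  [set q | [\/ q = y *m base_mx R par0 leg0 ord0,
    exists v s, [/\ v != ord0, 0 <= s <= len y ((inl v, false) : dvert E Delta) &
      q = y *m base_mx R par0 leg0 (par0 v) + s *: toR R (bslope par0 leg0 (inl v))] |
    exists i s, 0 <= s /\ q = y *m base_mx R par0 leg0 (leg0 i) + s *: toR R Delta`_i]].

Definition valid_base (par0 : 'I_E.+1 -> 'I_E.+1) (leg0 : 'I_k -> 'I_E.+1) : Prop :=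
  [/\ par0 ord0 = ord0, forall v, v != ord0 -> (par0 v < v)%N,
      forall v, v != ord0 -> exists i, fconnect par0 (leg0 i) v &
      forall v, v != ord0 -> exists i, ~~ fconnect par0 (leg0 i) v].

End TreeSet.

Section NearTree.
Variables (R : realType) (n : nat) (Delta : seq 'rV[int]_n).
Local Notation C := R[i].
Local Notation nc := (@Normc.normc R).
Local Notation k := (size Delta).
Local Notation m := (k - 2)%N.
Local Notation E := m.-1.

(** The first term is the error of the tree. The second comes from [far_point], used with [m.+1]
    points: if [|w - a i| <= (m + 2) rho] and [rho <= 3 |w - a j|], then [|a i - a j|] is at most
    [3 (m + 2) + 1 = 3 (m + 1) + 4] times [|w - a j|]. *)
Definition level_error : R := m%:R * ln 2 + ln (3 * m.+1%:R + 4).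

Lemma approx_tree_exists_all (a : 'I_m.+1 -> C) : injective a ->
  exists par leg lam, approx_tree (E := E) a par leg lam (m%:R * ln 2).
Proof.
move: m a => [|N] a a_inj.
  exists id, (fun=> ord0), (fun=> 0); split=> //.
  - by split=> // v; rewrite (ord1 v).
  - by move=> v; exists ord0; rewrite (ord1 v) connect0.
  - by move=> i j; rewrite (ord1 i) (ord1 j).
have [par [leg [lam [[h1 h2 h3 h4] _]]]] := approx_tree_exists a_inj.
exists par, leg, lam; split=> // i j ij; apply: le_trans (h4 i j ij) _.
by rewrite ler_wpM2r ?ler_nat // ln_ge0 // ler1n.
Qed.

Section Fixed.
Variables (a : nat -> C) (p : 'rV[R]_n).
Hypothesis a_inj : forall i j, (i < m.+1)%N -> (j < m.+1)%N -> a i = a j -> i = j.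
Variables (par : 'I_E.+1 -> 'I_E.+1) (leg : 'I_m.+1 -> 'I_E.+1) (lam : 'I_E.+1 -> R).
Hypothesis tree : approx_tree (fun i : 'I_m.+1 => a i) par leg lam (m%:R * ln 2).
Hypothesis Delta_toric : toric_degree Delta.

Let d (i : 'I_m.+1) := Delta`_i.
Let par_root : par ord0 = ord0. Proof. by case: tree => -[]. Qed.
Let par_lt v : v != ord0 -> (par v < v)%N. Proof. by case: tree => -[_ h] _ _ _; exact: h. Qed.
Let lam_par v : lam v <= lam (par v). Proof. by case: tree. Qed.

Let path := tree_path par leg lam d p.
Let level := path_level par leg lam.

Let d_gt0 : (0 : R) < 3 * m.+1%:R + 4.
Proof. by rewrite ltr_wpDl // mulr_ge0. Qed.

Let ln_err : ln (2 : R) <= ln (3 * m.+1%:R + 4).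
Proof.
rewrite ler_ln ?posrE //; have : (0 : R) <= 3 * m.+1%:R by rewrite mulr_ge0.
lra.
Qed.

Let a_sub (i j : 'I_m.+1) : j != i -> a i - a j != 0.
Proof.
by move=> ji; rewrite subr_eq0; apply: contra_neq ji => aij; exact/val_inj/esym/(a_inj (ltn_ord i) (ltn_ord j) aij).
Qed.

Let max_lip (r x y : R) : `|Num.max r x - Num.max r y| <= `|x - y|.
Proof.
rewrite ler_norml; have := ler_norm (x - y); have := ler_norm (y - x); rewrite [`|y - x|]distrC.
by rewrite /Num.max; case: ifP; case: ifP => /= h1 h2; rewrite ?ltNge in h1 h2; lra.
Qed.

Let level_near (i j : 'I_m.+1) (r : R) (w : C) : w != a j ->
  (j = i -> `|ln (nc (w - a j)) - r| <= ln (3 * m.+1%:R + 4)) ->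
  (j != i -> `|ln (nc (w - a j)) - Num.max r (ln (nc (a i - a j)))| <= ln (3 * m.+1%:R + 4)) ->
  `|ln (nc (w - a j)) - level i j r| <= level_error.
Proof.
move=> wj h1 h2; have e0 : 0 <= m%:R * ln (2 : R) by rewrite mulr_ge0 // ln_ge0 // ler1n.
rewrite /level /path_level /level_error; case: eqVneq => [ji|ji].
  by have := h1 ji; lra.
have := h2 ji; have := max_lip r (ln (nc (a i - a j))) (meet par lam (leg i) (leg j)).
have [_ _ _ err] := tree; have := err i j; rewrite eq_sym ji => /(_ isT).
rewrite /logdist => h3 h4 h5.
rewrite -[_ - Num.max _ _](subrKA (Num.max r (ln (nc (a i - a j))))).
by apply: (le_trans (ler_normD _ _)); rewrite addrC lerD // (le_trans h4).
Qed.

Let ln_le (x y c : R) : 0 < x -> 0 < y -> 0 < c -> x <= c * y -> ln x <= ln c + ln y.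
Proof.
by move=> x0 y0 c0 xy; rewrite -lnM ?posrE // ler_ln ?posrE // mulr_gt0.
Qed.

Let ln_max (x y : R) : 0 < x -> 0 < y -> Num.max (ln x) (ln y) = ln (Num.max x y).
Proof.
move=> x0 y0; have [xy|yx] := leP x y.
  by apply/max_r; rewrite ler_ln ?posrE.
by apply/max_l; rewrite ler_ln ?posrE // ltW.
Qed.

(** If [a i] is the point closest to [w], then [|w - a j|] is the maximum of [|w - a i|] and
    [|a i - a j|] up to a factor 2, so [w] belongs to the path of [i] at level [ln |w - a i|].
    Conversely, for a given level [r] on the path of [i], [far_point] yields a [w] at distance about
    [expR r] from [a i] that is not much closer to any other point. *)
Lemma log_factors_near_path :
  near_sets (level_error * weight R m.+1 (fun i => Delta`_i)) (log_factors m.+1 (fun i => Delta`_i) a p)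
    [set q | exists i r, q = path i r].
Proof.
have ln2 : 0 <= ln (2 : R) by rewrite ln_ge0 // ler1n.
have e_ge0 : 0 <= level_error.
  by apply: addr_ge0; [rewrite mulr_ge0|exact: le_trans ln_err].
have c1 : 0 < (3 * m.+1%:R + 4 : R) := d_gt0.
have m0 : (0 : R) <= m.+1%:R by rewrite ler0n.
split=> [_ [w wa <-]|_ [i [r ->]]].
  have wa' (j : 'I_m.+1) : w != a j by exact: wa.
  have [i _ imin] := @arg_minP _ _ _ (ord0 : 'I_m.+1) xpredT (fun j : 'I_m.+1 => nc (w - a j)) isT.
  exists (path i (ln (nc (w - a i)))); first by exists i, (ln (nc (w - a i))).
  apply: near_combination => // j; apply: level_near => [//|->|ji].
    by rewrite subrr normr0 (le_trans _ ln_err) // ln_ge0 // ler1n.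
  have p1 : 0 < nc (w - a i) by rewrite nc_gt0 subr_eq0.
  have p2 : 0 < nc (a i - a j) by rewrite nc_gt0 a_sub.
  have p3 : 0 < nc (w - a j) by rewrite nc_gt0 subr_eq0.
  apply: le_trans ln_err; rewrite ln_max //.
  have h1 : nc (w - a j) <= 2 * Num.max (nc (w - a i)) (nc (a i - a j)).
    have := ncD (w - a i) (a i - a j); rewrite addrA subrK => /le_trans; apply.
    by rewrite mulr_natl mulr2n lerD // le_max lexx ?orbT.
  have h2 : Num.max (nc (w - a i)) (nc (a i - a j)) <= 2 * nc (w - a j).
    rewrite ge_max; have := imin j isT; have := ncD (a i - w) (w - a j).
    by rewrite addrA subrK ncB; move=> h3 h4; apply/andP; split; lra.
  have p4 : 0 < Num.max (nc (w - a i)) (nc (a i - a j)) by rewrite lt_max p1.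
  have c2 : (0 : R) < 2 by [].
  by have := ln_le p3 p4 c2 h1; have := ln_le p4 p3 c2 h2; rewrite ler_norml; lra.
have [w [w1 w2 w3]] := far_point a i (expR_gt0 r).
have rho := expR_gt0 r.
have pj (j : 'I_m.+1) : 0 < nc (w - a j).
  by apply: lt_le_trans (w3 j (ltn_ord j)); rewrite divr_gt0.
exists (p - \sum_(j < m.+1) ln (nc (w - a j)) *: toR R Delta`_j).
  exists w => // j jm; have := pj (Ordinal jm) => /=.
  by rewrite nc_gt0 subr_eq0.
apply: near_combination => // j.
have wj : w != a j by rewrite -subr_eq0 -nc_gt0.
apply: level_near => // ji.
  subst j; have h1 : nc (w - a i) <= (3 * m.+1%:R + 4) * expR r.
    apply: le_trans w2 _; rewrite ler_pM2r // -[in leLHS]natr1; lra.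
  have h2 : expR r <= 1 * nc (w - a i) by rewrite mul1r.
  have := ln_le (pj i) rho c1 h1; have := ln_le rho (pj i) ltr01 h2.
  by rewrite expRK ln1 => h3 h4; rewrite ler_norml; have := ln_err; have : 0 <= ln (2 : R) by [rewrite ln_ge0 // ler1n]; lra.
have p2 : 0 < nc (a i - a j) by rewrite nc_gt0 a_sub.
rewrite -{1}[r]expRK ln_max //; have p4 : 0 < Num.max (expR r) (nc (a i - a j)) by rewrite lt_max rho.
have w3j := w3 j (ltn_ord j).
have s1 : expR r <= Num.max (expR r) (nc (a i - a j)) by rewrite le_max lexx.
have s2 : nc (a i - a j) <= Num.max (expR r) (nc (a i - a j)) by rewrite le_max lexx orbT.
have w2' : nc (w - a i) <= (m.+1%:R + 1) * expR r by rewrite natr1.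
have h1 : nc (w - a j) <= (3 * m.+1%:R + 4) * Num.max (expR r) (nc (a i - a j)).
  have := ncD (w - a i) (a i - a j); rewrite addrA subrK => /le_trans; apply.
  set mx := Num.max _ _ in s1 s2 p4 *.
  have : (m.+1%:R + 1) * expR r <= (m.+1%:R + 1) * mx by rewrite ler_wpM2l // addr_ge0.
  have : 0 <= m.+1%:R * mx by rewrite mulr_ge0 // ltW.
  by move=> h5 h6; rewrite !mulrDl in h6 *; lra.
have h2 : Num.max (expR r) (nc (a i - a j)) <= (3 * m.+1%:R + 4) * nc (w - a j).
  have h5 : 0 <= m.+1%:R * nc (w - a j) by rewrite mulr_ge0 // ltW.
  rewrite ge_max; apply/andP; split; first by rewrite mulrDl; lra.
  have := ncD (a i - w) (w - a j); rewrite addrA subrK ncB => /le_trans; apply.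
  have : (m.+1%:R + 1) * expR r <= (m.+1%:R + 1) * (3 * nc (w - a j)).
    by rewrite ler_wpM2l // ?addr_ge0 //; lra.
  by move=> h6; rewrite !mulrDl in h6 *; lra.
have := ln_le (pj j) p4 c1 h1; have := ln_le p4 (pj j) c1 h2.
by rewrite ler_norml => ? ?; lra.
Qed.

End Fixed.
End NearTree.

Section LogImageNearTree.
Variables (R : realType) (n : nat) (Delta : seq 'rV[int]_n).
Local Notation k := (size Delta).
Local Notation m := (k - 2)%N.
Local Notation E := m.-1.
Hypothesis Delta_toric : toric_degree Delta.

Section Path.
Variables (p : 'rV[R]_n).
Variables (par : 'I_E.+1 -> 'I_E.+1) (leg : 'I_m.+1 -> 'I_E.+1) (lam : 'I_E.+1 -> R).
Hypothesis par_root : par ord0 = ord0.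
Hypothesis par_lt : forall v, v != ord0 -> (par v < v)%N.
Hypothesis lam_par : forall v, lam v <= lam (par v).
Hypothesis leaf_under : forall v, exists i, fconnect par (leg i) v.

Let d (i : 'I_m.+1) := Delta`_i.
(** The last end, at infinity, is attached to the root. The parameter [y] below consists of the
    position of the root and of the level differences along the edges. *)
Let leg0 (i : 'I_k) : 'I_E.+1 := if (i < m.+1)%N then leg (inord i) else ord0.
Let y : 'rV[R]_(n + E) := row_mx (tree_pos par leg lam d p ord0)
  (\row_e (lam (par (lift ord0 e)) - lam (lift ord0 e))).

Let not_below_root v : v != ord0 -> fconnect par ord0 v = false.
Proof.
move=> v0; apply/negP => /(ancestor_rank (rk := @nat_of_ord _) par_root par_lt) /(_ v0).
by rewrite ltn0.
Qed.

Let E_pos v : v != ord0 :> 'I_E.+1 -> (m.+1 < k)%N.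
Proof. by move=> v0; have := ltn_ord v; have : (v : nat) != 0%N by []; lia. Qed.

Lemma tree_slope_base v : v != ord0 -> bslope par leg0 (inl v) = tree_slope par leg d v.
Proof.
move=> v0; rewrite /bslope /tree_slope.
pose P (j : nat) := fconnect par (leg (inord j)) v.
rewrite [RHS](eq_bigl (fun j : 'I_m.+1 => P j)) => [|j]; last by rewrite /P inord_val.
rewrite (big_ord_widen_cond k P (fun j => Delta`_j)); last exact/ltnW/(E_pos v0).
apply: eq_bigl => i; rewrite /leg0 /P; case: ltnP; rewrite ?andbT ?andbF // => _.
exact: not_below_root.
Qed.

Lemma path_len v : v != ord0 ->
  len y ((inl v, false) : dvert E Delta) = lam (par v) - lam v.
Proof.
move=> v0; rewrite /len /len_mx; case: unliftP => [e ->|v0']; last by rewrite v0' eqxx in v0.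
by rewrite -colE /y mxE row_mxEr mxE.
Qed.

Lemma path_pos v : y *m base_mx R par leg0 v = tree_pos par leg lam d p v.
Proof.
move: v; apply: (root_ind par_lt) => [|v v0 IH].
  rewrite mul_row_col mulmx1 [X in _ + _ *m X](_ : _ = 0) ?mulmx0 ?addr0 //.
  by apply/matrixP => e j; rewrite !mxE not_below_root // eq_sym neq_lift.
by rewrite base_mx_step // IH path_len // [in RHS]tree_pos_step // tree_slope_base.
Qed.

(** The path of an end runs through its leg, the edges above it and a ray beyond the root. This ray
    is the leg of the last end, whose vector is minus the sum of the others; if there is no such
    end, that sum is 0 and the ray is a point. *)
Lemma tree_set_path : tree_set par leg0 y = [set q | exists i r, q = tree_path par leg lam d p i r].
Proof.
have last_leg (i : 'I_k) : ~~ (i < m.+1)%N -> Delta`_i = - \sum_(j < m.+1) d j.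
  move=> i_ge; have ik := ltn_ord i.
  have kE : k = m.+2 by lia.
  have iE : nat_of_ord i = m.+1 by lia.
  have : \sum_(0 <= j < m.+2) Delta`_j = 0.
    by rewrite -kE; have := Delta_toric; rewrite /toric_degree (big_nth 0).
  by rewrite big_nat_recr //= big_mkord iE addrC => /eqP; rewrite addr_eq0 => /eqP.
have sumd : \sum_(j < m.+1) d j = 0 \/ exists i : 'I_k, ~~ (i < m.+1)%N.
  have [mk|km] := ltnP m.+1 k; first by right; exists (Ordinal mk); rewrite ltnn.
  left; have := Delta_toric; rewrite /toric_degree (big_nth 0) big_mkord.
  rewrite (@big_ord_widen _ _ _ k m.+1 (fun j => Delta`_j) km) => s0; rewrite -[RHS]s0.
  rewrite [RHS]big_mkcond; apply: eq_bigr => j _; case: ltnP => // kj.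
  by rewrite /d nth_default.
have toR_sumd : - \sum_j toR R (d j) = toR R (- \sum_j d j) by rewrite toRN toR_sum.
apply/seteqP; split=> q.
  case=> [->|[v [s [v0 s_in ->]]]|[i [s [s_ge0 ->]]]].
  - exists ord0, (lam ord0); rewrite tree_path_root // subrr scale0r addr0.
    exact: path_pos.
  - have [i iv] := leaf_under v; rewrite path_len // in s_in.
    exists i, (lam (par v) - s); rewrite (tree_path_edge _ _ par_root par_lt lam_par v0 iv); last by lra.
    by rewrite path_pos tree_slope_base // opprB subrKC.
  rewrite path_pos /leg0; case: ifP => [im|/negbT im].
    exists (inord i), (lam (leg (inord i)) - s); rewrite tree_path_leg //; last by lra.
    by rewrite opprB subrKC /d inordK.
  exists ord0, (lam ord0 + s); rewrite tree_path_root //; last by lra.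
  by rewrite [lam ord0 + s]addrC addrK toR_sumd -(last_leg i im).
case=> i [r ->]; have [ri|r0|[e [e0 ie er]]] := tree_path_cases leg lam par_lt i r.
- have [ik|ki] := ltnP i k.
    apply: Or33; exists (Ordinal ik), (lam (leg i) - r); split; first by lra.
    by rewrite path_pos /leg0 /= ltn_ord inord_val tree_path_leg.
  apply: Or31; rewrite tree_path_leg // /d nth_default // toR0 scaler0 addr0 path_pos.
  have mE : E = 0%N by have := ltn_ord i; lia.
  by congr tree_pos; apply/val_inj; have := ltn_ord (leg i); rewrite /= {2}mE; case: (leg i : nat).
- rewrite tree_path_root // toR_sumd; case: sumd => [->|[j jm]].
    by rewrite oppr0 toR0 scaler0 addr0; apply: Or31; rewrite path_pos.
  rewrite -(last_leg _ jm); apply: Or33; exists j, (r - lam ord0); split; first by lra.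
  by rewrite path_pos /leg0 (negPf jm).
apply: Or32; exists e, (lam (par e) - r); split=> //.
  by rewrite path_len //; lra.
by rewrite path_pos (tree_path_edge _ _ par_root par_lt lam_par e0 ie er) tree_slope_base.
Qed.

(** The last end, being attached to the root, is the one that lies below no other vertex. *)
Lemma path_valid_base : valid_base par leg0.
Proof.
split=> // v v0; have mk := E_pos v0.
  have [i iv] := leaf_under v; have ik : (i < k)%N by exact: ltn_trans (ltn_ord i) mk.
  by exists (Ordinal ik); rewrite /leg0 /= ltn_ord inord_val.
by exists (Ordinal mk); rewrite /leg0 /= ltnn not_below_root.
Qed.

End Path.

Lemma log_image_near_tree : exists kappa : R, 0 <= kappa /\
  forall f : curve_data R n k, curve_of_degree f ->
  exists (par0 : 'I_E.+1 -> 'I_E.+1) (leg0 : 'I_k -> 'I_E.+1) (y : 'rV[R]_(n + E)), [/\ valid_base par0 leg0,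
    forall v, v != ord0 -> 0 <= len y ((inl v, false) : dvert E Delta) &
    near_sets kappa ((@Log R n) @` curve_image f) (tree_set (Delta := Delta) par0 leg0 y)].
Proof.
exists (level_error R Delta * weight R m.+1 (fun i => Delta`_i)); split.
  rewrite mulr_ge0 // ?sumr_ge0 // => [|j _]; last exact: sumr_ge0.
  rewrite addr_ge0 ?mulr_ge0 ?ln_ge0 ?ler1n //.
  have : (0 : R) <= 3 * m.+1%:R by rewrite mulr_ge0.
  lra.
move=> f f_deg; have [a [p [a_inj ->]]] := log_curve_image Delta_toric f_deg.
have a_inj' : injective (fun i : 'I_m.+1 => a i).
  by move=> i j aij; exact/val_inj/(a_inj _ _ (ltn_ord i) (ltn_ord j) aij).
have [par [leg [lam tree]]] := approx_tree_exists_all a_inj'.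
have [[par_root par_lt] lam_par below _] := tree.
pose d (i : 'I_m.+1) := Delta`_i.
exists par, (fun i => if (i < m.+1)%N then leg (inord i) else ord0),
  (row_mx (tree_pos par leg lam d p ord0) (\row_e (lam (par (lift ord0 e)) - lam (lift ord0 e)))).
split; first exact: path_valid_base.
  by move=> v v0; rewrite path_len // subr_ge0.
rewrite tree_set_path //; exact: log_factors_near_path.
Qed.

End LogImageNearTree.

(** * Limits along an ultrafilter *)

Section L1Norm.
Variables (R : realType) (n : nat).
Implicit Types x y : 'rV[R]_n.

Definition nrm x : R := \sum_j `|x 0 j|.

Lemma nrm_ge0 x : 0 <= nrm x.
Proof. exact: sumr_ge0. Qed.

Lemma nrm_coord x j : `|x 0 j| <= nrm x.
Proof. by rewrite /nrm (bigD1 j) //= lerDl sumr_ge0. Qed.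

Lemma nrmD x y : nrm (x + y) <= nrm x + nrm y.
Proof. by rewrite /nrm -big_split ler_sum // => j _; rewrite mxE ler_normD. Qed.

Lemma nrmZ s x : nrm (s *: x) = `|s| * nrm x.
Proof. by rewrite /nrm mulr_sumr; apply: eq_bigr => j _; rewrite mxE normrM. Qed.

Lemma nrmN x : nrm (- x) = nrm x.
Proof. by rewrite -scaleN1r nrmZ normrN1 mul1r. Qed.

Lemma nrmB x y : nrm (x - y) = nrm (y - x).
Proof. by rewrite -nrmN opprB. Qed.

Lemma nrm0 : nrm 0 = 0.
Proof. by rewrite /nrm big1 // => j _; rewrite mxE normr0. Qed.

Lemma nrm_eq0 x : (nrm x == 0) = (x == 0).
Proof.
apply/eqP/eqP => [x0|->]; last exact: nrm0.
apply/rowP => j; rewrite mxE; apply/eqP; rewrite -normr_le0 -x0; exact: nrm_coord.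
Qed.

Lemma nrm_le_bound x e : (forall j, `|x 0 j| <= e) -> nrm x <= n%:R * e.
Proof.
move=> xe; apply: (@le_trans _ _ (\sum_(j < n) e)); first exact: ler_sum.
by rewrite sumr_const card_ord -[e *+ _]mulr_natl.
Qed.

Lemma nrm_toR (d : 'rV[int]_n) : d != 0 -> 0 < nrm (toR R d).
Proof.
move=> d0; rewrite lt_neqAle nrm_ge0 andbT eq_sym nrm_eq0; apply: contra_neq d0 => d0.
by apply/rowP => j; move/rowP: d0 => /(_ j); rewrite !mxE => /eqP; rewrite intr_eq0 => /eqP.
Qed.

End L1Norm.

Section AlongUltrafilter.
Variables (R : realType) (U : set_system nat).
Hypothesis UU : UltraFilter U.

Lemma ultra_near (P : nat -> Prop) : (\forall m \near U, P m) \/ (\forall m \near U, ~ P m).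
Proof. exact: (in_ultra_setVsetC (P : set nat) UU). Qed.

Lemma ultra_finite (T : finType) (f : nat -> T) : exists x, \forall m \near U, f m = x.
Proof.
apply: contrapT => no.
have : \forall m \near U, forall x, f m <> x.
  apply: filter_forall => x; have [fx|//] := ultra_near (fun m => f m = x).
  by exfalso; apply: no; exists x.
by move=> /filter_ex[m /(_ (f m))].
Qed.

(** The image of [U] under [u] is an ultrafilter containing a segment, which is compact. *)
Lemma ultra_cvg (u : nat -> R) (C : R) :
  (\forall m \near U, `|u m| <= C) -> exists l : R, u m @[m --> U] --> l.
Proof.
move=> uC; have := @segment_compact R (- C) C; rewrite compact_ultra => cpt.
have UF : UltraFilter (u @ U).
  split=> [|G FG UG]; first exact: fmap_proper_filter.
  apply/seteqP; split=> [A GA|]; last exact: UG.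
  have [//|uA] := in_ultra_setVsetC (u @^-1` A) UU.
  have : G (A `&` ~` A) by apply: filterI => //; exact: UG.
  by rewrite setICr => /filter_ex[].
have [] := cpt (u @ U) UF; last by move=> l [_ ul]; exists l.
by apply: filterS uC => m /=; rewrite in_itv /= ler_norml.
Qed.

Definition escapes (u : nat -> R) : Prop := forall C, \forall m \near U, C < u m.

Lemma cvg_or_escapes (u : nat -> R) : (\forall m \near U, 0 <= u m) ->
  (exists l : R, u m @[m --> U] --> l) \/ escapes u.
Proof.
move=> u_ge0; have [|bad] := pselect (exists C, \forall m \near U, u m <= C).
  move=> [C uC]; left; apply: (ultra_cvg (C := C)).
  by apply: filterS2 u_ge0 uC => m h1 h2; rewrite ger0_norm.
right=> C; have [//|h] := ultra_near (fun m => C < u m).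
exfalso; apply: bad; exists C; apply: filterS h => m h'.
by rewrite leNgt; apply/negP.
Qed.

Lemma cvg_not_escapes (u : nat -> R) (l : R) : u m @[m --> U] --> l -> ~ escapes u.
Proof.
move=> /cvgrPdist_lt/(_ 1 ltr01) ul /(_ (l + 1)) uC.
have [m [/= h1 h2]] := filter_ex (filterI (ul : \forall m \near U, `|l - u m| < 1) uC).
by move: h1; rewrite ltr_norml; lra.
Qed.

Lemma cvg_eps (u : nat -> R) (l e : R) : u m @[m --> U] --> l -> 0 < e ->
  \forall m \near U, `|u m - l| < e.
Proof. by move=> /cvgrPdist_lt ul /ul; apply: filterS => m; rewrite distrC. Qed.

Section Vectors.
Variable n : nat.
Implicit Types (u : nat -> 'rV[R]_n) (q : 'rV[R]_n).

Definition vcvg u q : Prop := forall j, u m 0 j @[m --> U] --> q 0 j.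
Definition bounded u : Prop := exists C, \forall m \near U, nrm (u m) <= C.

Lemma vcvg_eps u q e : vcvg u q -> 0 < e -> \forall m \near U, nrm (u m - q) < e.
Proof.
move=> uq e_gt0.
have e1 : 0 < e / n.+1%:R by rewrite divr_gt0.
have : \forall m \near U, forall j, `|u m 0 j - q 0 j| < e / n.+1%:R.
  by apply: filter_forall => j; exact: cvg_eps.
apply: filterS => m h; apply: (@le_lt_trans _ _ (n%:R * (e / n.+1%:R))).
  by apply: nrm_le_bound => j; rewrite !mxE ltW.
rewrite mulrCA -[ltRHS]mulr1 ltr_pM2l // ltr_pdivrMr // mul1r ltr_nat //.
Qed.

Lemma vcvg_bounded u q : vcvg u q -> bounded u.
Proof.
move=> uq; exists (nrm q + 1); apply: filterS (vcvg_eps uq ltr01) => m h.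
by have := nrmD (u m - q) q; rewrite subrK; lra.
Qed.

Lemma bounded_vcvg u : bounded u -> exists q, vcvg u q.
Proof.
move=> [C uC]; have /choice[l lP] : forall j, exists l : R, u m 0 j @[m --> U] --> l.
  move=> j; apply: (ultra_cvg (C := C)); apply: filterS uC => m.
  by apply: le_trans; exact: nrm_coord.
by exists (\row_j l j) => j; rewrite mxE; exact: lP.
Qed.

Lemma unbounded_near u C : ~ bounded u -> \forall m \near U, C < nrm (u m).
Proof.
move=> nb; have [//|h] := ultra_near (fun m => C < nrm (u m)).
by exfalso; apply: nb; exists C; apply: filterS h => m h'; rewrite leNgt; apply/negP.
Qed.

Lemma vcvg_unique u q q' : vcvg u q -> vcvg u q' -> q = q'.
Proof. by move=> h h'; apply/rowP => j; apply: cvg_unique (h j) (h' j). Qed.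

Lemma vcvg_near u u' q : (\forall m \near U, u m = u' m) -> vcvg u q -> vcvg u' q.
Proof.
move=> uu' uq j; apply: cvg_trans (uq j); apply: near_eq_cvg.
by apply: filterS uu' => m ->.
Qed.

Lemma bounded_near u u' : (\forall m \near U, u m = u' m) -> bounded u -> bounded u'.
Proof. by move=> uu' [C uC]; exists C; apply: filterS2 uu' uC => m <-. Qed.

Lemma boundedD u u' : bounded u -> bounded u' -> bounded (fun m => u m + u' m).
Proof.
move=> [C uC] [C' uC']; exists (C + C'); apply: filterS2 uC uC' => m h h'.
by apply: (le_trans (nrmD _ _)); exact: lerD.
Qed.

Lemma boundedN u : bounded u -> bounded (fun m => - u m).
Proof. by move=> [C uC]; exists C; apply: filterS uC => m; rewrite nrmN. Qed.

Lemma vcvgD u u' q q' : vcvg u q -> vcvg u' q' -> vcvg (fun m => u m + u' m) (q + q').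
Proof.
move=> uq uq' j; rewrite mxE; under eq_fun do rewrite mxE; exact: cvgD (uq j) (uq' j).
Qed.

Lemma vcvgZ (s : nat -> R) (l : R) q : s m @[m --> U] --> l -> vcvg (fun m => s m *: q) (l *: q).
Proof.
by move=> sl j; rewrite mxE; under eq_fun do rewrite mxE; apply: cvgMl; exact: sl.
Qed.

End Vectors.

Section ClosedSystem.
Variables (p : nat) (J : finType) (g : J -> 'cV[R]_p) (z : nat -> 'rV[R]_p).

(* The image of a linear map is closed, and a linear map that is bounded on an
   unbounded sequence has a kernel. *)
Lemma closed_system :
  (forall j, exists w : R, (z m *m g j) 0 0 @[m --> U] --> w) ->
  exists zs : 'rV[R]_p, (forall j, (z m *m g j) 0 0 @[m --> U] --> (zs *m g j) 0 0) /\
    (~ bounded z -> exists2 z' : 'rV[R]_p, z' != 0 & forall j, (z' *m g j) 0 0 = 0).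
Proof.
move=> /choice[w wP].
pose G : 'M[R]_(p, #|J|) := \matrix_(a, j) g (enum_val j) a 0.
have GE y j : (y *m g j) 0 0 = (y *m G) 0 (enum_rank j).
  by rewrite !mxE; apply: eq_bigr => a _; rewrite mxE enum_rankK.
pose W : 'rV[R]_#|J| := \row_j w (enum_val j).
have zW : vcvg (fun m => z m *m G) W.
  move=> j; rewrite mxE; have := wP (enum_val j).
  by under eq_fun do rewrite GE enum_valK.
have lin q (B : 'M[R]_(#|J|, q)) : vcvg (fun m => z m *m G *m B) (W *m B).
  move=> j; rewrite mxE; under eq_fun do rewrite mxE.
  by apply: (cvg_big add_continuous) => a _; apply: cvgMl; exact: zW.
(* The cokernel of [G] annihilates every [z m *m G], hence also their limit [W], which therefore
   lies in the row space of [G]. *)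
have /submxP[zs zsE] : (W <= G)%MS.
  rewrite submxE; apply/eqP; apply: vcvg_unique (lin _ (cokermx G)) _.
  apply: (@vcvg_near _ (fun=> 0)); last by move=> j; exact: cvg_cst.
  by apply: nearW => m; rewrite -mulmxA mulmx_coker mulmx0.
exists zs; split=> [j|nb].
  by rewrite GE -zsE mxE enum_rankK; exact: wP.
have [Gfree|Gker] := boolP (row_free G).
  exfalso; apply: nb; apply: (bounded_near (u := fun m => z m *m G *m pinvmx G)).
    by apply: nearW => m; rewrite -mulmxA mulmxVp // mulmx1.
  exact: vcvg_bounded (lin _ _).
rewrite -kermx_eq0 in Gker.
have [i /rowP ri] : exists i, row i (kermx G) <> 0.
  apply: contrapT => no; case/negP: Gker; apply/eqP/row_matrixP => i.
  by rewrite row0; apply: contrapT => h; apply: no; exists i.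
exists (row i (kermx G)); first by apply/eqP => h; apply: ri; rewrite h.
by move=> j; rewrite GE -row_mul mulmx_ker !mxE.
Qed.

End ClosedSystem.
End AlongUltrafilter.

Lemma cvg_eq (R : realType) (U : set_system nat) (u v : nat -> R) (l : R) :
  (forall m, u m = v m) -> u m @[m --> U] --> l -> v m @[m --> U] --> l.
Proof. by move=> /funext ->. Qed.

Lemma vcvgN (R : realType) (U : set_system nat) (UU : UltraFilter U) (n : nat)
  (u : nat -> 'rV[R]_n) (q : 'rV[R]_n) : vcvg U u q -> vcvg U (fun m => - u m) (- q).
Proof. by move=> uq j; rewrite mxE; under eq_fun do rewrite mxE; exact: cvgN (uq j). Qed.

Lemma ultra_cvg_sum (R : realType) (U : set_system nat) (UU : UltraFilter U) (T : Type) (r : seq T)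
    (P : pred T) (f : T -> nat -> R) (l : T -> R) : (forall x, P x -> f x m @[m --> U] --> l x) ->
  \sum_(x <- r | P x) f x m @[m --> U] --> \sum_(x <- r | P x) l x.
Proof.
move=> fl; elim: r => [|x r IH].
  by rewrite big_nil; under eq_fun do rewrite big_nil; exact: cvg_cst.
rewrite big_cons; under eq_fun do rewrite big_cons.
by case: ifP => // Px; apply: cvgD => //; exact: fl.
Qed.

(** * The limit of a sequence of balanced maps *)

Section Limit.
Variables (R : realType) (n E : nat) (Delta : seq 'rV[int]_n).
Local Notation k := (size Delta).
Local Notation X := (dvert E Delta).
Local Notation B := (bedge E Delta).
Variables (U : set_system nat) (UU : UltraFilter U).
Variables (par0 : 'I_E.+1 -> 'I_E.+1) (leg0 : 'I_k -> 'I_E.+1).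
Local Notation root := (droot E Delta).
Local Notation par := (dpar par0 leg0).
Local Notation rk := (@drk n E Delta).
Local Notation leaf := (@dleaf n E Delta).
Local Notation slope := (dslope par0 leg0).
Local Notation bottom := (bottom_of par0 leg0).
Local Notation bslope := (bslope par0 leg0).
Hypothesis par0_root : par0 ord0 = ord0.
Hypothesis par0_lt : forall v, v != ord0 -> (par0 v < v)%N.
Variable Y : nat -> 'rV[R]_(n + E).
Definition base_pos (m : nat) (v : 'I_E.+1) : 'rV[R]_n := Y m *m base_mx R par0 leg0 v.
Definition base_len (m : nat) (v : 'I_E.+1) : R := len (Y m) ((inl v, false) : X).
Hypothesis base_len_ge0 : forall m v, v != ord0 -> 0 <= base_len m v.

Definition edge_range (m : nat) (x : B) (s : R) : Prop :=
  0 <= s /\ if x is inl v then s <= base_len m v else True.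
Definition edge_point (m : nat) (x : B) (s : R) : 'rV[R]_n :=
  base_pos m (bottom x) + s *: toR R (bslope x).

(** The point of each edge closest to the origin, up to 1, so that an infimum suffices for its
    existence. It stays bounded as soon as some points of the edge do. *)
Definition near_minimal (sm : nat -> B -> R) : Prop :=
  forall m x, x != inl ord0 -> edge_range m x (sm m x) /\
    forall s, edge_range m x s -> nrm (edge_point m x (sm m x)) <= nrm (edge_point m x s) + 1.

Lemma near_minimal_exists : exists sm, near_minimal sm.
Proof.
suff /choice[sm smP] : forall mx : nat * B, exists s, mx.2 != inl ord0 ->
    edge_range mx.1 mx.2 s /\ forall s', edge_range mx.1 mx.2 s' ->
    nrm (edge_point mx.1 mx.2 s) <= nrm (edge_point mx.1 mx.2 s') + 1.
  by exists (fun m x => sm (m, x)) => m x; exact: (smP (m, x)).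
move=> [m x] /=; have [x0|x0] := eqVneq x (inl ord0); first by exists 0.
pose A := [set nrm (edge_point m x s) | s in edge_range m x].
have range0 : edge_range m x 0.
  split=> //; case: x x0 {A} => // v v0; apply: base_len_ge0.
  by apply: contraNneq v0 => ->.
have A_inf : has_inf A.
  split; first by exists (nrm (edge_point m x 0)), 0.
  by exists 0 => _ [s _ <-]; exact: nrm_ge0.
have [_ [s s_in <-] lt_s] := inf_adherent ltr01 A_inf.
exists s => _; split=> // s' s'_in; apply: ltW; apply: (lt_le_trans lt_s).
rewrite lerD2r; apply: ge_inf; first by case: A_inf.
by exists s'.
Qed.

Variable sm : nat -> B -> R.
Hypothesis smP : near_minimal sm.

(* The edges whose middle stays bounded while both ends escape: in the limit
   they contribute a straight line. *)
Definition line_edge : {set B} := [set x | `[< [/\ x != inl ord0,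
  bounded U (fun m => edge_point m x (sm m x)),
  ~ bounded U (fun m => base_pos m (bottom x)) &
  if x is inl v then ~ bounded U (fun m => base_pos m v) else True] >]].

(* Such an edge is subdivided at its near-minimal point; the subdivision point of
   any other edge is at its bottom. *)
Definition split_len (m : nat) (x : B) : R := if x \in line_edge then sm m x else 0.
Definition dpos (m : nat) (x : X) : 'rV[R]_n :=
  match x with
  | (inl v, false) => base_pos m v
  | (z, _) => edge_point m z (split_len m z)
  end.
Definition dlen (m : nat) (x : X) : R :=
  match x with
  | (z, true) => split_len m z
  | (inl v, false) => base_len m v - split_len m (inl v)
  | (inr _, false) => 0
  end.

Lemma dlen_sub m x : dlen m (x, true) = split_len m x.
Proof. by case: x. Qed.

Lemma dpos_sub m x : dpos m (x, true) = edge_point m x (split_len m x).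
Proof. by case: x. Qed.

Lemma false_neq_root (z : B) : (z, false) != root.
Proof. by rewrite xpair_eqE andbF. Qed.

Lemma line_edge_root : inl ord0 \notin line_edge.
Proof. by rewrite inE; apply/asboolP => -[]; rewrite eqxx. Qed.

Lemma base_len0 m : base_len m ord0 = 0.
Proof. by rewrite /base_len /len /len_mx unlift_none mulmx0 mxE. Qed.

Lemma split_len_range m x : edge_range m x (split_len m x).
Proof.
rewrite /split_len; case: ifP => xL.
  have x0 : x != inl ord0 by apply: contraTneq xL => ->; exact: line_edge_root.
  by have [] := smP m x0.
split=> //; case: x {xL} => // v; have [->|v0] := eqVneq v ord0; first by rewrite base_len0.
exact: base_len_ge0.
Qed.

Lemma dlen_ge0 m x : 0 <= dlen m x.
Proof.
case: x => [[v|i] []] //=; try by case: (split_len_range m (inl v)) => // h1 h2; rewrite ?subr_ge0.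
by case: (split_len_range m (inr i)).
Qed.

Lemma base_pos_step m v : base_pos m v =
  base_pos m (par0 v) + base_len m v *: toR R (bslope (inl v)).
Proof.
have [->|v0] := eqVneq v ord0; first by rewrite base_len0 scale0r addr0 par0_root.
exact: base_mx_step.
Qed.

Lemma dpos_step m x : x != root -> ~~ leaf x ->
  dpos m x = dpos m (par x) + dlen m x *: toR R (slope x).
Proof.
case: x => [[v|i] []] xr nlx //; rewrite /dslope /dpar /=.
- have [E1|_] := eqVneq (inl v : B) (inl ord0); first by rewrite E1 eqxx in xr.
  by [].
- by rewrite base_pos_step /edge_point /= -addrA -scalerDl subrKC.
Qed.

Definition cut_set : {set X} := [set x | `[< x != root /\ (leaf x \/ escapes U (fun m => dlen m x)) >]].
Definition zero_set : {set X} := [set x | `[< [/\ x != root, ~~ leaf x &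
  dlen m x @[m --> U] --> (0 : R)] >]].

Lemma leaf_cut_set i : (inr i, false) \in cut_set.
Proof. by rewrite inE; apply/asboolP; split=> //; left. Qed.

Lemma cut_zero x : x \in cut_set -> x \notin zero_set.
Proof.
move=> xI; apply/negP; move: xI; rewrite inE => /asboolP xI; rewrite inE => /asboolP[_ nlx c0].
case: xI => _ [lx|esc].
  by rewrite lx in nlx.
exact: (cvg_not_escapes UU c0 esc).
Qed.

Lemma root_zero_set : (inl ord0, false) \in zero_set.
Proof.
rewrite inE; apply/asboolP; split=> //=; rewrite /split_len (negPf line_edge_root).
by under eq_fun do rewrite base_len0 subrr; exact: cvg_cst.
Qed.

Lemma line_edge_neq0 x : x \in line_edge -> x != inl ord0.
Proof. by rewrite inE => /asboolP[]. Qed.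

(** The middle is bounded and the end towards the root is not, so the displacement
    [sm m x *: toR R (bslope x)] between them is unbounded. *)
Lemma line_edge_escapes x : x \in line_edge ->
  bslope x != 0 /\ escapes U (fun m => sm m x).
Proof.
rewrite inE => /asboolP[x0 [C bC] nb _].
have big c : \forall m \near U, c * nrm (toR R (bslope x)) < `|sm m x| * nrm (toR R (bslope x)).
  apply: filterS2 bC (unbounded_near UU (C + c * nrm (toR R (bslope x))) nb) => m h1 h2.
  have := nrmD (edge_point m x (sm m x)) (- (sm m x *: toR R (bslope x))).
  rewrite /edge_point addrK nrmN nrmZ -/(edge_point m x (sm m x)); lra.
have sl : bslope x != 0.
  apply/eqP => s0; have [m] := filter_ex (big 0).
  by rewrite s0 toR0 nrm0 !mulr0 ltxx.
split=> // c; apply: filterS (big c) => m; rewrite ltr_pM2r ?nrm_toR // ger0_norm //.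
by have [[]] := smP m x0.
Qed.

Lemma sub_zero_cut x : x != inl ord0 -> (x, true) \in zero_set \/
  [/\ (x, true) \in cut_set, (x, false) \in cut_set & bslope x != 0].
Proof.
move=> x0; have [xL|xL] := boolP (x \in line_edge); last first.
  left; rewrite inE; apply/asboolP; split=> //.
    by apply: contra x0 => /eqP [->].
  by apply: (cvg_eq (u := fun=> 0)) => [m|]; [rewrite dlen_sub /split_len (negPf xL)|exact: cvg_cst].
right; have [sl esc] := line_edge_escapes xL; split=> //.
  rewrite inE; apply/asboolP; split; last first.
    by right=> c; apply: filterS (esc c) => m; rewrite dlen_sub /split_len xL.
  by apply: contra x0 => /eqP [->].
case: x x0 xL sl esc => [v|i] x0 xL sl esc; last exact: leaf_cut_set.
rewrite inE; apply/asboolP; split; first exact: false_neq_root.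
right=> c.
have := xL; rewrite inE => /asboolP[_ [C bC] _ nb].
apply: filterS2 bC (unbounded_near UU (C + `|c| * nrm (toR R (bslope (inl v)))) nb) => m h1 h2.
have := nrmD (edge_point m (inl v) (sm m (inl v)))
  ((base_len m v - sm m (inl v)) *: toR R (bslope (inl v))).
rewrite {1}/edge_point -addrA -scalerDl subrKC -base_pos_step nrmZ => h3.
have [[_ s_le] _] := smP m x0; rewrite ger0_norm ?subr_ge0 // in h3.
have h4 : `|c| * nrm (toR R (bslope (inl v))) <
    (base_len m v - sm m (inl v)) * nrm (toR R (bslope (inl v))) by lra.
by rewrite ltr_pM2r ?nrm_toR // in h4; rewrite /= /split_len xL; apply: le_lt_trans h4; exact: ler_norm.
Qed.

Lemma cut_line z : (z, true) \in cut_set -> z \in line_edge.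
Proof.
rewrite inE => /asboolP[_ [//|esc]]; apply: contrapT => /negP zL.
by have [m] := filter_ex (esc 0); rewrite dlen_sub /split_len (negPf zL) ltxx.
Qed.

Lemma not_cut_not_line v : (inl v, false) \notin cut_set -> inl v \notin line_edge.
Proof.
apply: contra => vL; have := sub_zero_cut (line_edge_neq0 vL).
case=> [|[]//]; rewrite inE => /asboolP[_ _ c0]; exfalso.
have [_ esc] := line_edge_escapes vL; apply: (cvg_not_escapes UU c0) => c.
by apply: filterS (esc c) => m; rewrite dlen_sub /split_len vL.
Qed.

Variables (q : X -> 'rV[R]_n) (ell : X -> R).
Hypothesis qP : forall x, bounded U (fun m => dpos m x) -> vcvg U (fun m => dpos m x) (q x).
Hypothesis ellP : forall x, x != root -> x \notin cut_set -> dlen m x @[m --> U] --> ell x.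

Lemma limit_exists : (forall x, exists qx, bounded U (fun m => dpos m x) -> vcvg U (fun m => dpos m x) qx) /\
  (forall x, exists lx : R, x != root -> x \notin cut_set -> dlen m x @[m --> U] --> lx).
Proof.
split=> x.
  have [/(bounded_vcvg UU)[qx qxP]|nb] := pselect (bounded U (fun m => dpos m x)); first by exists qx.
  by exists 0.
have [|[lx lxP]|esc] := cvg_or_escapes UU (u := fun m => dlen m x).
- by apply: nearW => m; exact: dlen_ge0.
- by exists lx.
by exists 0 => xr; rewrite inE => /asboolP nx; exfalso; apply: nx; split=> //; right.
Qed.

(** The linear functions of the parameter that converge: positions of bounded vertices, lengths of
    edges that are not cut, and, for an edge tending to a line, the 2 x 2 minors of position and
    slope. The position on such an edge has no limit at its ends, but the minors do not change along
    the line. *)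
Let J : finType := ('I_E.+1 * 'I_n + ('I_E.+1 + B * 'I_n * 'I_n))%type.
Let g (j : J) : 'cV[R]_(n + E) :=
  match j with
  | inl (v, c) => if `[< bounded U (fun m => base_pos m v) >] then col c (base_mx R par0 leg0 v) else 0
  | inr (inl v) => if (inl v, false) \in cut_set then 0 else len_mx R ((inl v, false) : X)
  | inr (inr (x, c, c')) => if x \in line_edge then
      toR R (bslope x) 0 c' *: col c (base_mx R par0 leg0 (bottom x)) -
      toR R (bslope x) 0 c *: col c' (base_mx R par0 leg0 (bottom x)) else 0
  end.

Let mulcol (y : 'rV[R]_(n + E)) v c :
  (y *m col c (base_mx R par0 leg0 v)) 0 0 = (y *m base_mx R par0 leg0 v) 0 c.
Proof. by rewrite colE mulmxA -colE mxE. Qed.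

Let cross (y : 'rV[R]_(n + E)) x c c' :
  (y *m (toR R (bslope x) 0 c' *: col c (base_mx R par0 leg0 (bottom x)) -
      toR R (bslope x) 0 c *: col c' (base_mx R par0 leg0 (bottom x)))) 0 0 =
  toR R (bslope x) 0 c' * (y *m base_mx R par0 leg0 (bottom x)) 0 c -
  toR R (bslope x) 0 c * (y *m base_mx R par0 leg0 (bottom x)) 0 c'.
Proof.
have subE (P Q : 'M[R]_1) : (P - Q) 0 0 = P 0 0 - Q 0 0 by rewrite !mxE.
have scaleE a (P : 'M[R]_1) : (a *: P) 0 0 = a * P 0 0 by rewrite mxE.
by rewrite mulmxBr -!scalemxAr subE !scaleE !mulcol.
Qed.

Lemma line_dpos_bounded x : x \in line_edge -> bounded U (fun m => dpos m (x, true)).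
Proof.
move=> xL; have := xL; rewrite inE => /asboolP[_ b _ _].
apply: bounded_near b; apply: nearW => m.
by case: x xL => [v|i] xL; rewrite /= /split_len xL.
Qed.

Let g_cvg j : exists w : R, (Y m *m g j) 0 0 @[m --> U] --> w.
Proof.
case: j => [[v c]|[v|[[x c] c']]] /=; case: ifP => h.
- have /qP/(_ c) : bounded U (fun m => dpos m (inl v, false)) by exact/asboolP.
  by move=> hq; exists (q (inl v, false) 0 c); under eq_fun do rewrite mulcol.
- by exists 0; under eq_fun do rewrite mulmx0 mxE; exact: cvg_cst.
- by exists 0; under eq_fun do rewrite mulmx0 mxE; exact: cvg_cst.
- move/negbT in h; have vr := false_neq_root (inl v).
  have vL := not_cut_not_line h.
  exists (ell (inl v, false)); apply: cvg_trans (ellP vr h); apply: near_eq_cvg.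
  by apply: nearW => m; rewrite /= /split_len (negPf vL) subr0.
- have := qP (line_dpos_bounded h) => qx.
  exists (toR R (bslope x) 0 c' * q (x, true) 0 c - toR R (bslope x) 0 c * q (x, true) 0 c').
  have : toR R (bslope x) 0 c' * dpos m (x, true) 0 c -
      toR R (bslope x) 0 c * dpos m (x, true) 0 c' @[m --> U] -->
      toR R (bslope x) 0 c' * q (x, true) 0 c - toR R (bslope x) 0 c * q (x, true) 0 c'.
    by apply: cvgB; apply: cvgMr; exact: qx.
  apply: cvg_trans; apply: near_eq_cvg; apply: nearW => m.
  rewrite cross dpos_sub /edge_point !mxE; ring.
by exists 0; under eq_fun do rewrite mulmx0 mxE; exact: cvg_cst.
Qed.

(** [ys] need not be a limit of [Y]. It is correct on what the limit curves consist of and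
    unconstrained by the rest, such as the lengths of cut edges; lines are met only up to a shift
    [tau] along them. *)
Lemma limit_parameter : exists ys : 'rV[R]_(n + E),
  [/\ forall v, bounded U (fun m => base_pos m v) ->
        ys *m base_mx R par0 leg0 v = q (inl v, false),
      forall v, (inl v, false) \notin cut_set ->
        len ys ((inl v, false) : X) = ell (inl v, false),
      forall x, x \in line_edge -> exists tau,
        pos par0 leg0 ys (x, true) = q (x, true) + tau *: toR R (bslope x) &
      ~ bounded U Y -> exists j, ys 0 j = 0].
Proof.
have [zs [zs_cvg zs_ker]] := closed_system UU g_cvg.
have sol (ys : 'rV[R]_(n + E)) : (forall j, (ys *m g j) 0 0 = (zs *m g j) 0 0) ->
    forall j (w : R), (Y m *m g j) 0 0 @[m --> U] --> w -> (ys *m g j) 0 0 = w.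
  by move=> ysE j w jw; rewrite ysE; apply: cvg_unique (zs_cvg j) jw.
have [ys [ysE ys0]] : exists ys : 'rV[R]_(n + E),
    (forall j, (ys *m g j) 0 0 = (zs *m g j) 0 0) /\ (~ bounded U Y -> exists j, ys 0 j = 0).
  have [b|nb] := pselect (bounded U Y); first by exists zs.
  have [z' z'0 z'ker] := zs_ker nb.
  have [j z'j] : exists j, z' 0 j != 0.
    apply: contrapT => no; case/negP: z'0; apply/eqP/rowP => j; rewrite mxE.
    by apply/eqP; rewrite -[_ == _]negbK; apply/negP => h; apply: no; exists j.
  exists (zs - (zs 0 j / z' 0 j) *: z'); split=> [i|_].
    have subE (P Q : 'M[R]_1) : (P - Q) 0 0 = P 0 0 - Q 0 0 by rewrite !mxE.
    have scaleE a (P : 'M[R]_1) : (a *: P) 0 0 = a * P 0 0 by rewrite mxE.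
    by rewrite mulmxBl -scalemxAl subE scaleE z'ker mulr0 subr0.
  by exists j; rewrite !mxE divfK // subrr.
have {}sol := sol ys ysE; exists ys; split=> //.
- move=> v b; apply/rowP => c; have gE : g (inl (v, c)) = col c (base_mx R par0 leg0 v).
    by rewrite /g; case: asboolP.
  rewrite -mulcol -gE; apply: sol; rewrite gE.
  have bq : bounded U (fun m => dpos m (inl v, false)) by exact: b.
  apply: (cvg_eq (u := fun m => dpos m (inl v, false) 0 c)) => [m|]; first by rewrite mulcol.
  by have h := qP bq; have h' := h c.
- move=> v h; have gE : g (inr (inl v)) = len_mx R ((inl v, false) : X).
    by rewrite /g (negPf h).
  rewrite /len -gE; apply: sol; rewrite gE.
  have vr := false_neq_root (inl v).
  apply: cvg_trans (ellP vr h); apply: near_eq_cvg; apply: nearW => m.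
  by rewrite /= /split_len (negPf (not_cut_not_line h)) subr0.
move=> x xL; have [sl _] := line_edge_escapes xL.
have crossE c c' : toR R (bslope x) 0 c' * (ys *m base_mx R par0 leg0 (bottom x)) 0 c -
    toR R (bslope x) 0 c * (ys *m base_mx R par0 leg0 (bottom x)) 0 c' =
    toR R (bslope x) 0 c' * q (x, true) 0 c - toR R (bslope x) 0 c * q (x, true) 0 c'.
  rewrite -cross; have gE : g (inr (inr (x, c, c'))) = toR R (bslope x) 0 c' *: col c (base_mx R par0 leg0 (bottom x)) -
      toR R (bslope x) 0 c *: col c' (base_mx R par0 leg0 (bottom x)) by rewrite /g xL.
  rewrite -gE; apply: sol; rewrite gE.
  have qx := qP (line_dpos_bounded xL).
  have : toR R (bslope x) 0 c' * dpos m (x, true) 0 c -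
      toR R (bslope x) 0 c * dpos m (x, true) 0 c' @[m --> U] -->
      toR R (bslope x) 0 c' * q (x, true) 0 c - toR R (bslope x) 0 c * q (x, true) 0 c'.
    by apply: cvgB; apply: cvgMr; exact: qx.
  apply: cvg_trans; apply: near_eq_cvg; apply: nearW => m.
  rewrite cross dpos_sub /edge_point !mxE; ring.
have [c slc] : exists c, toR R (bslope x) 0 c != 0.
  apply: contrapT => no; have := nrm_toR R sl; rewrite /nrm big1 ?ltxx // => c _.
  by apply/eqP; rewrite normr_eq0 -[_ == _]negbK; apply/negP => h; apply: no; exists c.
have posE : pos par0 leg0 ys (x, true) = ys *m base_mx R par0 leg0 (bottom x).
  by rewrite /pos /=; case: (x).
rewrite posE; set P := ys *m _ in crossE *.
(* Equality of the minors says that [P - q (x, true)] is parallel to the slope; the factor is read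
   off in a coordinate [c] where the slope is nonzero. *)
exists ((P 0 c - q (x, true) 0 c) / toR R (bslope x) 0 c); apply/rowP => c'.
rewrite [RHS]mxE [X in _ + X]mxE; have := crossE c c'.
set sc := toR R _ 0 c in slc *; set sc' := toR R _ 0 c' => h.
apply: (mulfI slc); rewrite mulrDr [sc * (_ / sc * _)]mulrA mulrCA divff // mulr1; lra.
Qed.

Local Notation I := cut_set.
Local Notation Z := zero_set.
Local Notation cut := (cut I).
Local Notation bnd x := (bounded U (fun m => dpos m x)).

Let pr := dpar_root par0 leg0.
Let prk := @dpar_rank _ _ _ par0 leg0 par0_lt.
Let pnl := @dpar_nonleaf _ _ _ par0 leg0.
Let rnl : ~~ leaf root := isT.
Let IZ := cut_zero.
Let leaf_I := leaf_cut_set.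

(* The limits of bounded vertices, of edges whose length converges, and of edges
   that escape at their far or at their near end. *)
Definition limit_set : set 'rV[R]_n := [set p |
  [\/ exists z, [/\ ~~ leaf z, bnd z & p = q z],
      exists x s, [/\ [/\ x != root, x \notin Z, x \notin I & bnd (par x)],
        0 <= s <= ell x & p = q (par x) + s *: toR R (slope x)],
      exists x s, [/\ x != root, x \in I, bnd (par x), 0 <= s &
        p = q (par x) + s *: toR R (slope x)] |
      exists x s, [/\ x != root, x \in I /\ ~~ leaf x, bnd x, 0 <= s &
        p = q x - s *: toR R (slope x)]]].

Lemma not_cut_nonleaf x : x \notin I -> ~~ leaf x.
Proof.
apply: contra => lx; have [i ->] := leafP lx; exact: leaf_I.
Qed.

Lemma not_cut x : ~~ cut x -> x != root /\ x \notin I.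
Proof. by rewrite negb_or => /andP. Qed.

Lemma dlen_vcvg x : x != root -> x \notin I ->
  vcvg U (fun m => dlen m x *: toR R (slope x)) (ell x *: toR R (slope x)).
Proof. by move=> xr xI; apply: vcvgZ; exact: ellP. Qed.

Lemma bnd_par x : x != root -> x \notin I -> bnd x <-> bnd (par x).
Proof.
move=> xr xI; have b := vcvg_bounded UU (dlen_vcvg xr xI).
have st m := dpos_step m xr (not_cut_nonleaf xI).
split=> h.
  apply: bounded_near (boundedD UU h (boundedN UU b)).
  by apply: nearW => m; rewrite st addrK.
apply: bounded_near (boundedD UU h b).
by apply: nearW => m; rewrite st.
Qed.

Lemma bnd_top z : bnd z <-> bnd (top par rk cut z).
Proof.
apply: (@top_ind _ root _ _ prk cut (cut_root I) (fun z t => bnd z <-> bnd t)) => //.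
move=> x /not_cut[xr xI] <-; exact: bnd_par.
Qed.

Lemma ell_ge0 x : x != root -> x \notin I -> 0 <= ell x.
Proof.
move=> xr xI; rewrite leNgt; apply/negP => l0.
have l1 : 0 < - ell x by lra.
have [m] := filter_ex (cvg_eps UU (ellP xr xI) l1).
have := dlen_ge0 m x; rewrite ltr_norml; lra.
Qed.

Lemma ell_zero x : x \in Z -> ell x = 0.
Proof.
move=> xZ; have xI : x \notin I by apply/negP => /IZ; rewrite xZ.
move: xZ; rewrite inE => /asboolP[xr _ c0].
exact: cvg_unique (ellP xr xI) c0.
Qed.

Lemma ell_gt0 x : x != root -> x \notin Z -> x \notin I -> 0 < ell x.
Proof.
move=> xr xZ xI; rewrite lt_neqAle ell_ge0 // andbT eq_sym.
apply: contra xZ => /eqP l0; rewrite inE; apply/asboolP; split=> //.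
  exact: not_cut_nonleaf.
by rewrite -l0; exact: ellP.
Qed.

Lemma kept_edge x : x != root -> x \notin Z -> x \notin I -> exists v, x = (inl v, false).
Proof.
case: x => [[v|i] []] xr xZ xI; last 1 first.
- by rewrite leaf_I in xI.
- exfalso; have v0 : (inl v : B) != inl ord0 by apply: contra xr => /eqP ->.
  by case: (sub_zero_cut v0) => [h|[h _ _]]; [rewrite h in xZ|rewrite h in xI].
- by exists v.
exfalso; case: (sub_zero_cut (isT : (inr i : B) != inl ord0)) => [h|[h _ _]].
  by rewrite h in xZ.
by rewrite h in xI.
Qed.

Lemma line_edge_cut w : w \in line_edge -> (w, true) \in I /\ (w, false) \in I.
Proof.
move=> wL; have [|[]//] := sub_zero_cut (line_edge_neq0 wL).
rewrite inE => /asboolP[_ _ c0]; exfalso; have [_ esc] := line_edge_escapes wL.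
by apply: (cvg_not_escapes UU c0) => c; apply: filterS (esc c) => m; rewrite dlen_sub /split_len wL.
Qed.

Section Curves.
Variables (p : nat) (A : 'M[R]_(p, n + E)) (y : 'rV[R]_p) (ys : 'rV[R]_(n + E)).
Hypothesis yA : y *m A = ys.
Hypothesis ys_pos : forall v, bounded U (fun m => base_pos m v) ->
  ys *m base_mx R par0 leg0 v = q (inl v, false).
Hypothesis ys_len : forall v, (inl v, false) \notin I ->
  len ys ((inl v, false) : X) = ell (inl v, false).
Hypothesis ys_line : forall x, x \in line_edge -> exists tau,
  pos par0 leg0 ys (x, true) = q (x, true) + tau *: toR R (bslope x).

Lemma ys_contracted : contracted_lengths Z (y *m A).
Proof.
rewrite yA => -[[v|i] []] xZ; rewrite /len; try by rewrite /= mulmx0 mxE.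
by rewrite -/(len _ _) ys_len ?ell_zero //; apply/negP => /IZ; rewrite xZ.
Qed.

Lemma ys_positive : positive_lengths Z I (y *m A).
Proof.
rewrite yA => x xr xZ xI; have [v xE] := kept_edge xr xZ xI; subst x.
by rewrite ys_len // ell_gt0.
Qed.

Definition is_line (z : X) : bool := z.2 && (z.1 \in line_edge).

Lemma ys_q z : ~~ leaf z -> bnd z -> ~~ is_line z -> pos par0 leg0 (y *m A) z = q z.
Proof.
rewrite yA; have sub w : bnd (w, true) -> w \notin line_edge ->
    ys *m base_mx R par0 leg0 (bottom w) = q (w, true).
  move=> b wL; have E1 m : dpos m (w, true) = base_pos m (bottom w).
    by rewrite dpos_sub /edge_point /split_len (negPf wL) scale0r addr0.
  have b' : bounded U (fun m => base_pos m (bottom w)).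
    by apply: bounded_near b; apply: nearW => m; exact: E1.
  rewrite ys_pos //; have bb : bnd (inl (bottom w), false) by exact: b'.
  apply: (vcvg_unique UU (qP bb)); apply: (vcvg_near UU) (qP b).
  by apply: nearW => m; exact: E1.
case: z => [[v|i] []] nlz b nl //=; last exact: sub.
- exact: sub.
- exact: ys_pos.
Qed.

Local Notation img c := (trop_image (hcurve par0 leg0 Z I A c y)).
Definition active (c : X) : Prop := [/\ cut c, ~~ leaf c & bnd c].

(** The component of the middle of such an edge has two legs in opposite directions, one along each
    half of the edge, so its image contains the whole line and the shift [tau] does no harm. *)
Lemma line_image w s : w \in line_edge ->
  img (w, true) (q (w, true) + s *: toR R (bslope w)).
Proof.
move=> wL; have [tau posE] := ys_line wL; have [cI fI] := line_edge_cut wL.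
have cc : cut (w, true) by apply/orP; right.
have wr : (w, true) != root.
  by apply/eqP => -[w0]; have := line_edge_neq0 wL; rewrite w0 eqxx.
have -> : q (w, true) + s *: toR R (bslope w) =
    pos par0 leg0 (y *m A) (w, true) + (s - tau) *: toR R (bslope w).
  by rewrite yA posE scalerBl addrACA subrr addr0 addrC.
have [st|ts] := leP 0 (s - tau).
  apply: (image_leg par0_root par0_lt IZ ys_contracted cc isT (false_neq_root w) fI) st.
  exact: top_id.
rewrite -[s - tau]opprK scaleNr; apply: image_up => //.
by rewrite oppr_ge0 ltW.
Qed.

(** Both halves of the edge are cut, so its middle is alone in its component. *)
Lemma line_component w z : w \in line_edge -> top par rk cut z = (w, true) -> z = (w, true).
Proof.
move=> wL; have [_ fI] := line_edge_cut wL.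
apply: (@top_ind _ root _ _ prk cut (cut_root I) (fun z t => t = (w, true) -> z = (w, true))) => //.
move=> [x []] /not_cut[xr xI] IH /IH.
  by rewrite /dpar /=; case: ifP => // /eqP x0; rewrite x0 eqxx in xr.
by rewrite /dpar /= => -[xw]; rewrite xw fI in xI.
Qed.

Lemma is_line_top z : is_line z -> top par rk cut z = z.
Proof.
case: z => [w b] /andP[/= bt wL]; have [cI _] := line_edge_cut wL.
by apply: top_id; apply/orP; right; case: b bt.
Qed.

(** Each piece of the limit belongs to the component of the vertex it starts from, found by [top].
    Components of lines are treated apart, since [ys] gives their position only up to a shift. *)
Lemma limit_set_images : limit_set = [set r | exists c, active c /\ img c r].
Proof.
have cutI x : x \in I -> cut x by move=> xI; apply/orP; right.
have act z : ~~ leaf z -> bnd z -> active (top par rk cut z).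
  move=> nlz bz; split; first exact: (topP prk (cut_root I)).
    exact: (top_nonleaf prk (cut_root I) pnl).
  by case: (bnd_top z) => h _; exact: h.
have act_cut c : active c -> cut c /\ ~~ leaf c by case.
apply/seteqP; split=> [r|r [c [ac]]].
  case=> [[z [nlz bz ->]]|[x [s [[xr xZ xI bx] s_in ->]]]|[x [s [xr xI bx s_ge0 ->]]]|
      [x [s [xr [xI nlx] bx s_ge0 ->]]]].
  - exists (top par rk cut z); have az := act _ nlz bz; split=> //; have [cc nlc] := act_cut _ az.
    have [lz|nlz'] := boolP (is_line z).
      rewrite (is_line_top lz); case: z lz {nlz bz az cc nlc} => [w b] /andP[/= bt wL].
      by case: b bt => // _; have := line_image 0 wL; rewrite scale0r addr0.
    rewrite -ys_q //; exact: (image_vertex par0_root par0_lt IZ ys_contracted cc nlc nlz).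
  - have nc : ~~ cut x by rewrite negb_or xr.
    have nlp := pnl xr; exists (top par rk cut (par x)); have az := act _ nlp bx.
    split=> //; have [cc nlc] := act_cut _ az.
    have npl : ~~ is_line (par x).
      have [v xE] := kept_edge xr xZ xI; rewrite xE /is_line /=.
      apply/negP => vL; have [_ fI] := line_edge_cut vL; by rewrite xE fI in xI.
    rewrite -ys_q //; apply: (image_edge par0_root par0_lt leaf_I IZ ys_contracted cc nlc) => //.
      by rewrite (top_par prk (cut_root I) nc).
    have [v xE] := kept_edge xr xZ xI; subst x.
    by rewrite yA ys_len.
  - have nlp := pnl xr; exists (top par rk cut (par x)); have az := act _ nlp bx.
    split=> //; have [cc nlc] := act_cut _ az.
    have [lp|nlp'] := boolP (is_line (par x)).
      rewrite (is_line_top lp); case: x xr xI {bx nlp az cc nlc} lp => [w []] xr xI /andP[/=].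
        by rewrite /dpar /=; case: ifP => // /eqP w0; rewrite w0 eqxx in xr.
      by move=> _ wL; exact: line_image.
    rewrite -ys_q //; exact: (image_leg par0_root par0_lt IZ ys_contracted cc nlc xr xI erefl s_ge0).
  have cx := cutI _ xI; exists x; split; first by split.
  case: x xr xI nlx bx cx => [w []] xr xI nlx bx cx.
    have wL := cut_line xI.
    by rewrite -scaleNr; exact: line_image.
  by rewrite -ys_q //; exact: image_up.
have [cc nlc] := act_cut _ ac; have bc : bnd c by case: ac.
have [lc|nlc'] := boolP (is_line c).
  case: c lc ac cc nlc bc => [w b] /andP[/= bt wL]; case: b bt => // _ ac cc nlc bc.
  have [cI fI] := line_edge_cut wL; have [tau posE] := ys_line wL.
  have wr : (w, true) != root.
    by apply/eqP => -[w0]; have := line_edge_neq0 wL; rewrite w0 eqxx.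
  have onl s : limit_set (q (w, true) + s *: toR R (bslope w)).
    have [s_ge0|s_lt0] := leP 0 s.
      by apply: Or43; exists (w, false), s; rewrite false_neq_root.
    apply: Or44; exists (w, true), (- s); split=> //; first by rewrite oppr_ge0 ltW.
    by rewrite scaleNr opprK.
  have onp s : limit_set (pos par0 leg0 ys (w, true) + s *: toR R (bslope w)).
    by rewrite posE -addrA -scalerDl; exact: onl.
  move=> /(image_inv par0_root par0_lt IZ ys_contracted cc nlc); rewrite yA.
  case=> [[z [_ zc ->]]|[x [s [[xr xZ xI xc] _ _]]]|[x [s [xr xI xc s_ge0 ->]]]|[s [_ s_ge0 ->]]].
  - by rewrite (line_component wL zc); have := onp 0; rewrite scale0r addr0.
  - by have xE := line_component wL xc; rewrite xE cI in xI.
  - have := line_component wL xc; case: x xr xI xc => [x []] xr xI xc; rewrite /dpar /=.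
      by case: ifP => // /eqP x0; rewrite x0 eqxx in xr.
    by case=> ->; exact: onp.
  by rewrite -scaleNr; exact: onp.
have in_c z : top par rk cut z = c -> bnd z by move=> zc; case: (bnd_top z) => _ h; apply: h; rewrite zc.
have nline z : top par rk cut z = c -> ~~ is_line z.
  by move=> zc; apply: contra nlc' => lz; rewrite -zc is_line_top.
have pos_q z : ~~ leaf z -> top par rk cut z = c -> pos par0 leg0 (y *m A) z = q z.
  by move=> nlz zc; apply: ys_q => //; [exact: in_c|exact: nline].
move=> /(image_inv par0_root par0_lt IZ ys_contracted cc nlc).
case=> [[z [nlz zc ->]]|[x [s [[xr xZ xI xc] s_in ->]]]|[x [s [xr xI xc s_ge0 ->]]]|[s [cr s_ge0 ->]]].
- by apply: Or41; exists z; split=> //; [exact: in_c|exact: pos_q].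
- have nc : ~~ cut x by rewrite negb_or xr.
  have pc : top par rk cut (par x) = c by rewrite -(top_par prk (cut_root I) nc).
  apply: Or42; exists x, s; split; first by split=> //; exact: in_c.
    have [v xE] := kept_edge xr xZ xI; subst x.
    by rewrite yA ys_len in s_in.
  by rewrite pos_q // pnl.
- by apply: Or43; exists x, s; split=> //; [exact: in_c|rewrite pos_q // pnl].
apply: Or44; exists c, s; split=> //; last by rewrite ys_q.
by split=> //; move: cc => /orP[/eqP E1|//]; rewrite E1 eqxx in cr.
Qed.

End Curves.

Hypothesis U_fine : forall N, \forall m \near U, (N <= m)%N.
Local Notation tree m := (tree_set par0 leg0 (Y m)).

Lemma tree_set_edge m r : tree m r <-> r = base_pos m ord0 \/
  exists b s, [/\ b != inl ord0, edge_range m b s & r = edge_point m b s].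
Proof.
split=> [[->|[v [s [v0 /andP[s_ge s_le] ->]]]|[i [s [s_ge ->]]]]|[->|[[v|i] [s [b0 [s_ge s_le] ->]]]]].
- by left.
- right; exists (inl v), s; split=> //.
- by right; exists (inr i), s; split=> //.
- exact: Or31.
- by apply: Or32; exists v, s; rewrite s_ge; split=> //.
by apply: Or33; exists i, s.
Qed.

(** Rays are closed. The case [x = 0] is separate because [d] may then escape; [l = 0] serves. *)
Lemma ray_limit (d : nat -> R) (x : 'rV[int]_n) :
  (\forall m \near U, 0 <= d m) -> bounded U (fun m => d m *: toR R x) ->
  exists2 l, 0 <= l & vcvg U (fun m => d m *: toR R x) (l *: toR R x).
Proof.
move=> d_ge0 b; have [->|x0] := eqVneq x 0.
  by exists 0 => // j; rewrite toR0; under eq_fun do rewrite scaler0; rewrite scaler0; exact: cvg_cst.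
have [[l dl]|esc] := cvg_or_escapes UU d_ge0.
  exists l; last exact: vcvgZ.
  rewrite leNgt; apply/negP => l0; have l1 : 0 < - l by lra.
  have [m [/= h1 h2]] := filter_ex (filterI d_ge0 (cvg_eps UU dl l1)).
  move: h2; rewrite ltr_norml; lra.
case: b => C bC; exfalso; have x_gt0 := nrm_toR R x0.
have [m [/= h1 h2]] := filter_ex (filterI bC (esc (`|C| / nrm (toR R x)))).
move: h1; rewrite nrmZ => h1; rewrite ltr_pdivrMr // in h2.
have := ler_norm C; have := ler_norm (d m); nra.
Qed.

Lemma line_limit (d : nat -> R) (x : 'rV[int]_n) : bounded U (fun m => d m *: toR R x) ->
  exists l, vcvg U (fun m => d m *: toR R x) (l *: toR R x).
Proof.
move=> b; have [d_ge0|d_lt0] := ultra_near UU (fun m => 0 <= d m).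
  by have [l _ h] := ray_limit d_ge0 b; exists l.
have [||l _ h] := @ray_limit (fun m => - d m) x.
- by apply: filterS d_lt0 => m /negP; rewrite -ltNge oppr_ge0; exact: ltW.
- by apply: bounded_near (boundedN UU b); apply: nearW => m; rewrite scaleNr.
exists (- l); rewrite scaleNr; apply: (vcvg_near UU) (vcvgN UU h); apply: nearW => m.
by rewrite scaleNr opprK.
Qed.

(** If the edge tends to a line, [r] lies on a ray from its middle. If its root end is bounded, [r]
    lies on a segment or ray from there. Otherwise its near-minimal point is bounded, as [r] is
    approached; since the edge does not tend to a line, the far end must be bounded, and [r] lies on
    a ray from that end. *)
Lemma edge_limit b (s : nat -> R) r : b != inl ord0 ->
  (\forall m \near U, edge_range m b (s m)) ->
  vcvg U (fun m => edge_point m b (s m)) r -> limit_set r.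
Proof.
move=> b0 rs vr; have br := vcvg_bounded UU vr.
have spl x m t : edge_point m x t =
    dpos m (x, true) + (t - split_len m x) *: toR R (bslope x).
  by rewrite dpos_sub /edge_point -addrA -scalerDl subrKC.
have diffb (u : X) (v : nat -> 'rV[R]_n) : bnd u -> (forall m, edge_point m b (s m) = dpos m u + v m) ->
    bounded U v.
  move=> bu E1; apply: bounded_near (boundedD UU br (boundedN UU bu)).
  by apply: nearW => m; rewrite E1 addrAC subrr add0r.
have lim (u : X) (v : nat -> 'rV[R]_n) l : bnd u -> (forall m, edge_point m b (s m) = dpos m u + v m) ->
    vcvg U v l -> r = q u + l.
  move=> bu E1 vl; apply: (vcvg_unique UU vr).
  by apply: (vcvg_near UU) (vcvgD UU (qP bu) vl); apply: nearW => m.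
have [bL|bL] := boolP (b \in line_edge).
  have [tI fI] := line_edge_cut bL.
  have bb := line_dpos_bounded bL.
  have E1 m := spl b m (s m).
  have [l vl] := line_limit (diffb _ _ bb E1).
  have rE := lim _ _ _ bb E1 vl.
  have tr : (b, true) != root by apply: contra b0 => /eqP[->].
  have [l0|l0] := leP 0 l.
    by apply: Or43; exists (b, false), l; split=> //; exact: false_neq_root.
  apply: Or44; exists (b, true), (- l); split=> //.
    by rewrite oppr_ge0 ltW.
  by rewrite scaleNr opprK.
have spl0 m : split_len m b = 0 by rewrite /split_len (negPf bL).
have dE m : dpos m (b, true) = base_pos m (bottom b).
  by rewrite dpos_sub /edge_point spl0 scale0r addr0.
have s_ge0 : \forall m \near U, 0 <= s m by apply: filterS rs => m [].
have [bb|nb] := pselect (bounded U (fun m => base_pos m (bottom b))).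
  have bt : bnd (b, true) by apply: bounded_near bb; apply: nearW => m; rewrite dE.
  have E1 m : edge_point m b (s m) = dpos m (b, true) + s m *: toR R (bslope b).
    by rewrite dE.
  have [fI|fI] := boolP ((b, false) \in I).
    have [l l0 vl] := ray_limit s_ge0 (diffb _ _ bt E1).
    apply: Or43; exists (b, false), l; split=> //; first exact: false_neq_root.
    exact: lim E1 vl.
  case: b b0 rs vr br spl diffb lim bL spl0 dE bb bt E1 fI =>
      [v|i] b0 rs vr br spl diffb lim bL spl0 dE bb bt E1 fI; last by rewrite leaf_I in fI.
  have vr0 : ((inl v, false) : X) != root := false_neq_root _.
  have cl := ellP vr0 fI.
  have s_le : \forall m \near U, s m <= dlen m (inl v, false).
    by apply: filterS rs => m []; rewrite /= spl0 subr0.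
  have [C s_C] : exists C, \forall m \near U, `|s m| <= C.
    exists (ell (inl v, false) + 1).
    apply: filterS3 s_ge0 s_le (cvg_eps UU cl ltr01) => m h1 h2 h3.
    by rewrite ger0_norm //; move: h3; rewrite ltr_norml; lra.
  have [l sl] := ultra_cvg UU s_C.
  have rE := lim _ _ _ bt E1 (vcvgZ _ sl).
  have l0 : 0 <= l by apply: (ler_cvg_to (cvg_cst 0) sl).
  have lE : l <= ell (inl v, false) by apply: ler_cvg_to sl cl s_le.
  have [vZ|vZ] := boolP ((inl v, false) \in Z).
    have l00 : l = 0.
      by apply/le_anti; rewrite l0 andbT -(ell_zero vZ).
    apply: Or41; exists (inl v, true); split=> //.
    by rewrite rE l00 scale0r addr0.
  by apply: Or42; exists (inl v, false), l; split; [split|rewrite l0 lE|exact: rE].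
have mb : bounded U (fun m => edge_point m b (sm m b)).
  case: br => C bC; exists (C + 1); apply: filterS2 rs bC => m h1 h2.
  have [_ h3] := smP m b0; have := h3 _ h1; lra.
move: bL; rewrite inE => /asboolP bL.
case: b b0 rs vr br spl diffb lim bL spl0 dE nb mb =>
      [v|i] b0 rs vr br spl diffb lim bL spl0 dE nb mb; last by exfalso; apply: bL.
have bv : bnd (inl v, false) by apply: contrapT => bv; apply: bL; split.
have vr0 : ((inl v, false) : X) != root := false_neq_root _.
have fI : (inl v, false) \in I.
  apply/negPn/negP => fI; apply: nb; have [h _] := bnd_par vr0 fI.
  have := h bv; apply: bounded_near; apply: nearW => m; exact: dE.
have d_ge0 : \forall m \near U, 0 <= base_len m v - s m by apply: filterS rs => m [_ h]; rewrite subr_ge0.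
have E1 m : edge_point m (inl v) (s m) = dpos m (inl v, false) + - ((base_len m v - s m) *: toR R (bslope (inl v))).
  rewrite /= (base_pos_step) /edge_point -addrA -scaleNr -scalerDl.
  by rewrite opprB subrKC.
have [l l0 vl] : exists2 l, 0 <= l & vcvg U (fun m => (base_len m v - s m) *: toR R (bslope (inl v))) (l *: toR R (bslope (inl v))).
  apply: ray_limit => //; apply: bounded_near (boundedN UU (diffb _ _ bv E1)).
  by apply: nearW => m; rewrite opprK.
apply: Or44; exists (inl v, false), l; split=> //.
exact: lim bv E1 (vcvgN UU vl).
Qed.

Lemma dpos_tree m x : ~~ leaf x -> tree m (dpos m x).
Proof.
have base v : tree m (base_pos m v).
  apply/tree_set_edge; have [->|v0] := eqVneq v ord0; first by left.
  right; exists (inl v), (base_len m v); split.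
  - by apply: contra v0 => /eqP[->].
  - by split=> //; exact: base_len_ge0.
  by rewrite (base_pos_step).
case: x => [b []] nlx; last by case: b nlx => //= v _; exact: base.
rewrite dpos_sub; have [->|b0] := eqVneq b (inl ord0).
  rewrite /split_len (negPf line_edge_root) /edge_point scale0r addr0; exact: base.
apply/tree_set_edge; right; exists b, (split_len m b); split=> //.
exact: split_len_range.
Qed.

(** There are finitely many edges, so one of them contains [x m] for [U]-almost all [m], unless
    [x m] is the root. *)
Lemma tree_limit (x : nat -> 'rV[R]_n) r :
  (\forall m \near U, tree m (x m)) -> vcvg U x r -> limit_set r.
Proof.
move=> xT xr; have [x0|nx0] := ultra_near UU (fun m => x m = base_pos m ord0).
  have c : vcvg U (fun m => dpos m (inl ord0, false)) r by exact: (vcvg_near UU) x0 xr.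
  have b := vcvg_bounded UU c.
  by apply: Or41; exists (inl ord0, false); split=> //; exact: (vcvg_unique UU c (qP b)).
have /choice[bs bsP] : forall m, exists bs : B * R, tree m (x m) -> x m <> base_pos m ord0 ->
    [/\ bs.1 != inl ord0, edge_range m bs.1 bs.2 & x m = edge_point m bs.1 bs.2].
  move=> m; have [/tree_set_edge[h|[b [s h]]]|h] := pselect (tree m (x m)).
  - by exists (inl ord0, 0).
  - by exists (b, s).
  - by exists (inl ord0, 0) => /h.
have [b bE] := ultra_finite UU (fun m => (bs m).1).
have all : \forall m \near U, [/\ b != inl ord0, edge_range m b (bs m).2 & x m = edge_point m b (bs m).2].
  apply: filterS3 xT nx0 bE => m h1 h2 <-; exact: bsP.
have [m0 [b0 _ _]] := filter_ex all.
apply: (edge_limit (b := b) (s := fun m => (bs m).2)) => //.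
  by apply: filterS all => m [].
by apply: (vcvg_near UU) xr; apply: filterS all => m [].
Qed.

(** A point with parameter [s] from a bounded vertex is approached by points with the same parameter
    from that vertex. They exist for [U]-almost all [m] if the edge escapes; on an edge of
    converging length, [s] is capped by the length. *)
Lemma limit_tree r : limit_set r ->
  exists2 x : nat -> 'rV[R]_n, \forall m \near U, tree m (x m) & vcvg U x r.
Proof.
have edge b (s : nat -> R) (u : X) (d : nat -> R) (l : R) : b != inl ord0 -> bnd u ->
    (\forall m \near U, edge_range m b (s m)) ->
    (\forall m \near U, edge_point m b (s m) = dpos m u + d m *: toR R (bslope b)) ->
    d m @[m --> U] --> l ->
  exists2 x : nat -> 'rV[R]_n, \forall m \near U, tree m (x m) & vcvg U x (q u + l *: toR R (bslope b)).
  move=> b0 bu rs E1 dl; exists (fun m => edge_point m b (s m)).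
    by apply: filterS rs => m h; apply/tree_set_edge; right; exists b, (s m).
  apply: (vcvg_near UU) (vcvgD UU (qP bu) (vcvgZ _ dl)).
  by apply: filterS E1 => m ->.
have spl m b s : edge_point m b s = dpos m (b, true) + (s - split_len m b) *: toR R (bslope b).
  by rewrite dpos_sub /edge_point -addrA -scalerDl subrKC.
case=> [[z [nlz bz ->]]|[x [s [[xr xZ xI bx] /andP[s_ge0 s_le] ->]]]|[x [s [xr xI bx s_ge0 ->]]]|
      [x [s [xr [xI nlx] bx s_ge0 ->]]]].
- exists (fun m => dpos m z); last exact: qP.
  by apply: nearW => m; exact: dpos_tree.
- have [v xE] := kept_edge xr xZ xI; subst x.
  have v0 : v != ord0.
    by apply: contraNneq xZ => ->; exact: root_zero_set.
  have vL := not_cut_not_line xI.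
  have s0 m : split_len m (inl v) = 0 by rewrite /split_len (negPf vL).
  have lP := ellP xr xI.
  have b0 : (inl v : B) != inl ord0 by apply: contra v0 => /eqP[->].
  apply: (edge (inl v) (fun m => Num.min s (base_len m v)) (inl v, true) (fun m => Num.min s (base_len m v))) => //.
  + apply: nearW => m; split; last by rewrite ge_min lexx orbT.
    by rewrite le_min s_ge0 base_len_ge0.
  + by apply: nearW => m; rewrite spl s0 subr0.
  + apply: (cvg_eq (u := fun m => Num.min s (dlen m (inl v, false)))) => [m|]; first by rewrite /= s0 subr0.
    apply/cvgrPdist_lt => e e_gt0; apply: filterS (cvg_eps UU lP e_gt0) => m.
    by rewrite ltr_norml minEle; case: ifP => [_|/negbT]; rewrite ?subrr ?normr0 // -ltNge ltr_norml; lra.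
- have esc b : (b, false) \in I -> b != inl ord0.
    by move=> h; apply/negP => /eqP b0; move: (IZ h); rewrite b0 root_zero_set.
  case: x xr xI bx => [b []] xr xI bx.
    exfalso; have bL := cut_line xI; move: (bL); rewrite inE => /asboolP[_ _ nb _]; apply: nb.
    move: bx; rewrite /dpar /=; case: ifP => [/eqP b0|//].
    by have := line_edge_neq0 bL; rewrite b0 eqxx.
  apply: (edge b (fun m => split_len m b + s) (b, true) (fun=> s)) => //.
  + exact: esc.
  + have hr m := split_len_range m b.
    have hs : \forall m \near U, if b is inl v then is_true (split_len m b + s <= base_len m v) else True.
      case: b xr xI bx hr => [v|i] xr xI bx hr; last by exact: nearW.
      move: xI; rewrite inE => /asboolP[_ [//|/(_ s)]]; apply: filterS => m /=.
      by move=> h; rewrite -lerBrDl; exact: ltW.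
    apply: filterS hs => m h; split=> //; case: (hr m) => h1 _; exact: addr_ge0.
  + by apply: nearW => m; rewrite spl addrAC subrr add0r.
  + exact: cvg_cst.
have bE b t : (b, t) != root -> (b, t) \in I -> b != inl ord0.
  move=> h1 h2; apply/negP => /eqP b0; rewrite b0 in h1 h2; case: t h1 h2 => // _ h2.
  by move: (IZ h2); rewrite root_zero_set.
case: x xr xI nlx bx => [b t] xr xI nlx bx; have b0 := bE _ _ xr xI.
rewrite -scaleNr; have hr m := split_len_range m b.
case: t xr xI nlx bx => xr xI nlx bx.
  apply: (edge b (fun m => split_len m b - s) (b, true) (fun=> - s)) => //.
  - move: xI; rewrite inE => /asboolP[_ [//|/(_ s)]]; apply: filterS => m; rewrite dlen_sub => h.
    case: (hr m) => h1 h2; split; first by rewrite subr_ge0 ltW.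
    by case: b {xr nlx bx b0 h hr h1} h2 => // v h2; apply: le_trans h2; rewrite gerBl.
  - by apply: nearW => m; rewrite spl addrAC subrr add0r.
  - exact: cvg_cst.
case: b xr xI nlx bx b0 hr => [v|//] xr xI nlx bx b0 hr.
apply: (edge (inl v) (fun m => base_len m v - s) (inl v, false) (fun=> - s)) => //.
- move: xI; rewrite inE => /asboolP[_ [//|/(_ s)]]; apply: filterS => m /= h.
  case: (hr m) => h1 h2; split; last by rewrite gerBl.
  lra.
- apply: nearW => m; rewrite /= (base_pos_step) /edge_point -addrA -scalerDl.
  by [].
exact: cvg_cst.
Qed.

(** Points of the trees that are almost as close to [r] as possible converge to [r], because [r] is
    approached by limits of such points; so [tree_limit] applies. *)
Lemma limit_set_adherent r : (forall e, 0 < e -> exists2 r', limit_set r' & nrm (r' - r) < e) ->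
  limit_set r.
Proof.
move=> adh; have tree0 m : exists r', tree m r' by exists (base_pos m ord0); apply/tree_set_edge; left.
have /choice[x xP] : forall m, exists x, tree m x /\
    forall x', tree m x' -> nrm (x - r) <= nrm (x' - r) + m.+1%:R^-1.
  move=> m; pose D := [set nrm (x - r) | x in tree m].
  have D_inf : has_inf D.
    split; first by have [x xt] := tree0 m; exists (nrm (x - r)), x.
    by exists 0 => _ [x _ <-]; exact: nrm_ge0.
  have m_gt0 : 0 < m.+1%:R^-1 :> R by rewrite invr_gt0.
  have [_ [x xt <-] lt_x] := inf_adherent m_gt0 D_inf.
  exists x; split=> // x' x't; apply: ltW; apply: (lt_le_trans lt_x).
  by rewrite lerD2r; apply: ge_inf; [case: D_inf|exists x'].
apply: (@tree_limit x); first by apply: nearW => m; case: (xP m).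
move=> j; apply/cvgrPdist_lt => e e_gt0.
have e3 : 0 < e / 3 by rewrite divr_gt0.
have [r' r'L r'r] := adh _ e3; have [x' x'T x'r'] := limit_tree r'L.
near=> m.
have h1 : tree m (x' m) by near: m; exact: x'T.
have h2 : nrm (x' m - r') < e / 3 by near: m; exact: (vcvg_eps UU x'r' e3).
have h3 : m.+1%:R^-1 < e / 3.
  near: m; apply: filterS (U_fine (Num.truncn (e / 3)^-1)) => m h.
  rewrite invf_plt ?posrE //; apply: lt_le_trans (truncnS_gt _) _.
  by rewrite ler_nat ltnS.
have [_ /(_ _ h1) h4] := xP m.
have := nrmD (x' m - r') (r' - r); rewrite addrA subrK => h5.
rewrite distrC; have := nrm_coord (x m - r) j; rewrite !mxE; move: h3 h4; set w := _^-1; lra.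
Unshelve. all: by end_near.
Qed.

(** If either half failed, [U]-almost every [m] would have a violating point of norm at most [C].
    These points converge along [U], and their limit contradicts [tree_limit] or [limit_tree]. *)
Lemma limit_set_near (C e : R) : 0 < e -> \forall m \near U,
  (forall x, tree m x -> nrm x <= C -> exists2 r, limit_set r & nrm (x - r) < e) /\
  (forall r, limit_set r -> nrm r <= C -> exists2 x, tree m x & nrm (x - r) < e).
Proof.
move=> e_gt0; apply: filterI.
  have [//|bad] := ultra_near UU (fun m => forall x, tree m x -> nrm x <= C ->
    exists2 r, limit_set r & nrm (x - r) < e).
  exfalso; have /choice[x xP] : forall m, exists x, ~ (forall x, tree m x -> nrm x <= C ->
      exists2 r, limit_set r & nrm (x - r) < e) ->
      [/\ tree m x, nrm x <= C & ~ exists2 r, limit_set r & nrm (x - r) < e].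
    move=> m; have [h|h] := pselect (forall x, tree m x -> nrm x <= C ->
      exists2 r, limit_set r & nrm (x - r) < e); first by exists 0.
    have [x hx] : exists x, ~ (tree m x -> nrm x <= C -> exists2 r, limit_set r & nrm (x - r) < e).
      exact/existsNP.
    by exists x => _; move: hx => /not_implyP[h1 /not_implyP[h2 h3]].
  have all : \forall m \near U, [/\ tree m (x m), nrm (x m) <= C &
      ~ exists2 r, limit_set r & nrm (x m - r) < e] by apply: filterS bad => m; exact: xP.
  have [r xr] : exists r, vcvg U x r.
    by apply: (bounded_vcvg UU); exists C; apply: filterS all => m [].
  have rL : limit_set r by apply: (tree_limit _ xr); apply: filterS all => m [].
  have [m [/= [_ _ no] h]] := filter_ex (filterI all (vcvg_eps UU xr e_gt0)).
  by apply: no; exists r.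
have [//|bad] := ultra_near UU (fun m => forall r, limit_set r -> nrm r <= C ->
  exists2 x, tree m x & nrm (x - r) < e).
exfalso; have /choice[r rP] : forall m, exists r, ~ (forall r, limit_set r -> nrm r <= C ->
    exists2 x, tree m x & nrm (x - r) < e) ->
    [/\ limit_set r, nrm r <= C & ~ exists2 x, tree m x & nrm (x - r) < e].
  move=> m; have [h|h] := pselect (forall r, limit_set r -> nrm r <= C ->
    exists2 x, tree m x & nrm (x - r) < e); first by exists 0.
  have [r hr] : exists r, ~ (limit_set r -> nrm r <= C -> exists2 x, tree m x & nrm (x - r) < e).
    exact/existsNP.
  by exists r => _; move: hr => /not_implyP[h1 /not_implyP[h2 h3]].
have all : \forall m \near U, [/\ limit_set (r m), nrm (r m) <= C &
    ~ exists2 x, tree m x & nrm (x - r m) < e] by apply: filterS bad => m; exact: rP.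
have [r' rr'] : exists r', vcvg U r r'.
  by apply: (bounded_vcvg UU); exists C; apply: filterS all => m [].
have r'L : limit_set r'.
  apply: limit_set_adherent => d d_gt0.
  have [m [/= [h1 _ _] h2]] := filter_ex (filterI all (vcvg_eps UU rr' d_gt0)).
  by exists (r m).
have [x xT xr'] := limit_tree r'L; have e2 : 0 < e / 2 by rewrite divr_gt0.
have [m [/= [_ _ no] [h1 [h2 h3]]]] := filter_ex (filterI all (filterI xT
  (filterI (vcvg_eps UU rr' e2) (vcvg_eps UU xr' e2)))).
apply: no; exists (x m) => //.
have := nrmD (x m - r') (r' - r m); rewrite addrA subrK [nrm (r' - _)]nrmB.
have := @splitr _ e; lra.
Qed.

Local Notation D := (deg_tree par0 leg0 I).
Local Notation at_ := (@deg_at n E Delta par0 leg0 I).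
Local Notation croot := (comp_root par rk leaf (ends (Delta := Delta)) cut root).
Local Notation cpar := (@comp_par X par rk leaf (ends (Delta := Delta)) cut root).
Local Notation slp := (@deg_slope n E Delta par0 leg0 I).

Definition total_cut_len (m : nat) : R := \sum_(x in I | ~~ leaf x) dlen m x.

Let mu := total_cut_len.

(** The vertices of a component stay at bounded distance from each other, so after division by
    [total_cut_len] a component counts as one point. *)
Lemma dpos_top z : bounded U (fun m => dpos m z - dpos m (top par rk cut z)).
Proof.
apply: (@top_ind _ root _ _ prk cut (cut_root I) (fun z t => bounded U (fun m => dpos m z - dpos m t))).
  by move=> x _; exists 0; apply: nearW => m; rewrite subrr nrm0.
move=> x /not_cut[xr xI] b; have b' := vcvg_bounded UU (dlen_vcvg xr xI).
apply: bounded_near (boundedD UU b b'); apply: nearW => m.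
by rewrite (dpos_step m xr (not_cut_nonleaf xI)) [RHS]addrAC.
Qed.

Lemma bounded_div (u : nat -> 'rV[R]_n) : escapes U mu -> bounded U u ->
  vcvg U (fun m => (mu m)^-1 *: u m) 0.
Proof.
move=> esc [C bC] j; rewrite mxE; apply/cvgrPdist_lt => e e_gt0.
apply: filterS3 bC (esc (`|C| / e)) (esc 0) => m h1 h2 mu0.
rewrite sub0r normrN mxE normrM gtr0_norm ?invr_gt0 // mulrC ltr_pdivrMr //.
rewrite ltr_pdivrMr // in h2; apply: le_lt_trans (nrm_coord _ _) _.
by rewrite mulrC; apply: le_lt_trans h2; apply: (le_trans h1); exact: ler_norm.
Qed.

Lemma cut_len_le m x : x \in I -> ~~ leaf x -> dlen m x <= mu m.
Proof.
move=> xI nlx; rewrite /mu /total_cut_len (bigD1 x) ?xI //= lerDl.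
by apply: sumr_ge0 => y _; exact: (dlen_ge0).
Qed.

Lemma cut_escapes x : x \in I -> ~~ leaf x -> escapes U mu.
Proof.
move=> xI nlx C; move: (xI); rewrite inE => /asboolP[_ [lx|/(_ C)]]; first by rewrite lx in nlx.
by apply: filterS => m h; apply: lt_le_trans h _; exact: cut_len_le.
Qed.

Lemma deg_vertex (v : vert D) : cut (at_ v) /\ ~~ leaf (at_ v).
Proof.
have := comp_atP v; rewrite (comp_vertexE par rk (@ends_cut _ _ _ _ leaf_I) (ends_root E Delta) rnl).
by move=> /and3P[].
Qed.

Lemma deg_vertex_cut (v : vert D) : v != croot -> at_ v \in I /\ ~~ leaf (at_ v).
Proof.
have [cv nlv] := deg_vertex v; rewrite comp_eq_root => vr; split=> //.
by case/orP: cv => // h; case/negP: vr.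
Qed.

(* The weights are the limits of the lengths of the cut edges, divided by their
   sum; along a path between bounded vertices the edge vectors then telescope to 0. *)
Lemma allowable_bounded : allowable (D := D) R slp [set v : vert D | bnd (at_ v)].
Proof.
have [[x0 /andP[x0I nlx0]]|no] := pselect (exists x, (x \in I) && ~~ leaf x); last first.
  (* Without cut edges other than leaves, the tree of the degeneration has a single vertex and the
     weights may be 0. *)
  exists (fun _ _ => 0); split=> [//|gt1|v w p _ _ _].
  - exfalso; apply: no; have [i ir] : exists i : vert D, i != croot.
      have /card_gt1P[i [j [_ _ ij]]] : (1 < #|{: vert D}|)%N by rewrite card_ord.
      have [E1|] := eqVneq i croot; last by exists i.
      by exists j; rewrite -E1 eq_sym.
    by have [h1 h2] := deg_vertex_cut ir; exists (at_ i); rewrite h1.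
  by rewrite /path_sum big1 // => e _; rewrite scale0r.
have esc := cut_escapes x0I nlx0.
have mu_gt0 : \forall m \near U, 0 < mu m by exact: esc.
have /choice[al alP] : forall x, exists a : R, x \in I -> ~~ leaf x -> dlen m x / mu m @[m --> U] --> a.
  move=> x; have [/andP[xI nlx]|h] := boolP ((x \in I) && ~~ leaf x); last first.
    by exists 0 => h1 h2; rewrite h1 h2 in h.
  have [|a aP] := @ultra_cvg _ _ UU (fun m => dlen m x / mu m) 1; last by exists a.
  apply: filterS mu_gt0 => m h; have l0 := dlen_ge0 m x.
  rewrite ger0_norm ?divr_ge0 ?(ltW h) // ler_pdivrMr // mul1r; exact: cut_len_le.
have al_ge0 x : x \in I -> ~~ leaf x -> 0 <= al x.
  move=> xI nlx; have c : (0 : R) @[m --> U] --> (0 : R) by exact: cvg_cst.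
  apply: (ler_cvg_to c (alP x xI nlx)); apply: filterS mu_gt0 => m h.
  by rewrite divr_ge0 ?(ltW h) // (dlen_ge0).
(* The normalised lengths sum to 1, so their limits do not all vanish. *)
have [x1 [x1I nlx1 x1al]] : exists x, [/\ x \in I, ~~ leaf x & al x != 0].
  apply: contrapT => no.
  have : \sum_(x in I | ~~ leaf x) (dlen m x / mu m) @[m --> U] --> \sum_(x in I | ~~ leaf x) al x.
    by apply: (ultra_cvg_sum UU) => x /andP[xI nlx]; exact: alP.
  rewrite big1 => [|x /andP[xI nlx]]; last first.
    by apply/eqP; rewrite -[_ == _]negbK; apply/negP => h; apply: no; exists x.
  move=> c0; have [m [/= h1 h2]] := filter_ex (filterI mu_gt0 (cvg_eps UU c0 ltr01)).
  move: h2; rewrite -mulr_suml -/(total_cut_len m) -/(mu m) divff ?gt_eqF // subr0 normr1; lra.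
pose a (u v : vert D) : R := if (u != croot) && (cpar u == v) then al (at_ u)
  else if (v != croot) && (cpar v == u) then al (at_ v) else 0.
have asym := comp_par_asym pr prk pnl (ends_root E Delta) (cut_root I) (@ends_cut _ _ _ _ leaf_I) (ends_root E Delta) rnl.
have a_up u v : u != croot -> cpar u = v -> a u v = al (at_ u) /\ a v u = al (at_ u).
  move=> ur uv; rewrite /a ur uv eqxx /=; split=> //.
  by case: ifP => // /andP[vr /eqP vu]; case: (asym _ _ ur vr uv vu).
have slp_up u v : u != croot -> cpar u = v -> slp u v = - slope (at_ u) /\ slp v u = slope (at_ u).
  move=> ur uv; rewrite /deg_slope /comp_slope ur uv eqxx /=; split=> //.
  by case: ifP => // /andP[vr /eqP vu]; case: (asym _ _ ur vr uv vu).
have up u : u != croot -> vcvg U (fun m => (mu m)^-1 *: (dpos m (at_ u) - dpos m (at_ (cpar u))))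
    (al (at_ u) *: toR R (slope (at_ u))).
  move=> ur; have [uI nlu] := deg_vertex_cut ur.
  have ux : at_ u != root by apply: contraNneq ur => h; rewrite comp_eq_root; apply/eqP.
  have atE : at_ (cpar u) = top par rk cut (par (at_ u)).
    exact: (comp_parE prk pnl (ends_root E Delta) (cut_root I) (@ends_cut _ _ _ _ leaf_I) (ends_root E Delta) rnl ur).
  rewrite -[X in vcvg _ _ X]add0r.
  apply: (vcvg_near UU) (vcvgD UU (bounded_div esc (dpos_top (par (at_ u)))) (vcvgZ _ (alP _ uI nlu))).
  apply: nearW => m; rewrite atE (dpos_step m ux nlu).
  by rewrite mulrC -scalerA -scalerDr addrAC.
have step u v : parent_adj croot cpar u v ->
    vcvg U (fun m => (mu m)^-1 *: (dpos m (at_ v) - dpos m (at_ u))) (a u v *: toR R (slp u v)).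
  case/orP => /andP[ur /eqP uv].
    have [-> _] := a_up _ _ ur uv; have [-> _] := slp_up _ _ ur uv; rewrite toRN scalerN -uv.
    apply: (vcvg_near UU) (vcvgN UU (up _ ur)); apply: nearW => m.
    by rewrite -scalerN opprB.
  by have [_ ->] := a_up _ _ ur uv; have [_ ->] := slp_up _ _ ur uv; rewrite -uv; exact: up.
have tele v p : path (parent_adj croot cpar) v p ->
    vcvg U (fun m => (mu m)^-1 *: (dpos m (at_ (last v p)) - dpos m (at_ v))) (@path_sum R n k D slp a v p).
  elim: p v => [|w p IH] v /=.
    move=> _; rewrite /path_sum big_nil => j; under eq_fun do rewrite subrr scaler0; exact: cvg_cst.
  move=> /andP[vw wp]; rewrite /path_sum /= big_cons /=.
  apply: (vcvg_near UU) (vcvgD UU (step _ _ vw) (IH _ wp)); apply: nearW => m.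
  by rewrite -scalerDr addrC addrA subrK.
exists a; split.
- move=> u v uv; case/orP: (uv) => /andP[ur /eqP ur']; have [-> ->] := a_up _ _ ur ur'.
    by have [h1 h2] := deg_vertex_cut ur; split=> //; exact: al_ge0.
  by have [h1 h2] := deg_vertex_cut ur; split=> //; exact: al_ge0.
- move=> _; pose i := deg_vert par0 leg0 I x1.
  have iE : at_ i = x1.
    by apply: deg_at_vert => //; apply/orP; right.
  have ir : i != croot by rewrite comp_eq_root -/(at_ i) iE; move: x1I; rewrite inE => /asboolP[].
  exists i, (cpar i); split; first by rewrite /= /parent_adj ir eqxx.
  by have [-> _] := a_up _ _ ir erefl; rewrite iE.
move=> v w p /= bv bw [vp lp _].
apply: (vcvg_unique UU (tele _ _ vp)); rewrite lp.
by apply: (bounded_div esc); exact: (boundedD UU bw (boundedN UU bv)).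
Qed.

Lemma base_pos_bounded v : bounded U Y -> bounded U (fun m => base_pos m v).
Proof.
move=> [C bC]; exists (n%:R * (C * \sum_i \sum_j `|base_mx R par0 leg0 v i j|)).
apply: filterS bC => m h; apply: nrm_le_bound => j.
rewrite /base_pos mxE; apply: (le_trans (ler_norm_sum _ _ _)).
rewrite mulr_sumr; apply: ler_sum => i _; rewrite normrM ler_pM //.
  exact: le_trans (nrm_coord _ _) h.
by rewrite (bigD1 j) //= lerDl sumr_ge0.
Qed.

Lemma base_len_bounded v : bounded U Y -> exists C, \forall m \near U, base_len m v <= C.
Proof.
move=> [C bC]; exists (\sum_i C * `|len_mx R ((inl v, false) : X) i 0|).
apply: filterS bC => m h; rewrite /base_len /len mxE; apply: le_trans (ler_norm _) _.
apply: (le_trans (ler_norm_sum _ _ _)); apply: ler_sum => i _; rewrite normrM ler_wpM2r //.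
exact: le_trans (nrm_coord _ _) h.
Qed.

Lemma line_edge_unbounded b : b \in line_edge -> ~ bounded U Y.
Proof.
by rewrite inE => /asboolP[_ _ nb _] bY; apply: nb; exact: base_pos_bounded.
Qed.

(** A component other than that of the root lies below a cut edge, and the length of this edge, or
    the distance of its middle from the root end, escapes. *)
Lemma active_unbounded c : active c -> c != root -> ~ bounded U Y.
Proof.
move=> [/orP[/eqP ->|cI] nlc _]; first by rewrite eqxx.
move=> _; case: c cI nlc => [b []] cI nlc; first exact: (line_edge_unbounded (cut_line cI)).
case: b cI nlc => // v cI _ bY; have [C lC] := base_len_bounded v bY.
move: cI; rewrite inE => /asboolP[_ [//|/(_ C) esc]].
have [m [/= h1 h2]] := filter_ex (filterI lC esc).
have [h3 _] := split_len_range m (inl v); lra.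
Qed.

Hypothesis Delta_toric : toric_degree Delta.

Section SmallDegree.
Hypothesis E0 : E = 0%N.
Hypothesis k2 : (k <= 2)%N.

Lemma active_small c : active c -> c = root \/ exists2 i, c = (inr i, true) & inr i \in line_edge.
Proof.
move=> [/orP[/eqP ->|cI] nlc _]; first by left.
have v0 (v : 'I_E.+1) : v = ord0 by apply: val_inj => /=; have := ltn_ord v; rewrite {2}E0; lia.
right; case: c cI nlc => [[v|i] []] cI //= _.
- by have := line_edge_neq0 (cut_line cI); rewrite (v0 v) eqxx.
- by move: (IZ cI); rewrite (v0 v) root_zero_set.
- by exists i => //; exact: (cut_line cI).
Qed.

(** The components are the one of the root and those of legs tending to lines. A bounded root
    excludes lines. Two legs have opposite vectors, so their middles differ by the sum of two
    escaping parameters times a nonzero vector and cannot both be bounded. *)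
Lemma active_unique c c' : active c -> active c' -> c = c'.
Proof.
have v0 (v : 'I_E.+1) : v = ord0 by apply: val_inj => /=; have := ltn_ord v; rewrite {2}E0; lia.
have nroot i : active root -> inr i \in line_edge -> False.
  move=> [_ _ br]; rewrite inE => /asboolP[_ _ nb _]; apply: nb; apply: bounded_near br.
  apply: nearW => m; rewrite /= /split_len (negPf line_edge_root) /edge_point scale0r addr0.
  by rewrite (v0 (bottom (inl ord0))) (v0 (leg0 i)).
move=> ac ac'; have [cr|[i cE iL]] := active_small ac; have [c'r|[j c'E jL]] := active_small ac'.
- by rewrite cr.
- by exfalso; apply: (nroot j); rewrite // -cr.
- by exfalso; apply: (nroot i); rewrite // -c'r.
have [ij|ij] := eqVneq i j; first by rewrite cE c'E ij.
have [sl iesc] := line_edge_escapes iL; have [_ jesc] := line_edge_escapes jL.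
have opp : Delta`_j = - Delta`_i.
  move: Delta_toric; rewrite /toric_degree (big_nth 0) big_mkord (bigD1 i) //= (bigD1 j) 1?eq_sym //=.
  rewrite big1 => [|l /andP[li lj]]; first by rewrite addr0 addrC => /eqP; rewrite addr_eq0 => /eqP.
  exfalso; have hi := ltn_ord i; have hj := ltn_ord j; have hl := ltn_ord l.
  by move: ij li lj; rewrite -!val_eqE /=; lia.
have [C bC] : bounded U (fun m => (sm m (inr i) + sm m (inr j)) *: toR R Delta`_i).
  apply: bounded_near (boundedD UU (line_dpos_bounded iL) (boundedN UU (line_dpos_bounded jL))).
  apply: nearW => m; rewrite /= /split_len iL jL /edge_point /= (v0 (leg0 i)) (v0 (leg0 j)) opp toRN.
  by rewrite scalerN opprB [_ + _ *: _]addrC addrACA subrr addr0 scalerDl.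
have sl_gt0 := nrm_toR R sl; exfalso.
have [m [/= h1 [h2 h3]]] := filter_ex (filterI bC (filterI (iesc (`|C| / nrm (toR R Delta`_i))) (jesc 0))).
move: h1; rewrite nrmZ => h1; rewrite ltr_pdivrMr //= in h2.
have h4 := ler_norm C; have h5 := ler_norm (sm m (inr i) + sm m (inr j)).
have : sm m (inr i) * nrm (toR R Delta`_i) <= `|sm m (inr i) + sm m (inr j)| * nrm (toR R Delta`_i).
  by apply: ler_wpM2r; [exact: nrm_ge0|lra].
lra.
Qed.

End SmallDegree.

Hypothesis leaf_under : forall v, v != ord0 -> exists i, fconnect par0 (leg0 i) v.
Hypothesis leaf_not_under : forall v, v != ord0 -> exists i, ~~ fconnect par0 (leg0 i) v.

Definition active_set : {set X} := [set c | `[< active c >]].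

Lemma active_setP (i : 'I_#|active_set|) : active (enum_val i).
Proof. by have := enum_valP i; rewrite inE => /asboolP. Qed.

Let root_Z : (inl ord0, false) \in Z := root_zero_set.
Let sub_ZI x (x0 : x != inl ord0) := sub_zero_cut x0.

Lemma limit_degeneration :
  degeneration R Delta (fun i : 'I_#|active_set| => comp_degree par0 leg0 I (enum_val i)).
Proof.
have vert_at (i : 'I_#|active_set|) : deg_at (deg_vert par0 leg0 I (enum_val i)) = enum_val i.
  by have [cc nlc _] := active_setP i; exact: deg_at_vert.
exists (deg_tree par0 leg0 I), (@deg_slope n E Delta par0 leg0 I),
  (fun i => deg_vert par0 leg0 I (enum_val i)); split.
- exact: deg_is_ltree par0_lt leaf_under leaf_not_under leaf_I IZ root_Z sub_ZI Delta_toric.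
- exact: deg_balanced par0_root par0_lt leaf_I Delta_toric.
- by move=> i j ij; apply: enum_val_inj; rewrite -(vert_at i) ij vert_at.
- have [a [h1 h2 h3]] := allowable_bounded.
  exists a; split=> // v w p [i _ <-] [j _ <-]; apply: h3 => /=; rewrite vert_at.
    by case: (active_setP i).
  by case: (active_setP j).
by move=> i; have [cc nlc _] := active_setP i; exact: deg_star.
Qed.

Section Solution.
Variables (p : nat) (A : 'M[R]_(p, n + E)) (y : 'rV[R]_p) (ys : 'rV[R]_(n + E)).
Hypothesis yA : y *m A = ys.
Hypothesis ys_pos : forall v, bounded U (fun m => base_pos m v) ->
  ys *m base_mx R par0 leg0 v = q (inl v, false).
Hypothesis ys_len : forall v, (inl v, false) \notin I ->
  len ys ((inl v, false) : X) = ell (inl v, false).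
Hypothesis ys_line : forall x, x \in line_edge -> exists tau,
  pos par0 leg0 ys (x, true) = q (x, true) + tau *: toR R (bslope x).

Lemma limit_tropical (i : 'I_#|active_set|) :
  tropical_curve (hcurve par0 leg0 Z I A (enum_val i) y).
Proof.
have [cc nlc _] := active_setP i.
apply: (hcurve_tropical par0_root par0_lt IZ) => //.
- exact: (ys_contracted yA ys_len).
- exact: (ys_positive yA ys_len).
- exact: ctree_is_ltree par0_lt leaf_under leaf_not_under leaf_I IZ root_Z sub_ZI Delta_toric _ cc nlc.
- exact: ctree_balanced par0_root par0_lt leaf_I IZ Delta_toric _ cc nlc.
Qed.

Lemma limit_bigcup : limit_set =
  \bigcup_(i in [set: 'I_#|active_set|]) trop_image (hcurve par0 leg0 Z I A (enum_val i) y).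
Proof.
rewrite (limit_set_images yA ys_pos ys_len ys_line).
apply/seteqP; split=> [r [c [ac rc]]|r [i _ ri]].
  have cS : c \in active_set by rewrite inE; exact/asboolP.
  by exists (enum_rank_in cS c) => //=; rewrite enum_rankK_in.
by exists (enum_val i); split=> //; exact: active_setP.
Qed.

End Solution.

End Limit.

(** * Dimension of the parameters *)

Section PackedFamilies.
Variables (R : realType) (n : nat).

(* Tuples of maps of all degrees in one type, in which families of tuples whose
   degrees depend on their index can be compared with a given tuple. *)
Definition shape : Type := {s : nat & 'I_s -> seq 'rV[int]_n}.
Definition packed : Type := {x : shape & trop_tuple R (projT2 x)}.
Definition pack (s : nat) (Deltas : 'I_s -> seq 'rV[int]_n) (h : trop_tuple R Deltas) : packed :=
  existT (fun x : shape => trop_tuple R (projT2 x)) (existT _ s Deltas) h.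

Lemma pack_inj s (Deltas : 'I_s -> seq 'rV[int]_n) : injective (@pack s Deltas).
Proof.
move=> h h' e; have := projT2_eq e.
by rewrite (Prop_irrelevance (projT1_eq e) erefl).
Qed.

Lemma cast_family (x x' : shape) (d : nat) (F : 'rV[R]_d -> trop_tuple R (projT2 x)) :
  x = x' -> affine_family F -> exists F' : 'rV[R]_d -> trop_tuple R (projT2 x'),
    affine_family F' /\ forall y, existT (fun x : shape => trop_tuple R (projT2 x)) x' (F' y) = existT _ x (F y).
Proof. by move=> xx'; case: _ / xx' => aff; exists F. Qed.

Variables (T : finType) (s_ : T -> nat) (De : forall c, 'I_(s_ c) -> seq 'rV[int]_n).
Variables (d : nat) (F : forall c, 'rV[R]_d -> trop_tuple R (@De c)) (N : int).
Hypothesis dN : T -> d%:Z < N.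
Hypothesis F_affine : forall c, affine_family (@F c).

(** Only the families whose degrees equal [Deltas] can contain [h]; these are transported along that
    equality. *)
Lemma packed_dim_lt s (Deltas : 'I_s -> seq 'rV[int]_n) (L : set (trop_tuple R Deltas)) :
  (forall h, L h -> exists c y, pack h = pack (@F c y)) -> dim_lt L N.
Proof.
move=> LF; pose P := finset (fun c => `[< existT _ _ (@De c) = existT _ _ Deltas :> shape >]).
have cast c : c \in P -> exists F' : 'rV[R]_d -> trop_tuple R Deltas,
    affine_family F' /\ forall y, pack (F' y) = pack (@F c y).
  rewrite inE => /asboolP e; exact: (cast_family e (@F_affine c)).
have /choice[G GP] : forall i : 'I_#|P|, exists F' : 'rV[R]_d -> trop_tuple R Deltas,
    affine_family F' /\ forall y, pack (F' y) = pack (@F (enum_val i) y).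
  by move=> i; apply: cast; exact: enum_valP.
exists #|P|, (fun=> d), G; split=> [j|h /LF[c [y hE]]].
  by split; [exact: dN (enum_val j)|case: (GP j)].
have cP : c \in P by rewrite inE; apply/asboolP; have := projT1_eq hE => /= ->.
exists (enum_rank_in cP c), y; apply: pack_inj; rewrite hE.
by case: (GP (enum_rank_in cP c)) => _ ->; rewrite enum_rankK_in.
Qed.

End PackedFamilies.

Lemma dim_lt_set0 (R : realType) (n s : nat) (Deltas : 'I_s -> seq 'rV[int]_n)
  (L : set (trop_tuple R Deltas)) (N : int) : (forall h, ~ L h) -> dim_lt L N.
Proof.
move=> L0; have F : forall j : 'I_0, 'rV[R]_0 -> trop_tuple R Deltas by case.
by exists 0%N, (fun=> 0%N), F; split=> [[]//|h /L0].
Qed.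

Section Strata.
Variables (R : realType) (n : nat) (Delta : seq 'rV[int]_n).
Local Notation k := (size Delta).
Local Notation E := (k - 2).-1.
Local Notation X := (dvert E Delta).

(** The inclusion of the hyperplane on which coordinate [j] vanishes. *)
Definition skip_mx (p : nat) (j : 'I_p) : 'M[R]_(p.-1, p) :=
  \matrix_(a, b) (lift j a == b)%:R.

Lemma skip_mxK (p : nat) (j : 'I_p) (z : 'rV[R]_p) : z 0 j = 0 ->
  (\row_a z 0 (lift j a)) *m skip_mx j = z.
Proof.
move=> z0; apply/rowP => b; rewrite mxE; case: (unliftP j b) => [b' ->|->].
  rewrite (bigD1 b') //= !mxE eqxx mulr1 big1 ?addr0 // => a ab.
  by rewrite !mxE (inj_eq lift_inj) (negPf ab) mulr0.
rewrite z0 big1 // => a _; rewrite !mxE (_ : (lift j a == j) = false) ?mulr0 //.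
by rewrite eq_sym (negPf (neq_lift j a)).
Qed.

(* The combinatorial data of a limit, together with a vanishing coordinate of
   the parameter. *)
Definition stratum : finType :=
  ({ffun 'I_E.+1 -> 'I_E.+1} * {ffun 'I_k -> 'I_E.+1} *
   ({set X} * {set X} * {set X}) * 'I_(n + E))%type.

Definition stratum_degree (c : stratum) : 'I_#|c.1.2.2| -> seq 'rV[int]_n :=
  fun i => comp_degree c.1.1.1 c.1.1.2 c.1.2.1.2 (enum_val i).

Definition stratum_family (c : stratum) (y : 'rV[R]_(n + E).-1) :
    trop_tuple R (@stratum_degree c) :=
  fun i => hcurve c.1.1.1 c.1.1.2 c.1.2.1.1 c.1.2.1.2 (skip_mx c.2) (enum_val i) y.

(** For [k <= 2] one has [E = 0], and [n + E - 1] parameters would be too many; the locus is then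
    empty, as [active_unique] allows. *)
Definition small_locus (s : nat) (Deltas : 'I_s -> seq 'rV[int]_n) : set (trop_tuple R Deltas) :=
  [set h | [/\ (2 < k)%N, @parameter_space R n s Deltas h &
    exists c y, pack h = pack (@stratum_family c y)]].

Lemma small_locus_dim s (Deltas : 'I_s -> seq 'rV[int]_n) :
  dim_lt (@small_locus s Deltas) (n%:Z + k%:Z - 3).
Proof.
have [k2|k2] := leqP k 2.
  by apply: dim_lt_set0 => h [k3 _ _]; have := leq_trans k3 k2; rewrite ltnn.
apply: (@packed_dim_lt _ _ stratum _ stratum_degree _ stratum_family) => [c|c i|h [_ _ //]].
  (* The vanishing coordinate [c.2] shows that [n + E] is positive, so its predecessor is really
     smaller; moreover [E = k - 3] here. *)
  have lt_c := ltn_ord c.2; lia.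
exists (ctree c.1.1.1 c.1.1.2 c.1.2.1.1 c.1.2.1.2 (enum_val i)), (@cslope _ _ _ _ _ _ _ _),
  (fun _ _ => 0), (fun u v => skip_mx c.2 *m len_mx R (child_of u v)), (fun=> 0),
  (fun v => skip_mx c.2 *m pos_mx R c.1.1.1 c.1.1.2 (comp_at v)) => y.
by [].
Qed.

End Strata.

(** * Limits of curves *)

Section LimitOfTrees.
Variables (R : realType) (n : nat) (Delta : seq 'rV[int]_n).
Local Notation k := (size Delta).
Local Notation E := (k - 2).-1.
Hypothesis Delta_toric : toric_degree Delta.
Variables (U : set_system nat) (UU : UltraFilter U).
Hypothesis U_fine : forall N, \forall m \near U, (N <= m)%N.

(* The first clause states that A is closed. *)
Definition set_limit (B : nat -> set 'rV[R]_n) (A : set 'rV[R]_n) : Prop :=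
  (forall r, (forall e, 0 < e -> exists2 r', A r' & nrm (r' - r) < e) -> A r) /\
  forall C e, 0 < e -> \forall m \near U,
    (forall x, B m x -> nrm x <= C -> exists2 r, A r & nrm (x - r) < e) /\
    (forall r, A r -> nrm r <= C -> exists2 x, B m x & nrm (x - r) < e).

Definition tropical_limit (B : nat -> set 'rV[R]_n) : Prop :=
  exists (s : nat) (Deltas : 'I_s -> seq 'rV[int]_n) (h : trop_tuple R Deltas),
    [/\ degeneration R Delta Deltas,
        forall i, tropical_curve (h i),
        set_limit B (\bigcup_(i in [set: 'I_s]) trop_image (h i))
      & (1 < s)%N -> small_locus Delta h].

Lemma tropical_limit_tree (P : {ffun 'I_E.+1 -> 'I_E.+1}) (Q : {ffun 'I_k -> 'I_E.+1})
    (Y : nat -> 'rV[R]_(n + E)) : valid_base P Q ->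
  (forall m v, v != ord0 -> 0 <= base_len Delta Y m v) ->
  tropical_limit (fun m => tree_set (Delta := Delta) P Q (Y m)).
Proof.
move=> [par0_root par0_lt leaf_under leaf_not_under] base_len_ge0.
have [sm smP] := @near_minimal_exists R n E Delta P Q Y base_len_ge0.
have [/choice[q qP] /choice[ell ellP]] := limit_exists UU base_len_ge0 smP.
have [ys [ys_pos ys_len ys_line ys_zero]] := limit_parameter UU par0_root par0_lt smP qP ellP.
have lim := limit_set_near UU par0_root par0_lt base_len_ge0 smP qP ellP U_fine.
have adh := limit_set_adherent UU par0_root par0_lt base_len_ge0 smP qP ellP U_fine.
have deg := limit_degeneration UU par0_root par0_lt base_len_ge0 smP ellP
  Delta_toric leaf_under leaf_not_under.
have trop p (A : 'M[R]_(p, n + E)) y (yA : y *m A = ys) := limit_tropical UU par0_root par0_lt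
  base_len_ge0 smP ellP Delta_toric leaf_under leaf_not_under yA ys_len.
have img p (A : 'M[R]_(p, n + E)) y (yA : y *m A = ys) := limit_bigcup UU par0_root par0_lt smP
  qP ellP yA ys_pos ys_len ys_line.
pose h p (A : 'M[R]_(p, n + E)) y : trop_tuple R
    (fun i : 'I_#|active_set U P Q Y sm| => comp_degree P Q (cut_set U P Q Y sm) (enum_val i)) :=
  fun i => hcurve P Q (zero_set U P Q Y sm) (cut_set U P Q Y sm) A (enum_val i) y.
have actP c : c \in active_set U P Q Y sm -> active U P Q Y sm c by rewrite inE => /asboolP.
(* A bounded parameter leaves no component but that of the root; an unbounded one provides a
   vanishing coordinate. *)
have [bY|nbY] := pselect (bounded U Y).
  have yA : ys *m 1%:M = ys by rewrite mulmx1.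
  exists _, _, (h _ 1%:M ys); split=> //.
  - exact: trop yA.
  - by rewrite -(img _ _ _ yA); split.
  move=> /card_gt1P[c [c' [/actP ac /actP ac' cc']]]; exfalso.
  have [cr|cr] := eqVneq c (droot E Delta); last by case: (active_unbounded UU base_len_ge0 smP ac cr).
  have c'r : c' != droot E Delta by rewrite -cr eq_sym.
  by case: (active_unbounded UU base_len_ge0 smP ac' c'r).
have [j ysj] := ys_zero nbY; have yA := skip_mxK ysj.
pose c : stratum Delta := (P, Q, (zero_set U P Q Y sm, cut_set U P Q Y sm, active_set U P Q Y sm), j).
exists _, _, (@stratum_family R n Delta c (\row_a ys 0 (lift j a))); split=> //.
- exact: trop yA.
- by rewrite -(img _ _ _ yA); split.
move=> s_gt1; split; [|exact: trop yA|by exists c, (\row_a ys 0 (lift j a))].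
rewrite ltnNge; apply/negP => k2; move: s_gt1 => /card_gt1P[a [a' [/actP ac /actP ac' /eqP]]]; apply.
have E0 : E = 0%N by lia.
exact: (active_unique UU smP Delta_toric E0 k2 ac ac').
Qed.

End LimitOfTrees.

Section LimitOfCurves.
Variables (R : realType) (n : nat) (Delta : seq 'rV[int]_n).
Local Notation k := (size Delta).
Local Notation E := (k - 2).-1.
Hypothesis Delta_toric : toric_degree Delta.
Variables (U : set_system nat) (UU : UltraFilter U).
Hypothesis U_fine : forall N, \forall m \near U, (N <= m)%N.

Lemma tree_set_scale (P : 'I_E.+1 -> 'I_E.+1) (Q : 'I_k -> 'I_E.+1) (a : R) y r : 0 < a ->
  tree_set (Delta := Delta) P Q y r -> tree_set (Delta := Delta) P Q (a *: y) (a *: r).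
Proof.
have lenE v : len (a *: y) ((inl v, false) : dvert E Delta) = a * len y ((inl v, false) : dvert E Delta).
  by rewrite /len -scalemxAl mxE.
move=> a_gt0 [->|[v [s [v0 /andP[s_ge s_le] ->]]]|[i [s [s_ge ->]]]].
- by apply: Or31; rewrite -scalemxAl.
- apply: Or32; exists v, (a * s); rewrite lenE mulr_ge0 ?(ltW a_gt0) // ler_wpM2l ?(ltW a_gt0) //.
  by rewrite scalerDr scalerA -scalemxAl.
apply: Or33; exists i, (a * s); rewrite mulr_ge0 ?(ltW a_gt0) //.
by rewrite scalerDr scalerA -scalemxAl.
Qed.

Lemma near_by_scale (a kappa : R) (x y : 'rV[R]_n) : 0 < a -> near_by kappa x y ->
  nrm (a *: x - a *: y) <= n%:R * (a * kappa).
Proof.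
move=> a_gt0 xy; apply: nrm_le_bound => c.
by rewrite !mxE -mulrBr normrM gtr0_norm // ler_wpM2l // ltW.
Qed.

Lemma set_limit_near (B B' : nat -> set 'rV[R]_n) (d : nat -> R) (A : set 'rV[R]_n) :
  d m @[m --> U] --> (0 : R) ->
  (\forall m \near U, (forall x, B m x -> exists2 y, B' m y & nrm (x - y) <= d m) /\
     (forall y, B' m y -> exists2 x, B m x & nrm (x - y) <= d m)) ->
  set_limit U B' A -> set_limit U B A.
Proof.
move=> d0 BB' [adh lim]; split=> // C e e_gt0; have e2 : 0 < e / 2 by rewrite divr_gt0.
have E2 := @splitr _ e.
near=> m.
have dm : d m < e / 2.
  have : `|d m - 0| < e / 2 by near: m; exact: (cvg_eps UU d0 e2).
  by rewrite subr0; apply: le_lt_trans; exact: ler_norm.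
have [h1 h2] : (forall x, B m x -> exists2 y, B' m y & nrm (x - y) <= d m) /\
     (forall y, B' m y -> exists2 x, B m x & nrm (x - y) <= d m) by near: m.
(* The radius is enlarged by [e / 2] because the intermediate point in [B' m] may lie outside radius
   [C]. *)
have [h3 h4] : (forall x, B' m x -> nrm x <= C + e / 2 -> exists2 r, A r & nrm (x - r) < e / 2) /\
    (forall r, A r -> nrm r <= C + e / 2 -> exists2 x, B' m x & nrm (x - r) < e / 2).
  by near: m; exact: lim.
split=> [x Bx xC|r Ar rC].
  have [y B'y xy] := h1 x Bx.
  have [|r Ar yr] := h3 y B'y.
    by have := nrmD x (y - x); rewrite addrC subrK nrmB; lra.
  exists r => //; have := nrmD (x - y) (y - r); rewrite addrA subrK; lra.
have [|y B'y yr] := h4 r Ar; first lra.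
have [x Bx xy] := h2 y B'y; exists x => //.
have := nrmD (x - y) (y - r); rewrite addrA subrK; lra.
Unshelve. all: by end_near.
Qed.

Lemma tropical_limit_curves (g : nat -> curve_data R n k) (t : nat -> R) :
  (forall m, curve_of_degree (g m)) -> t m @[m --> \oo] --> +oo ->
  tropical_limit Delta U (fun m => Log_ (t m) @` curve_image (g m)).
Proof.
move=> g_deg t_oo; have [kappa [kappa_ge0 near_tree]] := log_image_near_tree R Delta_toric.
have lnt M : \forall m \near U, M < ln (t m).
  move/cvgryPgt : t_oo => /(_ (expR M)) [N _ tN]; apply: filterS (U_fine N) => m Nm.
  have h : expR M < t m by exact: tN.
  by rewrite -[M]expRK ltr_ln ?posrE ?expR_gt0 //; apply: lt_trans h; exact: expR_gt0.
(* Shapes are stored as finite functions, so that they form a finite type and [ultra_finite] makes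
   the shape constant along [U]. *)
have /choice[D DP] : forall m, exists D : {ffun 'I_E.+1 -> 'I_E.+1} * {ffun 'I_k -> 'I_E.+1} * 'rV[R]_(n + E),
    [/\ valid_base D.1.1 D.1.2, forall v, v != ord0 -> 0 <= len D.2 ((inl v, false) : dvert E Delta) &
      near_sets kappa ((@Log R n) @` curve_image (g m)) (tree_set (Delta := Delta) D.1.1 D.1.2 D.2)].
  move=> m; have [P [Q [y [h1 h2 h3]]]] := near_tree _ (g_deg m).
  exists (finfun P, finfun Q, y) => /=.
  have -> : (finfun P : _ -> _) = P by apply/funext => v; rewrite ffunE.
  by have -> : (finfun Q : _ -> _) = Q by apply/funext => v; rewrite ffunE.
have [[P Q] PQ] := ultra_finite UU (fun m => (D m).1).
(* The absolute value keeps the scaled lengths nonnegative for every [m], also where [ln (t m)] is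
   not positive. *)
pose a m := `|(ln (t m))^-1|.
have valid : valid_base P Q.
  by have [m mPQ] := filter_ex PQ; case: (DP m); rewrite mPQ.
have [|s [Deltas [h [h1 h2 h3 h4]]]] := tropical_limit_tree Delta_toric UU U_fine
  (Y := fun m => a m *: (D m).2) valid.
  move=> m v v0; rewrite /base_len /len -scalemxAl mxE mulr_ge0 ?normr_ge0 //.
  by case: (DP m) => _ /(_ v v0).
exists s, Deltas, h; split=> //.
apply: (set_limit_near (d := fun m => n%:R * (a m * kappa))) h3; last first.
  near=> m.
  have lnt0 : 0 < ln (t m) by near: m; exact: lnt.
  have am : a m = (ln (t m))^-1 by rewrite /a gtr0_norm // invr_gt0.
  have am0 : 0 < a m by rewrite am invr_gt0.
  have PQm : (D m).1 = (P, Q) by near: m.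
  have [_ _] := DP m; rewrite PQm /= => -[n1 n2]; split=> [x [z gz <-]|y yT].
    have [|y yT xy] := n1 (Log z); first by exists z.
    exists (a m *: y); first exact: tree_set_scale.
    by rewrite /Log_ -am; exact: near_by_scale.
  have yT' : tree_set (Delta := Delta) P Q (D m).2 ((a m)^-1 *: y).
    have := @tree_set_scale P Q (a m)^-1 _ _ _ yT; rewrite scalerA mulVf ?gt_eqF // scale1r.
    by apply; rewrite invr_gt0.
  have [_ [z gz <-] zy] := n2 _ yT'.
  exists (Log_ (t m) z); first by exists z.
  have -> : y = a m *: ((a m)^-1 *: y) by rewrite scalerA divff ?gt_eqF // scale1r.
  by rewrite /Log_ -am; exact: near_by_scale.
apply/cvgrPdist_lt => e e_gt0; near=> m.
have lnt0 : 0 < ln (t m) by near: m; exact: lnt.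
have lnte : n%:R * kappa / e < ln (t m) by near: m; exact: lnt.
have am : a m = (ln (t m))^-1 by rewrite /a gtr0_norm // invr_gt0.
have d_ge0 : 0 <= n%:R * (a m * kappa) by do 2! apply: mulr_ge0 => //; exact: normr_ge0.
rewrite sub0r normrN ger0_norm // am mulrCA mulrC ltr_pdivrMr //.
by rewrite ltr_pdivrMr // in lnte; rewrite [e * _]mulrC.
Unshelve. all: by end_near.
Qed.

End LimitOfCurves.

(** * Hausdorff limits *)

Section HausdorffLimits.
Variables (R : realType) (n : nat).
Implicit Types (x y : 'rV[R]_n) (A : set 'rV[R]_n) (B : nat -> set 'rV[R]_n).

Lemma nrm_ball x y e : nrm (x - y) < e -> ball x e y.
Proof.
move=> xy; split; first by apply: le_lt_trans xy; exact: nrm_ge0.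
move=> i j; rewrite (ord1 i); apply: le_lt_trans xy; have := nrm_coord (x - y) j; by rewrite !mxE.
Qed.

Lemma ball_nrm x y e : ball x e y -> nrm (x - y) <= n%:R * e.
Proof.
move=> [_ xy]; apply: nrm_le_bound => j; rewrite !mxE; apply: ltW; exact: xy.
Qed.

Lemma scale_lt (e : R) : 0 < e -> n%:R * (e / n.+1%:R) < e.
Proof. by move=> e_gt0; rewrite mulrCA gtr_pMr // ltr_pdivrMr // mul1r ltr_nat. Qed.

Lemma closed_adherent A : closed A <->
  forall r, (forall e, 0 < e -> exists2 r', A r' & nrm (r' - r) < e) -> A r.
Proof.
split=> [clA r adh|adh r clr].
  apply: clA => V /nbhs_ballP[e /= e_gt0 eV]; have [r' Ar' r'r] := adh e e_gt0.
  by exists r'; split=> //; apply: eV; apply: nrm_ball; rewrite nrmB.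
apply: adh => e e_gt0; have e' : 0 < e / n.+1%:R by rewrite divr_gt0.
have [r' [Ar' /ball_nrm]] := clr _ (nbhsx_ballx r _ e').
rewrite nrmB => h; exists r' => //; apply: le_lt_trans h _.
exact: scale_lt.
Qed.

Lemma compact_nrm (K : set 'rV[R]_n) : compact K -> exists C, forall x, K x -> nrm x <= C.
Proof.
move=> cK; have /choice[C CP] : forall j : 'I_n, exists C, forall x, K x -> `|x 0 j| <= C.
  move=> j; have /compact_bounded[M [_ MP]] : compact ((fun x => x 0 j) @` K : set R^o).
    by apply: continuous_compact => //; apply: continuous_subspaceT => x; exact: coord_continuous.
  exists (M + 1) => x Kx; apply: (MP (M + 1)); first by rewrite ltrDl.
  by exists x.
exists (\sum_j C j) => x Kx; apply: ler_sum => j _; exact: CP.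
Qed.

Lemma compact_box (x : 'rV[R]_n) : compact [set y : 'rV[R]_n | forall j, `|y 0 j - x 0 j| <= 1].
Proof.
have -> : [set y : 'rV[R]_n | forall j, `|y 0 j - x 0 j| <= 1] =
    [set y : 'rV[R]_n | forall j, `[x 0 j - 1, x 0 j + 1]%classic (y 0 j)].
  by apply/seteqP; split=> y h j; have := h j; rewrite /= in_itv /= ler_distl.
by apply: (@rV_compact R n (fun j => `[x 0 j - 1, x 0 j + 1]%classic)) => j; exact: segment_compact.
Qed.

Lemma hausdorff_dist_lt (K A A' : set 'rV[R]_n) e : (hausdorff_dist_on K A A' < e%:E)%E ->
  [/\ 0 < e, forall x, A x -> K x -> exists2 y, A' y & ball y e x &
    forall y, A' y -> K y -> exists2 x, A x & ball x e y].
Proof.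
move=> /ereal_inf_lt[_ [d [d_gt0 h1 h2] <-]]; rewrite lte_fin => de.
split; first exact: lt_trans de.
  move=> x Ax Kx; have [y A'y yx] := h1 x (conj Ax Kx); exists y => //.
  exact: le_ball (ltW de) _ yx.
move=> y A'y Ky; have [x Ax xy] := h2 y (conj A'y Ky); exists x => //.
exact: le_ball (ltW de) _ xy.
Qed.

Lemma hausdorff_dist_le (K A A' : set 'rV[R]_n) e : 0 < e ->
  (forall x, A x -> K x -> exists2 y, A' y & nrm (x - y) < e) ->
  (forall y, A' y -> K y -> exists2 x, A x & nrm (x - y) < e) ->
  (0 <= hausdorff_dist_on K A A' <= e%:E)%E.
Proof.
move=> e_gt0 h1 h2; apply/andP; split.
  by apply: le_ereal_inf_tmp => _ [d [d_gt0 _ _] <-]; rewrite lee_fin ltW.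
apply: ge_ereal_inf; exists e%:E => //; exists e => //; split=> //.
  move=> x [Ax Kx]; have [y A'y xy] := h1 x Ax Kx; exists y => //.
  by apply: nrm_ball; rewrite nrmB.
by move=> y [A'y Ky]; have [x Ax xy] := h2 y A'y Ky; exists x => //; exact: nrm_ball.
Qed.

Variables (U : set_system nat) (UU : UltraFilter U).
Hypothesis U_oo : \oo `<=` U.

Lemma ultra_fine N : \forall m \near U, (N <= m)%N.
Proof. by apply: U_oo; exists N. Qed.

(** A point [r] of [A] is tested with the compact set [[set r]]. For a point [r] of [A'] the box
    around [r] is used, as it contains the points of [B m] close to [r]. *)
Lemma set_limit_unique B A A' : hausdorff_limit B A -> set_limit U B A' -> A = A'.
Proof.
move=> [/closed_adherent clA limA] [clA' limA'].
have dist K e : compact K -> 0 < e -> \forall m \near U, (hausdorff_dist_on K (B m) A < e%:E)%E.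
  move=> /limA lim e_gt0; apply: U_oo.
  have h : \forall x \near (0 : R), x < e by exact: lt_nbhsl.
  have /lim // : nbhs (0%E : \bar R) (fun z => (z < e%:E)%E).
  by case: h => d /= d_gt0 hd; exists d => //= x dx; rewrite lte_fin; exact: hd.
have scale (e : R) : 0 < e -> exists2 d : R, 0 < d & n%:R * d < e.
  move=> e_gt0; exists (e / n.+1%:R); first by rewrite divr_gt0.
  exact: scale_lt.
apply/seteqP; split=> r rA.
  apply: clA' => e e_gt0; have e2 : 0 < e / 2 by rewrite divr_gt0.
  have [d d_gt0 de] := scale _ e2.
  have [m [/= /hausdorff_dist_lt[_ _ h1] [h2 _]]] := filter_ex (filterI
    (dist [set r] d (@compact_set1 _ r) d_gt0) (limA' (nrm r + e / 2) _ e2)).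
  have [x Bx /ball_nrm xr] := h1 r rA erefl.
  have xr2 : nrm (x - r) < e / 2 by exact: le_lt_trans xr de.
  have [|r' A'r' r'x] := h2 x Bx.
    have := nrmD (x - r) r; rewrite subrK; lra.
  exists r' => //; have := nrmD (r' - x) (x - r); rewrite addrA subrK [nrm (r' - x)]nrmB.
  have := @splitr _ e; lra.
apply: clA => e e_gt0; have e2 : 0 < e / 2 by rewrite divr_gt0.
have [d d_gt0 de] := scale _ e2.
have e1 : 0 < Num.min 1 (e / 2) by rewrite lt_min ltr01.
have [m [/= /hausdorff_dist_lt[_ h1 _] [_ h2]]] := filter_ex (filterI
  (dist _ d (@compact_box r) d_gt0) (limA' (nrm r) _ e1)).
have [x Bx] := h2 r rA (lexx _); rewrite lt_min => /andP[xr1 xr2].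
have [|r' Ar' /ball_nrm r'x] := h1 x Bx.
  by move=> j; have := nrm_coord (x - r) j; rewrite !mxE; lra.
exists r' => //; have := nrmD (r' - x) (x - r); rewrite addrA subrK.
have := @splitr _ e; lra.
Qed.

(** A diagonal choice: [phi j] is an index beyond the previous one at which [B] and [A] agree up to
    [1 / (j + 1)] within radius [j]. *)
Lemma set_limit_subsequence B A : set_limit U B A -> exists2 phi : nat -> nat,
  {homo phi : i j / (i < j)%N} & hausdorff_limit (B \o phi) A.
Proof.
move=> [adh lim].
have /choice[f fP] : forall jN : nat * nat, exists m, (jN.2 < m)%N /\
    ((forall x, B m x -> nrm x <= jN.1%:R -> exists2 r, A r & nrm (x - r) < jN.1.+1%:R^-1) /\
     (forall r, A r -> nrm r <= jN.1%:R -> exists2 x, B m x & nrm (x - r) < jN.1.+1%:R^-1)).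
  move=> [j N] /=; have j_gt0 : 0 < j.+1%:R^-1 :> R by rewrite invr_gt0.
  by have [m [h1 h2]] := filter_ex (filterI (ultra_fine N.+1) (lim j%:R _ j_gt0)); exists m.
pose phi := fix phi j := if j is i.+1 then f (i.+1, phi i) else f (0%N, 0%N).
have phiP j : (forall x, B (phi j) x -> nrm x <= j%:R -> exists2 r, A r & nrm (x - r) < j.+1%:R^-1) /\
     (forall r, A r -> nrm r <= j%:R -> exists2 x, B (phi j) x & nrm (x - r) < j.+1%:R^-1).
  by case: j => [|j] /=; [case: (fP (0%N, 0%N))|case: (fP (j.+1, phi j))].
exists phi.
  by apply: homo_ltn => [? ? ?|j]; [exact: ltn_trans|case: (fP (j.+1, phi j))].
split; first exact/closed_adherent.
move=> K /compact_nrm[C KC].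
apply: (@squeeze_cvge _ _ _ _ (fun=> 0%E) _ (fun j => (j.+1%:R^-1 : R)%:E)).
- exists (Num.truncn C).+1 => //= j Cj.
  have Cj' : C <= j%:R.
    apply: ltW; apply: (lt_le_trans (truncnS_gt C)); rewrite ler_nat; exact: Cj.
  have [h1 h2] := phiP j; apply: hausdorff_dist_le => //.
    by move=> x Bx Kx; apply: h1 => //; exact: le_trans (KC x Kx) Cj'.
  by move=> y Ay Ky; apply: h2 => //; exact: le_trans (KC y Ky) Cj'.
- exact: cvg_cst.
apply: cvg_EFin; first by apply: nearW.
exact: cvg_harmonic.
Qed.

End HausdorffLimits.

Theorem theorem2p4 (R : realType) (n : nat) (Delta : seq 'rV[int]_n)
    (Delta_toric : toric_degree Delta)
    (t : nat -> R) (t_gt0 : forall m, 0 < t m)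
    (t_oo : t m @[m --> \oo] --> +oo) :
  (* (a) *)
  (forall f : nat -> curve_data R n (size Delta),
    (forall m, curve_of_degree (f m)) ->
    exists (phi : nat -> nat) (A : set 'rV[R]_n),
      {homo phi : i j / (i < j)%N} /\
      hausdorff_limit
        (fun m => Log_ (t (phi m)) @` curve_image (f (phi m))) A) /\
  (* (b) and (c) *)
  (exists L : forall (s : nat) (Deltas : 'I_s -> seq 'rV[int]_n),
      set (trop_tuple R Deltas),
    (forall (s : nat) (Deltas : 'I_s -> seq 'rV[int]_n),
      (1 < s)%N -> degeneration R Delta Deltas ->
      L s Deltas `<=` @parameter_space R n s Deltas /\
      dim_lt (L s Deltas) (n%:Z + (size Delta)%:Z - 3)) /\
    (forall f : nat -> curve_data R n (size Delta),
      (forall m, curve_of_degree (f m)) ->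
      forall (phi : nat -> nat) (A : set 'rV[R]_n),
      {homo phi : i j / (i < j)%N} ->
      hausdorff_limit
        (fun m => Log_ (t (phi m)) @` curve_image (f (phi m))) A ->
      exists (s : nat) (Deltas : 'I_s -> seq 'rV[int]_n)
          (h : trop_tuple R Deltas),
        [/\ degeneration R Delta Deltas,
            forall i, tropical_curve (h i),
            A = \bigcup_(i in [set: 'I_s]) trop_image (h i)
          & (1 < s)%N -> L s Deltas h])).
Proof.
have [U [UU U_oo]] := ultraFilterLemma (F := \oo) _.
split.
  move=> f f_deg.
  have [s [Deltas [h [_ _ lim _]]]] := tropical_limit_curves Delta_toric UU (ultra_fine U_oo) f_deg t_oo.
  have [phi phi_homo Aphi] := set_limit_subsequence UU U_oo lim.
  by exists phi, (\bigcup_(i in [set: 'I_s]) trop_image (h i)).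
exists (fun s Deltas => @small_locus R n Delta s Deltas); split.
  by move=> s Deltas _ _; split; [move=> h []|exact: small_locus_dim].
move=> f f_deg phi A phi_homo limA.
(* Hence [t (phi m)] still tends to infinity, and the subsequence is treated as a sequence of curves
   in its own right; its limit along [U] has to be [A]. *)
have phi_ge m : (m <= phi m)%N.
  elim: m => // m IH; exact: leq_ltn_trans IH (phi_homo _ _ (ltnSn m)).
have t_phi : t (phi m) @[m --> \oo] --> +oo.
  apply: cvg_comp t_oo => V [N _ NV]; exists N => // m /= Nm.
  exact: NV (leq_trans Nm (phi_ge m)).
have [s [Deltas [h [h1 h2 h3 h4]]]] := tropical_limit_curves Delta_toric UU (ultra_fine U_oo)
  (fun m => f_deg (phi m)) t_phi.
by exists s, Deltas, h; split=> //; exact: (set_limit_unique UU U_oo limA h3).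
Qed.
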